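(* Let $\mu$ be a complete, $\sigma$-finite, non-atomic measure on $(\Omega,\Sigma)$ and let $\varphi$ be a finite Orlicz function. Then the Orlicz space $L_\varphi$ over $(\Omega,\Sigma,\mu)$ (and likewise the Orlicz space $L_\varphi^0$ over $(\Omega,\Sigma,\mu)$) has the Radon-Nikodým property if and only if $\varphi$ is an $N$-function at infinity and $\varphi$ satisfies the appropriate $\Delta_2$ condition.
   Context: All spaces are real and $\mu(\Omega)>0$. An Orlicz function is a convex, left-continuous function $\varphi:[0,\infty)\to[0,\infty]$ with $\varphi(0)=0$, not identically zero and not identically infinite on $(0,\infty)$; it is finite if it does not take the value $\infty$. Its complementary function is $\varphi_*(u)=\sup_{v\ge0}\{uv-\varphi(v)\}$. $\varphi$ is an $N$-function at infinity if $\lim_{u\to\infty}\varphi(u)/u=\infty$. The appropriate $\Delta_2$ condition: if $\mu(\Omega)=\infty$, it is $\Delta_2$: there is $K>2$ with $\varphi(2u)\le K\varphi(u)$ for all $u\ge0$; if $\mu(\Omega)<\infty$, it is $\Delta_2^\infty$: there are $K>2$ and $u_0\ge0$ with $\varphi(u_0)<\infty$ and $\varphi(2u)\le K\varphi(u)$ for all $u\ge u_0$. For measurable $f:\Omega\to\mathbb{R}$ (modulo a.e. equality) let $I_\varphi(f)=\int_\Omega\varphi(|f|)\,d\mu$. The Orlicz space is the set of $f$ with $I_\varphi(\lambda f)<\infty$ for some $\lambda>0$. $L_\varphi$ denotes this space with the Luxemburg norm $\|f\|_\varphi=\inf\{\epsilon>0: I_\varphi(f/\epsilon)\le1\}$;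 $L_\varphi^0$ denotes it with the Orlicz norm $\|f\|_\varphi^0=\sup\{\int_\Omega fg\,d\mu: I_{\varphi_*}(g)\le1\}=\inf_{k>0}\frac1k(1+I_\varphi(kf))$. The measure space is not assumed to be separable. The Radon-Nikodým property is the classical one for Banach spaces; equivalently, every nonempty closed bounded convex subset of the space has slices of arbitrarily small diameter. *)

(* Defs.v *)
From HB Require Import structures.
From mathcomp Require Import all_boot all_order all_algebra.
From mathcomp Require Import generic_quotient ring_quotient ring lra.
From mathcomp Require Import all_classical all_reals all_analysis.
From mathcomp Require Import measurable_realfun.

Set Implicit Arguments.
Unset Strict Implicit.
Unset Printing Implicit Defensive.

Import Order.TTheory GRing.Theory Num.Theory.
Import numFieldTopology.Exports numFieldNormedType.Exports.

Local Open Scope classical_set_scope.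
Local Open Scope ring_scope.

(* A function on [0, +oo[ is encoded by a function on R whose values at
   negative reals are never used. In the convexity inequality, a term with
   zero coefficient and infinite value is 0, by the convention 0 * +oo = 0. *)
Definition is_orlicz_function (R : realType) (phi : R -> \bar R) : Prop :=
  [/\ phi 0 = 0%E,
      forall u : R, 0 <= u -> (0 <= phi u)%E,
      forall t u v : R, 0 <= t <= 1 -> 0 <= u -> 0 <= v ->
        (phi (t * u + (1 - t) * v)%R
          <= t%:E * phi u + (1 - t)%:E * phi v)%E,
      forall u : R, 0 < u -> phi x @[x --> u^'-] --> phi u &
      (exists2 u : R, 0 < u & phi u != 0%E) /\ (exists2 u : R, 0 < u & phi u != +oo%E)].

Record orlicz_function (R : realType) := OrliczFunction {
  orlicz_fun :> R -> \bar R;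
  orlicz_funP : is_orlicz_function orlicz_fun }.

Definition finite_orlicz (R : realType) (phi : R -> \bar R) : Prop :=
  forall u : R, 0 <= u -> (phi u < +oo)%E.

Definition complementary (R : realType) (phi : R -> \bar R) (u : R) : \bar R :=
  ereal_sup [set ((u * v)%:E - phi v)%E | v in [set v : R | 0 <= v]].

Definition N_function_at_infinity (R : realType) (phi : R -> \bar R) : Prop :=
  (phi u * (u^-1)%:E)%E @[u --> +oo] --> +oo%E.

Definition Delta2 (R : realType) (phi : R -> \bar R) : Prop :=
  exists2 K : R, 2 < K & forall u : R, 0 <= u -> (phi (2 * u)%R <= K%:E * phi u)%E.

Definition Delta2_infty (R : realType) (phi : R -> \bar R) : Prop :=
  exists K u0 : R, [/\ 2 < K, 0 <= u0, (phi u0 < +oo)%E &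
    forall u : R, u0 <= u -> (phi (2 * u)%R <= K%:E * phi u)%E].

Definition appropriate_Delta2 d (T : measurableType d) (R : realType)
    (mu : set T -> \bar R) (phi : R -> \bar R) : Prop :=
  (mu setT = +oo%E -> Delta2 phi) /\ ((mu setT < +oo)%E -> Delta2_infty phi).

Definition non_atomic d (T : measurableType d) (R : realType)
    (mu : set T -> \bar R) : Prop :=
  forall A, measurable A -> (0 < mu A)%E ->
    exists B, [/\ measurable B, B `<=` A, (0 < mu B)%E & (mu B < mu A)%E].

Section modular.
Context d (T : measurableType d) (R : realType).
Implicit Types (mu : {measure set T -> \bar R}) (phi : R -> \bar R) (f : T -> R).

Definition modular mu phi f : \bar R := (\int[mu]_x phi (`|f x|)%R)%E.

Definition luxemburg_norm mu phi f : R :=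
  inf [set e : R | 0 < e /\ (modular mu phi (fun x => f x / e)%R <= 1)%E].

Definition orlicz_norm mu phi f : R :=
  fine (ereal_sup [set (\int[mu]_x (f x * g x)%:E)%E | g in
    [set g : T -> R | measurable_fun setT g /\
                      (modular mu (complementary phi) g <= 1)%E]]).

End modular.

(* The properties shared by an Orlicz function and its complementary function
   on which the normed space structures rely. *)
Definition gauge (R : realType) (psi : R -> \bar R) : Prop :=
  [/\ psi 0 = 0%E,
      forall u : R, 0 <= u -> (0 <= psi u)%E,
      forall u v : R, 0 <= u -> u <= v -> (psi u <= psi v)%E &
      forall t u v : R, 0 <= t <= 1 -> 0 <= u -> 0 <= v ->
        (psi (t * u + (1 - t) * v)%R
          <= t%:E * psi u + (1 - t)%:E * psi v)%E].

Section gauge_lemmas.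
Context (R : realType).
Implicit Types (psi : R -> \bar R) (phi : orlicz_function R).

Lemma gauge_contract psi t u : psi 0 = 0%E ->
  (forall t u v : R, 0 <= t <= 1 -> 0 <= u -> 0 <= v ->
        (psi (t * u + (1 - t) * v)%R
          <= t%:E * psi u + (1 - t)%:E * psi v)%E) ->
  0 <= t <= 1 -> 0 <= u -> (psi (t * u)%R <= t%:E * psi u)%E.
Proof.
move=> p0 pc t01 u0.
by have := pc t u 0 t01 u0 (lexx _); rewrite mulr0 addr0 p0 mule0 adde0.
Qed.

Lemma orlicz_gauge phi : gauge phi.
Proof.
have [p0 pge0 pc _ _] := orlicz_funP phi; split => // u v u0 uv.
have [v0|v0] := ltP 0 v; last first.
  by have -> : u = v by apply/le_anti; rewrite uv (le_trans v0).
have -> : u = u / v * v by rewrite divfK// gt_eqF.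
have t01 : 0 <= u / v <= 1 by rewrite divr_ge0 ?(ltW v0)//= ler_pdivrMr// mul1r.
apply: le_trans (gauge_contract p0 pc t01 (ltW v0)) _.
case/andP: t01 => _ t1; apply: gee_pMl => //; first exact/pge0/ltW.

Qed.

Lemma complementary_ge phi u v : 0 <= v ->
  ((u * v)%:E - phi v <= complementary phi u)%E.
Proof. by move=> v0; apply: ereal_sup_ubound; exists v. Qed.

Lemma complementary_ge0 phi u : (0 <= complementary phi u)%E.
Proof.
have [p0 _ _ _ _] := orlicz_funP phi.
by apply: le_trans (complementary_ge phi u (lexx 0)); rewrite mulr0 p0 sube0.
Qed.

Lemma complementary_gauge phi : gauge (complementary phi).
Proof.
have [p0 pge0 pc _ _] := orlicz_funP phi; split.
- apply/eqP; rewrite eq_le complementary_ge0 andbT.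
  apply: ge_ereal_sup => _ [v v0 <-]; rewrite mul0r.
  by rewrite sub0e oppe_le0 pge0.
- by move=> u _; exact: complementary_ge0.
- move=> u v u0 uv; apply: ge_ereal_sup => _ [w w0 <-].
  apply: le_trans (complementary_ge phi v w0).
  by rewrite leeB// lee_fin ler_wpM2r.
- move=> t u v /andP[t0 t1] u0 v0; apply: ge_ereal_sup => _ [w w0 <-].
  have t1' : 0 <= 1 - t by rewrite subr_ge0.
  have := complementary_ge phi u w0; have := complementary_ge phi v w0.
  have := pge0 _ w0; case: (phi w) => [r| |] // _.
  + move=> hv hu.
    apply: (@le_trans _ _ (t%:E * ((u * w)%:E - r%:E)
                           + (1 - t)%:E * ((v * w)%:E - r%:E))%E).
      by rewrite -!EFinB -!EFinM -EFinD lee_fin; lra.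
    by apply: leeD; apply: lee_wpmul2l; rewrite ?lee_fin.
  + by move=> _ _; rewrite addeNy leNye.
Qed.

Lemma young phi u v : 0 <= u -> 0 <= v ->
  ((u * v)%:E <= phi u + complementary phi v)%E.
Proof.
have [p0 pge0 pc _ _] := orlicz_funP phi => u0 v0.
have := complementary_ge phi v u0; have := complementary_ge0 phi v.
have := pge0 _ u0; case: (phi u) => [r| |] //=.
  move=> _ _ h; rewrite mulrC -(@leeD2rE _ (- r%:E)%E)//.
  by rewrite [X in (_ <= X)%E]addeAC subee// add0e.
by move=> _ c0 _; rewrite addye ?leey// gt_eqF// (lt_le_trans _ c0) ?ltNy0.
Qed.

End gauge_lemmas.

Section modular_lemmas.
Context d (T : measurableType d) (R : realType).
Variables (mu : {measure set T -> \bar R}) (psi : R -> \bar R).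
Hypothesis psiG : gauge psi.
Implicit Types (f g : T -> R) (t u v : R).

Let psi0 : psi 0 = 0%E. Proof. by case: psiG. Qed.
Let psi_ge0 u : 0 <= u -> (0 <= psi u)%E. Proof. by case: psiG => _ + _ _; exact. Qed.
Let psi_le u v : 0 <= u -> u <= v -> (psi u <= psi v)%E.
Proof. by case: psiG => _ _ + _; exact. Qed.

Lemma gauge_measurable f : measurable_fun setT f ->
  measurable_fun setT (fun x => psi `|f x|).
Proof.
move=> mf; suff h : measurable_fun setT (fun u : R => psi (Num.max 0 u)).
  rewrite (_ : (fun x => _) = (fun u : R => psi (Num.max 0 u)) \o (fun x => `|f x|)).
    by apply: measurableT_comp => //; exact: measurableT_comp.
  by apply/funext => x /=; rewrite (max_idPr _).
move=> _; apply: (measurability _ (ErealGenCInfty.measurableE R)) => //.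
move=> _ [_ [y ->] <-]; rewrite setTI.
apply: is_interval_measurable => a b /=.
rewrite !in_itv/= !andbT => ha hb c /andP[ac cb].
have c0 : 0 <= Num.max 0 a by rewrite le_max lexx.
rewrite in_itv/= andbT; apply: le_trans ha (psi_le c0 _).
by rewrite ge_max !le_max lexx ac/= orbT.
Qed.

Lemma modular_ge0 f : (0 <= modular mu psi f)%E.
Proof. by apply: integral_ge0 => x _; exact: psi_ge0. Qed.

Lemma le_modular f g : measurable_fun setT f -> measurable_fun setT g ->
  (forall x, `|f x| <= `|g x|) -> (modular mu psi f <= modular mu psi g)%E.
Proof.
move=> mf mg fg; apply: ge0_le_integral => //.
- by move=> x _; exact: psi_ge0.
- exact: gauge_measurable.
- exact: gauge_measurable.
- by move=> x _; exact: psi_le.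
Qed.

Lemma modular_convex t f g : 0 <= t <= 1 ->
  measurable_fun setT f -> measurable_fun setT g ->
  (modular mu psi (fun x => t * f x + (1 - t) * g x)%R
    <= t%:E * modular mu psi f + (1 - t)%:E * modular mu psi g)%E.
Proof.
move=> t01 mf mg; have /andP[t0 t1] := t01.
have t1' : 0 <= 1 - t by rewrite subr_ge0.
rewrite /modular -!ge0_integralZl//; last first.
- by move=> x _; exact: psi_ge0.
- exact: gauge_measurable.
- by move=> x _; exact: psi_ge0.
- exact: gauge_measurable.
have mpf := gauge_measurable mf; have mpg := gauge_measurable mg.
rewrite -ge0_integralD//; last first.
- exact: measurable_funeM.
- by move=> x _; rewrite mule_ge0 ?psi_ge0.
- exact: measurable_funeM.
- by move=> x _; rewrite mule_ge0 ?psi_ge0.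
apply: ge0_le_integral => //.
- by move=> x _; exact: psi_ge0.
- apply: gauge_measurable; apply: measurable_funD; exact: measurable_funM.
- by apply: emeasurable_funD; exact: measurable_funeM.
move=> x _; have [_ _ _ pc] := psiG.
apply: le_trans (pc t _ _ t01 (normr_ge0 (f x)) (normr_ge0 (g x))).
apply: psi_le => //; apply: le_trans (ler_normD _ _) _.
by rewrite !normrM (ger0_norm t0) (ger0_norm t1').
Qed.

Lemma modular0 : modular mu psi (fun=> 0) = 0%E.
Proof. by rewrite /modular; under eq_integral do rewrite normr0 psi0; rewrite integral0. Qed.

Lemma modular_contract t f : 0 <= t <= 1 -> measurable_fun setT f ->
  (modular mu psi (fun x => t * f x)%R <= t%:E * modular mu psi f)%E.
Proof.
move=> t01 mf; have := modular_convex t01 mf (measurable_cst (0 : R)).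
rewrite modular0 mule0 adde0; apply: le_trans.
by under [X in (_ <= modular _ _ X)%E]eq_fun do rewrite mulr0 addr0.
Qed.

Lemma ae_eq_modular f g : measurable_fun setT f -> measurable_fun setT g ->
  f = g %[ae mu] -> modular mu psi f = modular mu psi g.
Proof.
move=> mf mg fg; apply: ge0_ae_eq_integral => //.
- exact: gauge_measurable.
- exact: gauge_measurable.
- by move=> x _; exact: psi_ge0.
- by move=> x _; exact: psi_ge0.
- by apply: filterS fg => x fg xT; rewrite fg.
Qed.

Lemma modular_ae_eq0 f : (exists2 u : R, 0 < u & psi u != 0%E) ->
  measurable_fun setT f ->
  (forall n : nat, (modular mu psi (fun x => n%:R * f x)%R <= 1)%E) ->
  f = 0 %[ae mu].
Proof.
move=> [u u0 pu] mf h.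
have mnf n : measurable_fun setT (fun x => n%:R * f x) by exact: measurable_funM.
have z n : modular mu psi (fun x => n%:R * f x) = 0%E.
  have b (k : nat) : (modular mu psi (fun x => n%:R * f x)%R <= (k.+1%:R^-1)%:E)%E.
    have t01 : 0 <= (k.+1%:R^-1 : R) <= 1.
      by rewrite invr_ge0 ler0n/= invf_le1// ler1n.
    have := modular_contract t01 (mnf (k.+1 * n)%N).
    rewrite (_ : (fun x => _) = (fun x => n%:R * f x)); last first.
      by apply/funext => x; rewrite natrM !mulrA mulVf// mul1r.
    move/le_trans; apply; rewrite -[leRHS]mule1; apply: lee_wpmul2l; last exact: h.
    by case/andP: t01.
  apply/eqP; rewrite eq_le modular_ge0 andbT.
  apply/lee_addgt0Pr => e e0; rewrite add0e.
  have [k] := ltr_add_invr e0; rewrite add0r => /ltW ke.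
  by apply: le_trans (b k) _; rewrite lee_fin.
have aez n : (fun x => psi `|n%:R * f x|) = cst 0%E %[ae mu].
  apply/(ae_eq_integral_abs mu measurableT (gauge_measurable (mnf n))).
  by rewrite -[RHS](z n); apply: eq_integral => x _; rewrite gee0_abs// psi_ge0.
apply: filterS (ae_foralln aez) => x hx _.
apply/eqP; apply: contraT => fx0; have fx : 0 < `|f x| by rewrite normr_gt0.
have [n nu] : exists n : nat, u <= n%:R * `|f x|.
  exists (Num.truncn (u / `|f x|)).+1.
  by rewrite -ler_pdivrMr// ltW// truncnS_gt.
have := hx n I; rewrite /= normrM normr_nat => e.
suff pu0 : psi u = 0%E by rewrite pu0 eqxx in pu.
by apply/le_anti/andP; split; [rewrite -e; apply: psi_le => //|apply: psi_ge0]; exact: ltW.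
Qed.

End modular_lemmas.

Definition orlicz_class d (T : measurableType d) (R : realType)
    (mu : {measure set T -> \bar R}) (phi : R -> \bar R) : {pred T -> R} :=
  mem [set f : T -> R | measurable_fun setT f /\
    exists2 l : R, 0 < l & (modular mu phi (fun x => l * f x)%R < +oo)%E].

Section orlicz_class_lemmas.
Context d (T : measurableType d) (R : realType).
Variables (mu : {measure set T -> \bar R}) (phi : orlicz_function R).
Implicit Types (f g : T -> R) (c l : R).

Let phiG : gauge phi. Proof. exact: orlicz_gauge. Qed.

Lemma orlicz_classP f : reflect (measurable_fun setT f /\
    exists2 l : R, 0 < l & (modular mu phi (fun x => l * f x)%R < +oo)%E)
  (f \in orlicz_class mu phi).
Proof. by apply: (iffP idP) => [|h]; rewrite ?inE//; exact: mem_set. Qed.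

Lemma orlicz_class_measurable f : f \in orlicz_class mu phi -> measurable_fun setT f.
Proof. by case/orlicz_classP. Qed.

Lemma orlicz_class_submod_closed : submod_closed (orlicz_class mu phi).
Proof.
split.
  apply/orlicz_classP; split; first exact: (measurable_cst (0 : R)).
  exists 1 => //; under [X in modular _ _ X]eq_fun do rewrite mulr0.
  by rewrite modular0.
move=> c f g /orlicz_classP[mf [k k0 kf]] /orlicz_classP[mg [l l0 lg]].
have mcf : measurable_fun setT (fun x => c * f x) by exact: measurable_funM.
apply/orlicz_classP; split; first exact: measurable_funD.
have c1 : 0 < `|c| + 1 by rewrite ltr_wpDl.
pose m := Num.min (k / (`|c| + 1)) l.
have m0 : 0 < m by rewrite lt_min divr_gt0.
exists (2^-1 * m); first by rewrite mulr_gt0.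
have half01 : 0 <= (2^-1 : R) <= 1 by lra.
have -> : (fun x => 2^-1 * m * (c *: f + g) x) =
    (fun x => 2^-1 * (m * c * f x) + (1 - 2^-1) * (m * g x)).
  by apply/funext => x; rewrite !fctE /GRing.scale/=; field.
have mkf : measurable_fun setT (fun x => k * f x) by exact: measurable_funM.
have mlg : measurable_fun setT (fun x => l * g x) by exact: measurable_funM.
have mmf : measurable_fun setT (fun x => m * c * f x) by exact: measurable_funM.
have mmg : measurable_fun setT (fun x => m * g x) by exact: measurable_funM.
apply: le_lt_trans (modular_convex mu phiG half01 mmf mmg) _.
have mk : m * (`|c| + 1) <= k by rewrite -ler_pdivlMr// ge_min lexx.
have hf : (modular mu phi (fun x => m * c * f x)%R < +oo)%E.
  apply: le_lt_trans kf; apply: le_modular => // x.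
  rewrite !normrM ler_wpM2r// (gtr0_norm k0) (gtr0_norm m0).
  by apply: le_trans mk; rewrite ler_wpM2l// ?ltW// ltrDl.
have hg : (modular mu phi (fun x => m * g x)%R < +oo)%E.
  apply: le_lt_trans lg; apply: le_modular => // x.
  by rewrite !normrM ler_wpM2r// (gtr0_norm l0) (gtr0_norm m0) ge_min lexx orbT.
by rewrite lte_add_pinfty// lte_mul_pinfty ?modular_ge0// lee_fin; lra.
Qed.

Let lux f := [set e : R | 0 < e /\ (modular mu phi (fun x => f x / e)%R <= 1)%E].

Let lux_lb f : has_lbound (lux f).
Proof. by exists 0 => e [/ltW]. Qed.

Let lux_neq0 f : f \in orlicz_class mu phi -> lux f !=set0.
Proof.
move=> /orlicz_classP[mf [l l0]].
set M := modular _ _ _ => Moo; have M0 : (0 <= M)%E by exact: modular_ge0.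
have Mfin : M \is a fin_num by rewrite ge0_fin_numE.
have M1 : 0 < 1 + fine M by rewrite ltr_pwDl// fine_ge0.
have t01 : 0 <= (1 + fine M)^-1 <= 1.
  by rewrite invr_ge0 ltW//= invf_le1// lerDl fine_ge0.
exists ((1 + fine M) / l); split; first by rewrite divr_gt0.
have mlf : measurable_fun setT (fun x => l * f x) by exact: measurable_funM.
have := modular_contract mu phiG t01 mlf; rewrite -/M => h.
have -> : (fun x => f x / ((1 + fine M) / l)) =
    (fun x => (1 + fine M)^-1 * (l * f x)).
  by apply/funext => x; field; rewrite !gt_eqF.
apply: le_trans h _; rewrite -(fineK Mfin) -EFinM lee_fin.
by rewrite mulrC ler_pdivrMr// mul1r lerDr.
Qed.

Lemma luxemburg_normD f g : f \in orlicz_class mu phi ->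
  g \in orlicz_class mu phi ->
  luxemburg_norm mu phi (f + g) <= luxemburg_norm mu phi f + luxemburg_norm mu phi g.
Proof.
move=> fO gO; have mf := orlicz_class_measurable fO.
have mg := orlicz_class_measurable gO.
rewrite -lerBlDl; apply: lb_le_inf; first exact: lux_neq0.
move=> b [b0 hb]; rewrite lerBlDl -lerBlDr.
apply: lb_le_inf; first exact: lux_neq0.
move=> a [a0 ha]; rewrite lerBlDr; apply: ge_inf; first exact: lux_lb.
have ab : 0 < a + b by rewrite addr_gt0.
split=> //.
have t01 : 0 <= a / (a + b) <= 1.
  by rewrite ler_pdivrMr// mul1r lerDl (ltW b0) divr_ge0// ltW.
have -> : (fun x => (f + g) x / (a + b)) =
    (fun x => a / (a + b) * (f x / a) + (1 - a / (a + b)) * (g x / b)).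
  by apply/funext => x; rewrite fctE; field; rewrite !gt_eqF.
have mfa : measurable_fun setT (fun x => f x / a) by exact: measurable_funM.
have mgb : measurable_fun setT (fun x => g x / b) by exact: measurable_funM.
apply: le_trans (modular_convex mu phiG t01 mfa mgb) _.
have /andP[t0 t1] := t01.
have -> : (1 = (a / (a + b))%:E * 1 + (1 - a / (a + b))%:E * 1 :> \bar R)%E.
  by rewrite !mule1 -EFinD addrC subrK.
by apply: leeD; apply: lee_wpmul2l; rewrite ?lee_fin ?subr_ge0.
Qed.

Lemma luxemburg_normZ c f : f \in orlicz_class mu phi ->
  luxemburg_norm mu phi (c *: f) = `|c| * luxemburg_norm mu phi f.
Proof.
have Z a h : a != 0 -> h \in orlicz_class mu phi ->
    luxemburg_norm mu phi (a *: h) <= `|a| * luxemburg_norm mu phi h.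
  move=> a0 hO; have mh := orlicz_class_measurable hO.
  have na0 : 0 < `|a| by rewrite normr_gt0.
  rewrite mulrC -ler_pdivrMr//; apply: lb_le_inf; first exact: lux_neq0.
  move=> e [e0 he]; rewrite ler_pdivrMr//; apply: ge_inf; first exact: lux_lb.
  split; first by rewrite mulr_gt0.
  apply: le_trans he; apply: le_modular => //.
  - apply: measurable_funM => //; exact: measurable_funM.
  - exact: measurable_funM.
  - move=> x; rewrite fctE /GRing.scale/= !normrM !normfV normrM normr_id.
    rewrite invfM [X in _ * X]mulrC mulrACA mulfV ?gt_eqF// mul1r//.
move=> fO; have [->|c0] := eqVneq c 0.
  rewrite normr0 mul0r scale0r; apply/eqP; rewrite eq_le; apply/andP; split.
    apply/ler_addgt0Pr => e e0; rewrite add0r; apply: ge_inf; first exact: lux_lb.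
    split => //; under [X in modular _ _ X]eq_fun do rewrite mul0r.
    by rewrite modular0.
  apply: lb_le_inf; last by move=> e [/ltW].
  by apply: lux_neq0; case: orlicz_class_submod_closed.
have cfO : c *: f \in orlicz_class mu phi.
  have [c0O /(_ c f 0 fO)] := orlicz_class_submod_closed.
  by rewrite addr0; apply.
apply/eqP; rewrite eq_le Z//= mulrC -ler_pdivlMr ?normr_gt0//.
have := Z c^-1 _ (invr_neq0 c0) cfO.
by rewrite scalerA mulVf// scale1r normfV mulrC.
Qed.

Lemma luxemburg_norm_eq0 f : f \in orlicz_class mu phi ->
  luxemburg_norm mu phi f = 0 -> f = 0 %[ae mu].
Proof.
move=> fO f0; have mf := orlicz_class_measurable fO.
have [_ _ _ _ [phin0 _]] := orlicz_funP phi.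
apply: (modular_ae_eq0 phiG phin0 mf) => n.
have n0 : 0 < (n.+1%:R^-1 : R) by rewrite invr_gt0.
have : has_inf (lux f) by split; [exact: lux_neq0|exact: lux_lb].
move=> /(inf_adherent n0)[e [e0 he]].
rewrite [inf _]f0 add0r => en.
apply: le_trans he; apply: le_modular => //.
- exact: measurable_funM.
- exact: measurable_funM.
- move=> x; rewrite !normrM normr_nat mulrC ler_wpM2l// gtr0_norm ?invr_gt0//.
  apply: (@le_trans _ _ n.+1%:R); first by rewrite ler_nat.
  by rewrite -(invrK n.+1%:R) lef_pV2 ?posrE ?invr_gt0// ltW.
Qed.

Lemma ae_eq_luxemburg_norm f g : measurable_fun setT f -> measurable_fun setT g ->
  f = g %[ae mu] -> luxemburg_norm mu phi f = luxemburg_norm mu phi g.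
Proof.
move=> mf mg fg; congr inf; apply/seteqP.
have h e : modular mu phi (fun x => f x / e) = modular mu phi (fun x => g x / e).
  apply: ae_eq_modular => //; [exact: measurable_funM..|].
  by apply: filterS fg => x fg xT; rewrite fg.
by split => e [e0]; rewrite ?h => ?; split => //; rewrite ?h.
Qed.

End orlicz_class_lemmas.

Section orlicz_norm_lemmas.
Context d (T : measurableType d) (R : realType).
Variables (mu : {measure set T -> \bar R}) (phi : orlicz_function R).
Implicit Types (f g h : T -> R) (c l : R).

Let phiG : gauge phi. Proof. exact: orlicz_gauge. Qed.
Let psiG : gauge (complementary phi). Proof. exact: complementary_gauge. Qed.

Let G := [set g : T -> R | measurable_fun setT g /\
                      (modular mu (complementary phi) g <= 1)%E].
Let S f := [set (\int[mu]_x (f x * g x)%:E)%E | g in G].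

Lemma orlicz_pairing f : f \in orlicz_class mu phi ->
  exists2 C : R, 0 <= C & forall g, G g ->
    mu.-integrable setT (fun x => (f x * g x)%:E) /\
    (`| \int[mu]_x (f x * g x)%:E | <= C%:E)%E.
Proof.
move=> /orlicz_classP[mf [l l0]].
set M := modular _ _ _ => Moo; have M0 : (0 <= M)%E by exact: modular_ge0.
have Mfin : M \is a fin_num by rewrite ge0_fin_numE.
have mlf : measurable_fun setT (fun x => l * f x) by exact: measurable_funM.
have li0 : 0 <= l^-1 by rewrite invr_ge0 ltW.
exists (l^-1 * (fine M + 1)).
  by rewrite mulr_ge0// addr_ge0// fine_ge0.
move=> g [mg g1].
have mfg : measurable_fun setT (fun x => (f x * g x)%:E).
  by apply/measurable_EFinP; exact: measurable_funM.
have m1 := gauge_measurable phiG mlf; have m2 := gauge_measurable psiG mg.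
have [_ phi0 _ _] := phiG; have [_ psi0 _ _] := psiG.
have bnd : (\int[mu]_x `|(f x * g x)%:E| <= (l^-1 * (fine M + 1))%:E)%E.
  apply: (@le_trans _ _ (\int[mu]_x (l^-1%:E * (phi `|l * f x|%R + complementary phi `|g x|%R)))%E).
    apply: ge0_le_integral => //.
    - exact: measurableT_comp.
    - by apply: measurable_funeM; exact: emeasurable_funD.
    - move=> x _; have := young phi (normr_ge0 (l * f x)) (normr_ge0 (g x)).
      move=> /(lee_wpmul2l (x := l^-1%:E)); rewrite lee_fin => /(_ li0).
      apply: le_trans; rewrite -EFinM lee_fin !normrM (gtr0_norm l0).
      by rewrite -!mulrA mulKf// gt_eqF.
  rewrite ge0_integralZl//; last 2 first.
  - exact: emeasurable_funD.
  - by move=> x _; rewrite adde_ge0 ?phi0 ?psi0.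
  rewrite ge0_integralD//; last 2 first.
  - by move=> x _; exact: phi0.
  - by move=> x _; exact: psi0.
  rewrite EFinM; apply: lee_wpmul2l; first by rewrite lee_fin.
  by rewrite EFinD fineK//; apply: leeD.
split; last exact: le_trans (le_abse_integral _ _ _) bnd.
by apply/integrableP; split => //; apply: le_lt_trans bnd _; rewrite ltry.
Qed.

Let G0 : G (fun=> 0).
Proof. by split; [exact: measurable_cst|rewrite modular0]. Qed.

Lemma orlicz_norm_fin f : f \in orlicz_class mu phi ->
  ((orlicz_norm mu phi f)%:E = ereal_sup (S f))%E.
Proof.
move=> /orlicz_pairing[C C0 hC]; rewrite /orlicz_norm fineK// fin_numElt.
apply/andP; split.
  apply: (@lt_le_trans _ _ 0%E) => //; apply: ereal_sup_ubound.
  by exists (fun=> 0) => //; under eq_integral do rewrite mulr0; rewrite integral0.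
apply: (@le_lt_trans _ _ C%:E); last by rewrite ltry.
by apply: ge_ereal_sup => _ [g gG <-]; apply: le_trans (lee_abs _) (hC g gG).2.
Qed.

Let orlicz_norm_ub f g : f \in orlicz_class mu phi -> G g ->
  (\int[mu]_x (f x * g x)%:E <= (orlicz_norm mu phi f)%:E)%E.
Proof. by move=> fO gG; rewrite orlicz_norm_fin//; apply: ereal_sup_ubound; exists g. Qed.

Let orlicz_norm_lub f (C : R) : f \in orlicz_class mu phi ->
  (forall g, G g -> (\int[mu]_x (f x * g x)%:E <= C%:E)%E) ->
  orlicz_norm mu phi f <= C.
Proof.
move=> fO h; rewrite -lee_fin orlicz_norm_fin//.
by apply: ge_ereal_sup => _ [g gG <-]; exact: h.
Qed.

Lemma orlicz_class_linear c f g : f \in orlicz_class mu phi ->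
  g \in orlicz_class mu phi -> c *: f + g \in orlicz_class mu phi.
Proof. by case: (orlicz_class_submod_closed mu phi) => _ /(_ c f g) + fO gO; apply. Qed.

Lemma orlicz_class0 : 0 \in orlicz_class mu phi.
Proof. by case: (orlicz_class_submod_closed mu phi). Qed.

Lemma orlicz_normD f g : f \in orlicz_class mu phi ->
  g \in orlicz_class mu phi ->
  orlicz_norm mu phi (f + g) <= orlicz_norm mu phi f + orlicz_norm mu phi g.
Proof.
move=> fO gO; apply: orlicz_norm_lub.
  by rewrite -[f]scale1r orlicz_class_linear.
move=> h hG; have [Cf _ /(_ h hG)[fh _]] := orlicz_pairing fO.
have [Cg _ /(_ h hG)[gh _]] := orlicz_pairing gO.
under eq_integral do rewrite fctE mulrDl EFinD.
by rewrite integralD// EFinD leeD// orlicz_norm_ub.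
Qed.

Lemma orlicz_normZ c f : f \in orlicz_class mu phi ->
  orlicz_norm mu phi (c *: f) = `|c| * orlicz_norm mu phi f.
Proof.
have Z a k : k \in orlicz_class mu phi ->
    orlicz_norm mu phi (a *: k) <= `|a| * orlicz_norm mu phi k.
  move=> kO; apply: orlicz_norm_lub.
    by rewrite -[_ *: _]addr0 orlicz_class_linear// orlicz_class0.
  move=> g [mg g1]; pose h x := Num.sg a * g x.
  have mh : measurable_fun setT h by exact: measurable_funM.
  have hG : G h.
    split => //; apply: le_trans g1; apply: le_modular => // x.
    rewrite normrM normr_sg; case: (a != 0); first by rewrite mul1r.
    by rewrite mul0r.
  have [C _ /(_ h hG)[kh _]] := orlicz_pairing kO.
  rewrite (_ : (\int[mu]_x _)%E = (\int[mu]_x (`|a|%:E * (k x * h x)%:E))%E).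
    by rewrite integralZl// EFinM lee_wpmul2l// orlicz_norm_ub.
  apply: eq_integral => x _; rewrite -EFinM /h fctE /GRing.scale/=.
  by rewrite [in LHS](numEsg a); congr EFin; ring.
move=> fO; apply/eqP; rewrite eq_le Z//=.
have [->|c0] := eqVneq c 0.
  rewrite normr0 mul0r scale0r -lee_fin orlicz_norm_fin ?orlicz_class0//.
  apply: ereal_sup_ubound; exists (fun=> 0) => //.
  by under eq_integral do rewrite mulr0; rewrite integral0.
rewrite mulrC -ler_pdivlMr ?normr_gt0//.
have cfO : c *: f \in orlicz_class mu phi.
  by rewrite -[_ *: _]addr0 orlicz_class_linear// orlicz_class0.
have := Z c^-1 _ cfO.
by rewrite scalerA mulVf// scale1r normfV mulrC.
Qed.

Let complementary_small (M : R) : 0 <= M ->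
  exists2 t : R, 0 < t & (complementary phi t * M%:E <= 1)%E.
Proof.
move=> M0; have [p0 phi0 phi_le phi_c] := phiG.
have [_ _ _ _ [[u u0 pu] _]] := orlicz_funP phi.
have [p pp pphi] : exists2 p : R, 0 < p & (p%:E <= phi u)%E.
  have := phi0 _ (ltW u0); case: (phi u) pu => [r| |] //.
    by rewrite eqe lee_fin => r0 r1; exists r => //; rewrite lt_neqAle eq_sym r0.
  by move=> _ _; exists 1 => //; rewrite leey.
have pu0 : 0 < p / u by rewrite divr_gt0.
have hp : (complementary phi (p / u) <= p%:E)%E.
  apply: ge_ereal_sup => _ [v v0 <-].
  have [uv|vu] := leP u v; last first.
    apply: (@le_trans _ _ (p / u * v)%:E); first by rewrite geeDl// oppe_le0 phi0.
    by rewrite lee_fin mulrAC ler_pdivrMr// ler_wpM2l// ltW.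
  have v0' : 0 < v by exact: lt_le_trans uv.
  apply: (@le_trans _ _ 0%E); last by rewrite lee_fin ltW.
  have t01 : 0 <= u / v <= 1.
    by rewrite ler_pdivrMr// mul1r uv divr_ge0// ltW.
  have := gauge_contract p0 phi_c t01 v0; rewrite divfK ?gt_eqF// => h.
  have := le_trans pphi h; have := phi0 _ v0.
  case: (phi v) => [r| |] // _; rewrite -?EFinM ?lee_fin.
    rewrite subr_le0 [p / u * v]mulrAC ler_pdivrMr// => h'.
    by rewrite -ler_pdivlMr//; apply: le_trans h' _; rewrite mulrAC (mulrC u).
pose s := (1 + p * M)^-1.
have sp : 0 < 1 + p * M by rewrite ltr_pwDl// mulr_ge0// ltW.
have s0 : 0 < s by rewrite invr_gt0.
exists (s * (p / u)); first by rewrite mulr_gt0.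
have [q0 _ _ psi_c] := psiG.
have s01 : 0 <= s <= 1 by rewrite (ltW s0)/= invf_le1// lerDl mulr_ge0// ltW.
have := gauge_contract q0 psi_c s01 (ltW pu0) => h.
apply: (@le_trans _ _ ((s * p)%:E * M%:E)%E).
  apply: lee_wpmul2r; first by rewrite lee_fin.
  by apply: le_trans h _; rewrite EFinM; apply: lee_wpmul2l; rewrite ?lee_fin ?(ltW s0).
by rewrite -EFinM lee_fin -mulrA mulrC ler_pdivrMr// mul1r lerDr.
Qed.

Let orlicz_norm_le0 f : sigma_finite setT mu -> f \in orlicz_class mu phi ->
  orlicz_norm mu phi f = 0 -> {ae mu, forall x, f x <= 0}.
Proof.
move=> [F UF FP] fO f0; have mf := orlicz_class_measurable fO.
have [q0 psi0 psi_le psi_c] := psiG.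
have h n : {ae mu, forall x, F n x -> f x <= 0}.
  have [mF Foo] := FP n.
  pose B := F n `&` [set x | 0 < f x].
  have mB : measurable B.
    apply: measurableI => //; rewrite -[X in measurable X]setTI.
    have -> : [set x | 0 < f x] = f @^-1` `]0, +oo[%classic.
      by apply/seteqP; split=> x /=; rewrite in_itv/= andbT.
    exact: mf.
  have Boo : (mu B < +oo)%E.
    by apply: le_lt_trans Foo; apply: le_measure; rewrite ?inE//; exact: subIsetl.
  have Bfin : mu B \is a fin_num by rewrite ge0_fin_numE.
  have [t t0 ht] := complementary_small (fine_ge0 (measure_ge0 mu B)).
  rewrite fineK// in ht.
  pose g x := t * \1_B x.
  have mg : measurable_fun setT g by apply: measurable_funM => //; exact: measurable_indic.
  have gG : G g.
    split => //; apply: le_trans ht; rewrite /modular.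
    under eq_integral => x _.
      rewrite (_ : complementary _ _ = complementary phi t * (\1_B x)%:E)%E; last first.
        rewrite /g indicE; case: (x \in B); last by rewrite mulr0 normr0 q0 mule0.
        by rewrite mulr1 gtr0_norm// mule1.
      over.
    rewrite ge0_integralZl//; last 2 first.
    - by apply/measurable_EFinP; exact: measurable_indic.
    - exact/psi0/ltW.
    by rewrite integral_indic// setIT.
  have := orlicz_norm_ub fO gG; rewrite f0.
  have ge0 x : 0 <= f x * g x.
    rewrite /g indicE; have [xB|_] := boolP (x \in B); last by rewrite !mulr0.
    by move/set_mem : xB => [_ /= fx]; rewrite mulr1 mulr_ge0// ltW.
  have mfg : measurable_fun setT (fun x => (f x * g x)%:E).
    by apply/measurable_EFinP; exact: measurable_funM.
  move=> le0.
  have int0 : (\int[mu]_x `|(f x * g x)%:E| = 0)%E.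
    under eq_integral do rewrite gee0_abs ?lee_fin ?ge0//.
    by apply/eqP; rewrite eq_le le0/= integral_ge0// => x _; rewrite lee_fin.
  have := (ae_eq_integral_abs mu measurableT mfg).1 int0.
  apply: filterS => x /(_ I)/= [] fg0 Fx.
  rewrite leNgt; apply/negP => fx; move: fg0.
  rewrite /g indicE mem_set//= mulr1 => /eqP.
  by rewrite mulf_eq0 !gt_eqF.
apply: filterS (ae_foralln h) => x hx.
have : setT x by []; rewrite UF => -[n _]; exact: hx.
Qed.

Lemma orlicz_norm_eq0 f : sigma_finite setT mu -> f \in orlicz_class mu phi ->
  orlicz_norm mu phi f = 0 -> f = 0 %[ae mu].
Proof.
move=> smu fO f0; have h1 := orlicz_norm_le0 smu fO f0.
have NfO : (-1) *: f \in orlicz_class mu phi.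
  by rewrite -[_ *: _]addr0 orlicz_class_linear// orlicz_class0.
have Nf0 : orlicz_norm mu phi ((-1) *: f) = 0 by rewrite orlicz_normZ// f0 mulr0.
have h2 := orlicz_norm_le0 smu NfO Nf0.
apply: filterS2 h1 h2 => x fx; rewrite fctE /GRing.scale/= mulN1r oppr_le0 => fx' _.
by apply/le_anti; rewrite fx.
Qed.

Lemma ae_eq_orlicz_norm f g : measurable_fun setT f -> measurable_fun setT g ->
  f = g %[ae mu] -> orlicz_norm mu phi f = orlicz_norm mu phi g.
Proof.
move=> mf mg fg; rewrite /orlicz_norm -/G; do 2 congr (_ _).
apply: eq_imagel => h [mh _]; apply: ae_eq_integral => //.
- by apply/measurable_EFinP; exact: measurable_funM.
- by apply/measurable_EFinP; exact: measurable_funM.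
- by apply: filterS fg => x fg xT; rewrite fg.
Qed.

End orlicz_norm_lemmas.

Section orlicz_space.
Context d (T : measurableType d) (R : realType).
Variables (mu : {measure set T -> \bar R}) (phi : orlicz_function R).

HB.instance Definition _ := GRing.isSubmodClosed.Build R (T -> R)
  (orlicz_class mu phi) (orlicz_class_submod_closed mu phi).

Record orlicz_elt : Type := OrliczElt {
  orlicz_elt_fun :> T -> R;
  orlicz_eltP : orlicz_elt_fun \in orlicz_class mu phi }.

HB.instance Definition _ := [isSub for orlicz_elt_fun].
HB.instance Definition _ := [Choice of orlicz_elt by <:].
HB.instance Definition _ := [SubChoice_isSubLmodule of orlicz_elt by <:].

Definition orlicz_null : {pred orlicz_elt} :=
  mem [set f : orlicz_elt | (f : T -> R) = 0 %[ae mu]].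

Lemma orlicz_nullP (f : orlicz_elt) :
  reflect ((f : T -> R) = 0 %[ae mu]) (f \in orlicz_null).
Proof. by apply: (iffP idP) => [|h]; rewrite ?inE//; exact: mem_set. Qed.

Lemma orlicz_null_zmod_closed : zmod_closed orlicz_null.
Proof.
split; first by apply/orlicz_nullP; exact: ae_eq_refl.
move=> f g /orlicz_nullP f0 /orlicz_nullP g0; apply/orlicz_nullP.
apply: filterS2 f0 g0 => x fx gx xT /=.
by rewrite !fctE fx// gx// subrr.
Qed.

HB.instance Definition _ := GRing.isZmodClosed.Build orlicz_elt orlicz_null
  orlicz_null_zmod_closed.

Definition orlicz_space : Type := Quotient.quot orlicz_null.
HB.instance Definition _ := GRing.Zmodule.on orlicz_space.
HB.instance Definition _ := EqQuotient.on orlicz_space.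

Local Open Scope quotient_scope.

Definition orlicz_pi (f : orlicz_elt) : orlicz_space :=
  \pi_(Quotient.quot orlicz_null) f.
Local Notation pi := orlicz_pi.

Definition orlicz_repr (x : orlicz_space) : orlicz_elt := repr x.

Lemma orlicz_reprK x : pi (orlicz_repr x) = x.
Proof. exact: reprK. Qed.

Lemma pi_eqP (f g : orlicz_elt) :
  pi f = pi g <-> (f : T -> R) = g %[ae mu].
Proof.
split=> [/eqP|fg].
  rewrite -[_ == _]/(f == g %[mod (Quotient.quot orlicz_null)]) -Quotient.idealrBE.
  move=> /orlicz_nullP; apply: filterS => x /[apply] /eqP.
  by rewrite /= !fctE subr_eq0 => /eqP.
apply/eqP; rewrite -[_ == _]/(f == g %[mod (Quotient.quot orlicz_null)]).
rewrite -Quotient.idealrBE; apply/orlicz_nullP.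
by apply: filterS fg => x /[apply] fg /=; rewrite !fctE fg subrr.
Qed.

Lemma repr_pi_ae (f : orlicz_elt) : (orlicz_repr (pi f) : T -> R) = f %[ae mu].
Proof. by apply/pi_eqP; rewrite orlicz_reprK. Qed.

Lemma orlicz_piD (f g : orlicz_elt) : pi (f + g) = pi f + pi g.
Proof. by rewrite /orlicz_pi raddfD. Qed.

Definition orlicz_scale (c : R) (x : orlicz_space) : orlicz_space :=
  pi (c *: orlicz_repr x).

Lemma orlicz_piZ c (f : orlicz_elt) : orlicz_scale c (pi f) = pi (c *: f).
Proof.
apply/pi_eqP; apply: filterS (repr_pi_ae f) => x /[apply] fx /=.
by rewrite !fctE fx.
Qed.

Lemma orlicz_scaleA a b x : orlicz_scale a (orlicz_scale b x) = orlicz_scale (a * b) x.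
Proof. by rewrite -[x]orlicz_reprK !orlicz_piZ scalerA. Qed.

Lemma orlicz_scale1 : left_id 1 orlicz_scale.
Proof. by move=> x; rewrite /orlicz_scale scale1r orlicz_reprK. Qed.

Lemma orlicz_scaleDr : right_distributive orlicz_scale +%R.
Proof.
move=> c x y; rewrite -[x]orlicz_reprK -[y]orlicz_reprK -orlicz_piD !orlicz_piZ.
by rewrite scalerDr orlicz_piD.
Qed.

Lemma orlicz_scaleDl x : {morph orlicz_scale^~ x : a b / a + b}.
Proof. by move=> a b; rewrite /orlicz_scale scalerDl orlicz_piD. Qed.

HB.instance Definition _ := GRing.Zmodule_isLmodule.Build R orlicz_space
  orlicz_scaleA orlicz_scale1 orlicz_scaleDr orlicz_scaleDl.

Lemma orlicz_reprD (x y : orlicz_space) :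
  (orlicz_repr (x + y) : T -> R) = (orlicz_repr x : T -> R) + orlicz_repr y %[ae mu].
Proof.
apply/(pi_eqP (orlicz_repr (x + y)) (orlicz_repr x + orlicz_repr y)).
by rewrite orlicz_piD !orlicz_reprK.
Qed.

Lemma orlicz_reprZ c (x : orlicz_space) :
  (orlicz_repr (c *: x) : T -> R) = c *: (orlicz_repr x : T -> R) %[ae mu].
Proof. exact: repr_pi_ae. Qed.

Lemma orlicz_repr_eq0 (x : orlicz_space) :
  (orlicz_repr x : T -> R) = 0 %[ae mu] -> x = 0.
Proof.
move=> x0; rewrite -[x]orlicz_reprK; transitivity (pi (0 : orlicz_elt)).
  exact/pi_eqP.
by rewrite -(scale0r (0 : orlicz_elt)) -orlicz_piZ; exact: (scale0r (pi 0)).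
Qed.

End orlicz_space.
Arguments orlicz_space {d T R}.

(* L_phi and L_phi0 are two copies of the same vector space, so that each can
   carry its own norm. *)
Section luxemburg_space.
Context d (T : measurableType d) (R : realType).
Variables (mu : {sigma_finite_measure set T -> \bar R}) (phi : orlicz_function R).

Definition L_phi : Type := orlicz_space mu phi.
HB.instance Definition _ := GRing.Lmodule.on L_phi.

Let N (x : L_phi) := luxemburg_norm mu phi (orlicz_repr x).
Let mrepr (x : L_phi) : measurable_fun setT (orlicz_repr x : T -> R).
Proof. exact/orlicz_class_measurable/orlicz_eltP. Qed.

Let ND x y : N (x + y) <= N x + N y.
Proof.
rewrite /N (ae_eq_luxemburg_norm _ _ _ (orlicz_reprD x y))//.
  by rewrite luxemburg_normD// orlicz_eltP.
exact: measurable_funD.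
Qed.

Let NZ c x : N (c *: x) = `|c| * N x.
Proof.
rewrite /N (ae_eq_luxemburg_norm _ _ _ (orlicz_reprZ c x))//.
  by rewrite luxemburg_normZ// orlicz_eltP.
exact: measurable_funM.
Qed.

Let N0 x : N x = 0 -> x = 0.
Proof.
by move=> /(luxemburg_norm_eq0 (orlicz_eltP _)); exact: orlicz_repr_eq0.
Qed.

HB.instance Definition _ := Lmodule_isNormed.Build R L_phi ND NZ N0.

End luxemburg_space.
Arguments L_phi {d T R}.

Section orlicz_norm_space.
Context d (T : measurableType d) (R : realType).
Variables (mu : {sigma_finite_measure set T -> \bar R}) (phi : orlicz_function R).

Definition L_phi0 : Type := orlicz_space mu phi.
HB.instance Definition _ := GRing.Lmodule.on L_phi0.

Let N (x : L_phi0) := orlicz_norm mu phi (orlicz_repr x).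
Let mrepr (x : L_phi0) : measurable_fun setT (orlicz_repr x : T -> R).
Proof. exact/orlicz_class_measurable/orlicz_eltP. Qed.

Let ND x y : N (x + y) <= N x + N y.
Proof.
rewrite /N (ae_eq_orlicz_norm _ _ _ (orlicz_reprD x y))//.
  by rewrite orlicz_normD// orlicz_eltP.
exact: measurable_funD.
Qed.

Let NZ c x : N (c *: x) = `|c| * N x.
Proof.
rewrite /N (ae_eq_orlicz_norm _ _ _ (orlicz_reprZ c x))//.
  by rewrite orlicz_normZ// orlicz_eltP.
exact: measurable_funM.
Qed.

Let N0 x : N x = 0 -> x = 0.
Proof.
move=> /(orlicz_norm_eq0 (sigma_finiteT mu) (orlicz_eltP _)).
exact: orlicz_repr_eq0.
Qed.

HB.instance Definition _ := Lmodule_isNormed.Build R L_phi0 ND NZ N0.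

End orlicz_norm_space.
Arguments L_phi0 {d T R}.

Lemma L_phi_normE d (T : measurableType d) (R : realType)
    (mu : {sigma_finite_measure set T -> \bar R}) (phi : orlicz_function R)
    (x : L_phi mu phi) :
  `|x| = luxemburg_norm mu phi (orlicz_repr x).
Proof. by []. Qed.

Lemma L_phi0_normE d (T : measurableType d) (R : realType)
    (mu : {sigma_finite_measure set T -> \bar R}) (phi : orlicz_function R)
    (x : L_phi0 mu phi) :
  `|x| = orlicz_norm mu phi (orlicz_repr x).
Proof. by []. Qed.

Section vector_measures.
Context d (S : measurableType d) (R : realType) (X : normedModType R).
Implicit Types (m : set S -> X) (g : S -> X).

Definition countably_additive m : Prop :=
  forall F : nat -> set S, (forall i, measurable (F i)) -> trivIset setT F ->
    \sum_(0 <= i < n) m (F i) @[n --> \oo] --> m (\bigcup_i F i).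

Definition variation m (A : set S) : \bar R :=
  ereal_sup [set y | exists n (F : 'I_n -> set S),
    [/\ forall i, measurable (F i), trivIset setT F, \bigcup_i F i = A &
        y = (\sum_(i < n) `|m (F i)|)%:E]].

Variable nu : {finite_measure set S -> \bar R}.

(* For a countably additive m, this is equivalent to m A --> 0 as nu A --> 0,
   by a theorem of Pettis. *)
Definition absolutely_continuous m : Prop :=
  forall A, measurable A -> nu A = 0%E -> m A = 0.

Definition simple_function (s : S -> X) : Prop :=
  finite_set (range s) /\ forall x, measurable (s @^-1` [set x]).

Definition simple_integral (A : set S) (s : S -> X) : X :=
  \sum_(x \in range s) fine (nu (A `&` s @^-1` [set x])) *: x.

Definition strongly_measurable g : Prop :=
  exists s : nat -> S -> X, (forall n, simple_function (s n)) /\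
    {ae nu, forall w, s n w @[n --> \oo] --> g w}.

(* As nu need not be complete, |s n w - g w| is only a.e. equal to a
   measurable function of w when g is strongly measurable; its integral, a
   supremum over the simple functions below it, is that of the measurable
   function. *)
Definition approximates_in_mean (s : nat -> S -> X) g : Prop :=
  (forall n, simple_function (s n)) /\
  (\int[nu]_w (`|s n w - g w|)%:E)%E @[n --> \oo] --> 0%E.

Definition bochner_integrable g : Prop :=
  strongly_measurable g /\ exists s, approximates_in_mean s g.

Definition is_bochner_integral (A : set S) g (x : X) : Prop :=
  exists2 s, approximates_in_mean s g &
    simple_integral A (s n) @[n --> \oo] --> x.

End vector_measures.

Definition radon_nikodym_property (R : realType) (X : normedModType R) : Prop :=
  forall d (S : measurableType d) (nu : {finite_measure set S -> \bar R})
    (m : set S -> X),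
    countably_additive m -> (variation m setT < +oo)%E ->
    absolutely_continuous nu m ->
    exists g : S -> X, bochner_integrable nu g /\
      forall A, measurable A -> is_bochner_integral nu A g (m A).

(* Main.v *)
Require Import Defs.
From HB Require Import structures.
From mathcomp Require Import all_boot all_order all_algebra.
From mathcomp Require Import ring lra.
From mathcomp Require Import all_classical all_reals all_analysis.
From mathcomp Require Import measurable_realfun.

(* Necessity. If a measure has a density, it is nearly proportional to the base
   measure on some set of positive measure. This fails for A |-> \1_(A `&` B)
   when phi is bounded by a linear function, the norm behaving like the L^1 norm
   on small sets; and it fails for A |-> (lambda (A `&` ]-oo, q_n]))_n in the copy
   of l^infty spanned by disjointly supported functions when Delta2 fails.

   Sufficiency. Let V be the variation of a measure m with values in L_phi, so
   that the averages F_p (s, t) = (m C / V C) t of m over the cells C of a finite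
   partition p satisfy |F_p (s, .)| <= 1. Bounded convex energies of the F_p show
   that F_p converges almost everywhere on S * T to some g along a sequence of
   partitions of nearly maximal energy and all of its refinements. As phi u / u
   tends to infinity, the F_p are uniformly integrable, so that Jensen's
   inequality gives int phi(F_p) <= int phi(g), and with Delta2 and a theorem of
   Pratt int phi(l |F_p - g|) --> 0 for every l. Thus the sections of g are a
   density of m for V, and multiplying by the density of V one for nu. Separability
   of mu is not involved because only countably many partitions are.

   The Orlicz and Luxemburg norms are equivalent, and the Radon-Nikodym property
   is invariant under isomorphism. *)

Set Implicit Arguments.
Unset Strict Implicit.
Unset Printing Implicit Defensive.

Import Order.TTheory GRing.Theory Num.Theory.
Import numFieldTopology.Exports numFieldNormedType.Exports.

Local Open Scope classical_set_scope.
Local Open Scope ring_scope.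

(** A single g must serve all measurable A at once. This is why the limit must be the same for every
    sequence refining the chosen one: adjoining A to each partition leaves g unchanged and makes A a
    union of cells, from which m A is recovered exactly. The energy integrates sqrt (1 + x^2)
    instead of phi, which need not be strictly convex: strict convexity makes a gain of energy
    control a distance, and linear growth keeps the energies bounded. The distance so controlled
    saturates at infinity, so divergence of the averages has to be excluded separately. As mu may be
    infinite, all this is done with an integrable weight w > 0 on T; averaging takes place in S only
    and commutes with w. Jensen's inequality cannot test against the slopes of phi at the averages,
    which may be unbounded; truncated slopes divided by w are used instead. Norms of differences
    with a density need not be measurable, so their integrals are lower integrals, handled by
    monotonicity and scaling. *)

Section lower_integral.
Context d (T : measurableType d) (R : realType) (mu : {measure set T -> \bar R}).
Import HBNNSimple.

(** Neither f nor g is assumed measurable, so the integrals are suprema over simple functions. One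
    lying below f lies below g once it is set to 0 on the exceptional null set, which does not
    change its integral. *)
Lemma ae_le_lower_integral (f g : T -> \bar R) :
  (forall x, (0 <= f x)%E) -> (forall x, (0 <= g x)%E) ->
  {ae mu, forall x, (f x <= g x)%E} -> (\int[mu]_x f x <= \int[mu]_x g x)%E.
Proof.
move=> f0 g0 [N [mN N0 sN]]; rewrite ge0_integralTE// [leRHS]ge0_integralTE//.
apply: ge_ereal_sup => _ [h /= hf <-].
pose k : {nnsfun T >-> R} := mul_nnsfun h (indic_nnsfun R (measurableC mN)).
apply: le_ereal_sup_tmp; exists (sintegral mu k).
  exists k => // x; change ((h x * \1_(~` N) x)%:E <= g x)%E; rewrite indicE.
  have [xN|xN] := boolP (x \in ~` N); last by rewrite mulr0.
  rewrite mulr1; apply: le_trans (hf x) _; apply: contrapT => fg.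
  by move/set_mem : xN; apply; exact: sN.
rewrite -!integralT_nnsfun; apply: ae_ge0_le_integral => //.
- by move=> x _; rewrite lee_fin; exact: fun_ge0.
- exact/measurable_EFinP.
- by move=> x _; rewrite lee_fin; exact: fun_ge0.
- exact/measurable_EFinP.
exists N; split => // x /= hx; apply: contrapT => xN; apply: hx => _.
change ((h x)%:E <= (h x * \1_(~` N) x)%:E)%E.
by rewrite indicE mem_set// mulr1.
Qed.

End lower_integral.

(** * Finite measurable partitions, simple functions and their integrals *)

Section labels.
Context d (S : measurableType d) (R : realType).
Implicit Types (p q : S -> nat) (A : set S).

(* A finite measurable partition is encoded by a bounded measurable labelling,
   whose fibres are its cells. *)
Definition label p N := measurable_fun setT p /\ forall w, (p w < N)%N.

Lemma measurable_label p N (B : set nat) : label p N -> measurable (p @^-1` B).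
Proof. by move=> [mp _]; rewrite -[X in measurable X]setTI; exact: mp. Qed.

Lemma measurable_fun_cells (U : S -> nat) :
  (forall i, measurable (U @^-1` [set i])) -> measurable_fun setT U.
Proof.
move=> h _ B _; rewrite setTI.
have -> : U @^-1` B = \bigcup_(i in B) (U @^-1` [set i]).
  apply/seteqP; split=> [x Bx|x [i Bi /= ix]]; first by exists (U x).
  by rewrite /= ix.
by apply: (@bigcup_measurable _ _ (fun i => U @^-1` [set i]) B) => i _.
Qed.

Lemma measure_label (nu : {measure set S -> \bar R}) p N A : label p N ->
  measurable A -> nu A = (\sum_(i < N) nu (A `&` p @^-1` [set (i : nat)]))%E.
Proof.
move=> lp mA; rewrite -measure_semi_additive_ord//.
- congr (nu _); apply/seteqP; split=> x.
    move=> Ax; rewrite -bigcup_seq/=.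
    by exists (Ordinal (lp.2 x)) => //=; exact: mem_index_enum.
  by rewrite -bigcup_seq => -[i _ []].
- by move=> i; apply: measurableI => //; exact: measurable_label lp.
- move=> i j _ _ [x [[_ /= xi] [_ /= xj]]]; apply: val_inj.
  by rewrite /= -xi -xj.
- apply: bigsetU_measurable => i _.
  by apply: measurableI => //; exact: measurable_label lp.
Qed.

Lemma integral_label (nu : {measure set S -> \bar R}) p N A (f : nat -> \bar R) :
  label p N -> measurable A -> (forall i, (0 <= f i)%E) ->
  (\int[nu]_(w in A) f (p w) = \sum_(i < N) f i * nu (A `&` p @^-1` [set (i : nat)]))%E.
Proof.
move=> lp mA f0.
have mc i : measurable (p @^-1` [set i]) by exact: measurable_label lp.
transitivity (\int[nu]_(w in A) \sum_(i < N) (f i * (\1_(p @^-1` [set (i : nat)]) w)%:E))%E.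
  apply: eq_integral => w _; rewrite (bigD1 (Ordinal (lp.2 w)))//= indicE mem_set//.
  rewrite mule1 big1 ?adde0// => i iw; rewrite indicE memNset ?mule0//= => wi.
  by move/eqP : iw; apply; exact/val_inj.
rewrite ge0_integral_sum//; last 2 first.
- move=> i; apply: measurable_funeM; apply/measurable_EFinP/measurable_funTS.
  exact: measurable_indic.
- by move=> i w _; rewrite mule_ge0// lee_fin.
apply: eq_bigr => i _; rewrite ge0_integralZl//.
- by rewrite integral_indic// setIC.
- by apply/measurable_EFinP/measurable_funTS; exact: measurable_indic.
Qed.

Definition join p q w := pickle (p w, q w).

Lemma label_join p q N M : label p N -> label q M ->
  exists K, label (join p q) K.
Proof.
move=> lp lq.
exists (\max_(ij : 'I_N * 'I_M) (pickle (val ij.1, val ij.2))).+1; split.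
  apply: measurable_fun_cells => i.
  have -> : join p q @^-1` [set i] =
     [set w | exists a b, [/\ pickle (a, b) = i, p w = a & q w = b]].
    apply/seteqP; split=> [w /= <-|w /= [a [b [<- <- <-]]]//].
    by exists (p w), (q w).
  have -> : [set w | exists a b, [/\ pickle (a, b) = i, p w = a & q w = b]] =
     \bigcup_a \bigcup_b (if pickle (a, b) == i then p @^-1` [set a] `&` q @^-1` [set b] else set0).
    apply/seteqP; split=> w /=.
      by move=> [a [b [ab pa qb]]]; exists a => //; exists b => //; rewrite ab eqxx.
    move=> [a _ [b _]]; case: ifPn => // /eqP ab [pa qb]; by exists a, b.
  apply: bigcup_measurable => a _; apply: bigcup_measurable => b _.
  case: ifP => // _; apply: measurableI.
    exact: measurable_label lp.
  exact: measurable_label lq.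
move=> w; rewrite ltnS.
exact: (leq_bigmax (Ordinal (lp.2 w), Ordinal (lq.2 w))).
Qed.

Definition refines q p := exists r : nat -> nat, p = r \o q.

Lemma refines_refl p : refines p p. Proof. by exists id. Qed.

Lemma refines_trans q p r : refines r q -> refines q p -> refines r p.
Proof. by move=> [f ->] [g ->]; exists (g \o f). Qed.

Lemma refines_joinl p q : refines (join p q) p.
Proof.
exists (fun i => if @unpickle (nat * nat)%type i is Some ij then ij.1 else 0%N).
by apply/funext => w; rewrite /join /= pickleK.
Qed.

Lemma refines_joinr p q : refines (join p q) q.
Proof.
exists (fun i => if @unpickle (nat * nat)%type i is Some ij then ij.2 else 0%N).
by apply/funext => w; rewrite /join /= pickleK.
Qed.

Section simple.
Context (X : normedModType R).
Implicit Types (s : S -> X) (c : nat -> X).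

Lemma simple_label p N c : label p N -> simple_function (c \o p).
Proof.
move=> lp; split.
  apply: (@sub_finite_set _ _ (c @` `I_N)); last exact/finite_image/finite_II.
  by move=> _ [w _ <-] /=; exists (p w) => //; exact: lp.2.
by move=> x; rewrite comp_preimage; exact: measurable_label lp.
Qed.

Lemma simple_functionP s : simple_function s ->
  exists N p c, label p N /\ s = c \o p.
Proof.
move=> [/finite_seqP[r rE] ms].
have sr w : s w \in r.
  by have : range s (s w) by []; rewrite rE.
exists (size r), (fun w => index (s w) r), (nth 0 r); split; last first.
  by apply/funext => w /=; rewrite nth_index.
split; last by move=> w; rewrite index_mem.
apply: measurable_fun_cells => i.
have [ir|ri] := ltnP i (size r); last first.
  rewrite (_ : _ @^-1` _ = set0)//; apply/seteqP; split=> // w /= wi.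
  by move: ri; rewrite -wi leqNgt index_mem sr.
rewrite (_ : _ @^-1` _ = \bigcup_(x in [set x | x \in r /\ index x r = i]) s @^-1` [set x]).
  apply: fin_bigcup_measurable => //.
  by apply: (@sub_finite_set _ _ [set` r]) => // x [].
apply/seteqP; split=> [w /= <-|w /= [x [_ <-] ->]//].
by exists (s w).
Qed.

(** Distinct cells may carry the same value, so each level set of [c \o p] is decomposed into cells;
    a value [c i] that is not attained comes from an empty cell and contributes 0. *)
Lemma simple_integral_label (nu : {finite_measure set S -> \bar R}) p N c A :
  label p N -> measurable A ->
  simple_integral nu A (c \o p) =
    \sum_(i < N) fine (nu (A `&` p @^-1` [set (i : nat)])) *: c i.
Proof.
move=> lp mA; pose s := c \o p.
have mc i : measurable (p @^-1` [set i]) by exact: measurable_label lp.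
have fin B : measurable B -> nu B \is a fin_num by move=> mB; exact: fin_num_measure.
pose r := undup [seq c (val i) | i <- enum 'I_N].
have cr (i : 'I_N) : c i \in r.
  by rewrite mem_undup; apply/mapP; exists i; rewrite ?mem_enum.
rewrite /simple_integral (fsbig_fwiden r)/=; last 3 first.
- by move=> _ [w _ <-] /=; exact: (cr (Ordinal (lp.2 w))).
- exact: undup_uniq.
- move=> x [_ /= xs].
  rewrite (_ : A `&` _ = set0) ?measure0 ?scale0r//.
  by apply/seteqP; split=> // w [_ /= wx]; apply: xs; exists w.
transitivity (\sum_(x <- r) \sum_(i < N | c i == x)
    fine (nu (A `&` p @^-1` [set (i : nat)])) *: c i).
  apply: eq_bigr => x _.
  have mx : measurable ((c \o p) @^-1` [set x]) by exact: (simple_label c lp).2.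
  rewrite (measure_label _ lp); last exact: measurableI.
  rewrite -sum_fine; last by move=> i _; apply: fin; do ?apply: measurableI.
  rewrite scaler_suml [RHS]big_mkcond/=; apply: eq_bigr => i _.
  case: eqP => cx.
    congr (fine (nu _) *: _) => //; apply/seteqP; split=> w /=; first by case=> -[].
    by move=> [Aw wi]; split => //; split => //=; rewrite wi.
  rewrite (_ : _ `&` _ = set0) ?measure0 ?scale0r//.
  by apply/seteqP; split=> // w [[_ /= wx] wi]; apply: cx; rewrite -wi.
rewrite (exchange_big_dep xpredT)//=; apply: eq_bigr => i _.
rewrite -big_filter (_ : [seq x <- r | c i == x] = [:: c i]) ?big_seq1//.
rewrite (@eq_filter _ _ (pred1 (c i))) ?filter_pred1_uniq ?undup_uniq//.
Qed.

End simple.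
End labels.

(** * Local behaviour of a measure with a density *)

Section density_local.
Context d (S : measurableType d) (R : realType) (X : normedModType R).
Variable nu : {finite_measure set S -> \bar R}.
Implicit Types (s : S -> X) (g : S -> X) (m : set S -> X).

(** Any relation will do, since both functions are constant on the cells of a common refinement. *)
Lemma measurable_simple2 s s' (P : X -> X -> Prop) :
  simple_function s -> simple_function s' -> measurable [set w | P (s w) (s' w)].
Proof.
move=> /simple_functionP[N [p [c [lp ->]]]] /simple_functionP[M [q [c' [lq ->]]]].
have [K lj] := label_join lp lq.
have [f pf] := refines_joinl p q; have [f' qf] := refines_joinr p q.
rewrite (_ : [set w | _] = join p q @^-1` [set i | P (c (f i)) (c' (f' i))]).
  exact: measurable_label lj.
apply/funext => w /=.
by rewrite -(congr1 (@^~ w) pf : p w = f _) -(congr1 (@^~ w) qf : q w = f' _).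
Qed.

(* Almost everywhere the approximating simple functions eventually stay within
   eta of some s n; E is part of a cell of such an s n. *)
Lemma density_nearly_constant m g (eta : R) B :
  bochner_integrable nu g ->
  (forall A, measurable A -> is_bochner_integral nu A g (m A)) ->
  0 < eta -> measurable B -> (0 < nu B)%E ->
  exists E y, [/\ measurable E, E `<=` B, (0 < nu E)%E &
    forall A, measurable A -> A `<=` E ->
      `|m A - fine (nu A) *: y| <= eta * fine (nu A)].
Proof.
move=> [[s [ss sg]] _] gm eta0 mB B0.
(* This set only involves simple functions and is therefore measurable, which is not known of the
   set where g is within eta of [s n]. *)
pose C n := [set w | forall k, (n <= k)%N -> `|s k w - s n w| <= eta].
have mC n : measurable (C n).
  rewrite (_ : C n = \bigcap_(k in [set k | (n <= k)%N]) [set w | `|s k w - s n w| <= eta]).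
    apply: bigcap_measurable => [|k _]; first by exists n => /=.
    exact: (@measurable_simple2 (s k) (s n) (fun x y => `|x - y| <= eta)).
  by apply/seteqP; split=> w /= h k; exact: h.
have [n [y Ey]] : exists n y, (0 < nu (B `&` C n `&` s n @^-1` [set y]))%E.
  apply: contrapT => h.
  have z n y : nu (B `&` C n `&` s n @^-1` [set y]) = 0%E.
    apply/eqP; rewrite eq_le measure_ge0 andbT leNgt; apply/negP => zz.
    by apply: h; exists n, y.
  suff : nu.-negligible B.
    by move/(negligibleP _ mB) => B0'; rewrite B0' ltxx in B0.
  have n1 n : nu.-negligible (B `&` C n).
    have [N [p [c [lp sE]]]] := simple_functionP (ss n).
    apply: (@negligibleS _ _ _ _ (\big[setU/set0]_(i < N) (B `&` C n `&` s n @^-1` [set c i]))).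
      move=> w Bw; rewrite -bigcup_seq/=.
      by exists (Ordinal (lp.2 w)); [exact: mem_index_enum|split => //=; rewrite sE].
    rewrite big_mkcond/=; elim/big_ind : _ => //; first exact: negligible_set0.
      by move=> ? ?; exact: negligibleU.
    move=> i _; apply/negligibleP; last exact: z.
    apply: measurableI; [exact: measurableI|exact: (ss n).2].
  have n2 : nu.-negligible (\bigcup_n (B `&` C n)) by exact: negligible_bigcup.
  have := negligibleU n2 sg; apply: negligibleS => w Bw.
  have [cw|cw] := pselect (s n w @[n --> \oo] --> g w); last by right.
  left; have : \forall k \near \oo, `|g w - s k w| <= eta / 2.
    by move/cvgrPdist_le : cw; apply; rewrite divr_gt0.
  move=> [n _ hn]; exists n => //; split => // k nk.
  rewrite -(subrK (g w) (s k w)) -addrA; apply: le_trans (ler_normD _ _) _.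
  rewrite (splitr eta); apply: lerD; last exact: hn n (leqnn n).
  by rewrite distrC; exact: hn.
set E := _ `&` _ in Ey.
have mE : measurable E.
  by apply: measurableI; [exact: measurableI|exact: (ss n).2].
exists E, y; split => //; first by move=> w [[]].
move=> A mA AE; have [s' [ss' s'g] s'm] := gm A mA.
have gy : {ae nu, forall w, A w -> `|g w - y| <= eta}.
  apply: filterS sg => w sw /AE[[_ Cw] /= yw].
  have : (fun k => `|s k w - y|) @ \oo --> `|g w - y|.
    by apply: cvg_norm; apply: cvgB => //; exact: cvg_cst.
  move=> /cvgr_to_le; apply; exists n => // k /= nk.
  by rewrite -yw; exact: Cw.
have Afin : nu A \is a fin_num by exact: fin_num_measure.
have key k : (`|simple_integral nu A (s' k) - fine (nu A) *: y|%:E <=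
    (eta * fine (nu A))%:E + \int[nu]_w (`|s' k w - g w|)%:E)%E.
  have [N [p [c [lp sE]]]] := simple_functionP (ss' k).
  have fin i : nu (A `&` p @^-1` [set i]) \is a fin_num.
    by apply: fin_num_measure; apply: measurableI => //; exact: measurable_label lp.
  have nuA : fine (nu A) = \sum_(i < N) fine (nu (A `&` p @^-1` [set (i : nat)])).
    by rewrite {1}(measure_label nu lp mA) sum_fine// => i _; exact: fin.
  rewrite sE (simple_integral_label _ _ lp mA) nuA scaler_suml -sumrB.
  under eq_bigr do rewrite -scalerBr.
  (* The excess of [|c i - y|] over eta. On A it is at most [|s' k - g|], because g is almost
     everywhere within eta of y there. *)
  pose f i := Num.max 0 (`|c i - y| - eta).
  have f0 i : 0 <= f i by rewrite le_max lexx.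
  apply: (@le_trans _ _ ((eta * fine (nu A))%:E + \int[nu]_(w in A) (f (p w))%:E)%E).
    rewrite (integral_label nu lp mA (f := fun i => (f i)%:E)); last first.
      by move=> i; rewrite lee_fin.
    rewrite (eq_bigr (fun i : 'I_N => (f i * fine (nu (A `&` p @^-1` [set (i : nat)])))%:E)); last first.
      by move=> i _; rewrite EFinM fineK.
    rewrite sumEFin -EFinD lee_fin nuA mulr_sumr -big_split/=.
    apply: le_trans (ler_norm_sum _ _ _) _; apply: ler_sum => i _.
    rewrite normrZ ger0_norm ?fine_ge0// -mulrDl mulrC ler_wpM2r ?fine_ge0//.
    by rewrite -lerBlDl le_max lexx orbT.
  rewrite -nuA leeD2l// integral_mkcond; apply: ae_le_lower_integral.
  - by move=> w; rewrite /patch; case: ifP => // _; rewrite lee_fin.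
  - by move=> w; rewrite lee_fin.
  apply: filterS gy => w gy; rewrite /patch; case: ifPn => [/set_mem Aw|_]; last first.
    by rewrite lee_fin.
  rewrite lee_fin /f ge_max normr_ge0/= lerBlDr; have := gy Aw.
  move=> /(lerD (lexx `|c (p w) - g w|)); apply: le_trans.
  by rewrite (le_trans _ (ler_normD _ _))// addrA subrK.
rewrite -lee_fin.
have l1 : (`|simple_integral nu A (s' k) - fine (nu A) *: y|%:E @[k --> \oo] -->
    `|m A - fine (nu A) *: y|%:E)%E.
  apply: cvg_EFin; first exact: nearW.
  by apply: cvg_norm; apply: cvgB => //; exact: cvg_cst.
have l2 : ((eta * fine (nu A))%:E + \int[nu]_w (`|s' k w - g w|)%:E @[k --> \oo] -->
    (eta * fine (nu A))%:E)%E.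
  rewrite -[X in _ --> X]adde0; apply: cvgeD => //; exact: cvg_cst.
rewrite -(cvg_lim _ l1)// -(cvg_lim _ l2)//; apply: lee_lim.
- by apply/cvg_ex; eexists; exact: l1.
- by apply/cvg_ex; eexists; exact: l2.
by apply: nearW => k; exact: key.
Qed.

End density_local.

(** * Additive vector measures and the variation as a finite measure *)

Section vector_measure_facts.
Context d (S : measurableType d) (R : realType) (X : normedModType R).
Implicit Types (m : set S -> X) (A B : set S).

Definition finitely_additive m := forall A B, measurable A -> measurable B ->
  A `&` B = set0 -> m (A `|` B) = m A + m B.

Lemma countably_additive0 m : countably_additive m -> m set0 = 0.
Proof.
move=> ca; have := ca (fun=> set0) (fun _ => measurable0) (@trivIset_set0 _ _ _).
rewrite bigcup0// => h.
have h' : \sum_(0 <= i < n.+1) m set0 @[n --> \oo] --> m set0.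
  by have h' := h; rewrite -cvg_shiftS in h'.
have : (\sum_(0 <= i < n.+1) m set0 - \sum_(0 <= i < n) m set0) @[n --> \oo] --> m set0 - m set0.
  exact: cvgB.
under eq_fun do rewrite big_nat_recr//= addrAC subrr add0r.
by move=> /(cvg_lim (@norm_hausdorff _ _)); rewrite lim_cst// subrr.
Qed.

Lemma countably_additive_finitely m : countably_additive m -> finitely_additive m.
Proof.
move=> ca A B mA mB AB; pose F := bigcup2 A B.
have mF i : measurable (F i) by case: i => [|[|i]] //; exact: measurable0.
have tF : trivIset setT F.
  move=> [|[|i]] [|[|j]] _ _ //= [x [/= xA xB]]; rewrite ?in_set0//.
    by have : (A `&` B) x by []; rewrite AB.
  by have : (A `&` B) x by []; rewrite AB.
have := ca F mF tF; rewrite bigcup2E => h.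
have : \sum_(0 <= i < n.+2) m (F i) @[n --> \oo] --> m (A `|` B).
  by have h' := h; rewrite -cvg_shiftS -cvg_shiftS in h'.
have -> : (fun n => \sum_(0 <= i < n.+2) m (F i)) = (fun=> m A + m B).
  apply/funext => n; rewrite big_nat_recl// big_nat_recl//= big1 ?addr0//.
  by move=> i _; exact: countably_additive0.
by move=> /(cvg_lim (@norm_hausdorff _ _)); rewrite lim_cst.
Qed.

Lemma finitely_additive_sum m n (F : 'I_n -> set S) : finitely_additive m ->
  m set0 = 0 -> (forall i, measurable (F i)) -> trivIset setT F ->
  m (\bigcup_i F i) = \sum_(i < n) m (F i).
Proof.
move=> fa m0; elim: n F => [|n IH] F mF tF.
  by rewrite big_ord0 bigcup0// => -[].
rewrite big_ord_recl -IH//; last by move=> i j _ _ /tF -/(_ I I); exact: lift_inj.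
rewrite -fa//.
- congr m; apply/seteqP; split=> x.
    by move=> [i _]; case: (unliftP ord0 i) => [j ->|-> ?]; [right; exists j|left].
  by move=> [Fx|[j _ Fx]]; [exists ord0|exists (lift ord0 j)].
- by apply: fin_bigcup_measurable => //; exact: finite_finset.
- apply/seteqP; split=> // x [F0 [j _ Fj]].
  by have /eqP := tF _ _ I I (ex_intro _ x (conj F0 Fj)); rewrite (negbTE (neq_lift _ _)).
Qed.

(** Domination by a multiple of nu upgrades finite additivity: the tail of a disjoint union has
    small nu-measure. Both counterexamples in the necessity part are of this kind. *)
Lemma bounded_additive_rnp_hyp (nu : {finite_measure set S -> \bar R}) m (C : R) :
  finitely_additive m -> (forall A, measurable A -> `|m A| <= C * fine (nu A)) ->
  [/\ countably_additive m, (Defs.variation m setT < +oo)%E & Defs.absolutely_continuous nu m].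
Proof.
move=> fa mC.
have m0 : m set0 = 0.
  by apply/eqP; rewrite -normr_le0; have := mC _ measurable0; rewrite measure0 mulr0.
have fin A : measurable A -> nu A \is a fin_num by move=> mA; exact: fin_num_measure.
have sumE n (F : nat -> set S) : (forall i, measurable (F i)) -> trivIset setT F ->
    m (\big[setU/set0]_(i < n) F i) = \sum_(i < n) m (F i).
  move=> mF tF; rewrite -(finitely_additive_sum fa m0 (F := fun i : 'I_n => F i))//.
    congr m; rewrite -bigcup_seq; apply/seteqP; split=> x [i _ Fi]; exists i => //.
    by rewrite /= mem_index_enum.
  by move=> i j _ _ /tF -/(_ I I) ij; exact/val_inj.
split.
- move=> F mF tF.
  have mU : measurable (\bigcup_i F i) by exact: bigcup_measurable.
  have bnd n : `|m (\bigcup_i F i) - \sum_(0 <= i < n) m (F i)| <=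
      C * (fine (nu (\bigcup_i F i)) - fine (\sum_(0 <= i < n) nu (F i))).
    rewrite !big_mkord -sumE// -measure_bigsetU//.
    set V := \big[setU/set0]_(i < n) F i.
    have mV : measurable V by exact: bigsetU_measurable.
    have VU : V `<=` \bigcup_i F i.
      by rewrite /V -bigcup_seq => x [i _ Fi]; exists i.
    have {1}-> : \bigcup_i F i = V `|` (\bigcup_i F i `\` V).
      by rewrite setDUK.
    have mD : measurable (\bigcup_i F i `\` V) by exact: measurableD.
    rewrite fa//; last by rewrite setDE setICA setICr setI0.
    rewrite addrAC subrr add0r; apply: le_trans (mC _ mD) _.
    rewrite measureD//; last by rewrite ltey_eq fin.
    by rewrite (setIidr VU) fineB// ?fin.
  apply/cvgrPdist_le => e e0.
  have : (C * (fine (nu (\bigcup_i F i)) - fine (\sum_(0 <= i < n) nu (F i)))) @[n --> \oo] --> (0 : R).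
    rewrite -(mulr0 C) -(subrr (fine (nu (\bigcup_i F i)))).
    apply: cvgM; first exact: cvg_cst.
    apply: cvgB; first exact: cvg_cst.
    apply: fine_cvg; rewrite fineK ?fin//.
    exact: measure_sigma_additive.
  move/cvgrPdist_le => /(_ e e0); apply: filterS => n.
  rewrite sub0r normrN => /(le_trans _); apply.
  exact: le_trans (bnd n) (ler_norm _).
- apply: (@le_lt_trans _ _ (C * fine (nu setT))%:E); last exact: ltry.
  apply: ge_ereal_sup => _ [n [F [mF tF UF ->]]]; rewrite lee_fin.
  have -> : fine (nu setT) = \sum_(i < n) fine (nu (F i)).
    rewrite -UF sum_fine; last by move=> i _; exact: fin.
    rewrite -measure_semi_additive_ord//.
      congr (fine (nu _)); rewrite -bigcup_seq; apply/seteqP; split=> x [i _ Fi]; exists i => //.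
      by rewrite /= mem_index_enum.
    exact: bigsetU_measurable.
  by rewrite mulr_sumr; apply: ler_sum => i _; exact: mC.
- move=> A mA A0; apply/eqP; rewrite -normr_le0.
  by have := mC A mA; rewrite A0 mulr0.
Qed.

End vector_measure_facts.

Section variation_measure.
Context d (S : measurableType d) (R : realType) (X : normedModType R).
Variable m : set S -> X.
Hypothesis mca : countably_additive m.
Implicit Types A B : set S.
Local Notation V := (Defs.variation m).

Let m0 : m set0 = 0. Proof. exact: countably_additive0. Qed.
Let mfa : finitely_additive m. Proof. exact: countably_additive_finitely. Qed.

Lemma variation_ub n (F : 'I_n -> set S) A : (forall i, measurable (F i)) ->
  trivIset setT F -> \bigcup_i F i = A -> ((\sum_(i < n) `|m (F i)|)%:E <= V A)%E.
Proof. by move=> mF tF UF; apply: ereal_sup_ubound; exists n, F. Qed.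

Lemma le_norm_variation A : measurable A -> (`|m A|%:E <= V A)%E.
Proof.
move=> mA; have := @variation_ub 1 (fun=> A) A; rewrite big_ord_recl big_ord0 addr0.
apply => //; last by apply/seteqP; split=> [x [i]//|x Ax]; exists ord0.
by move=> i j _ _ _; rewrite !ord1.
Qed.

Lemma variation_ge0 A : measurable A -> (0 <= V A)%E.
Proof. by move=> /le_norm_variation; apply: le_trans; rewrite lee_fin. Qed.

Lemma variation0 : V set0 = 0%E.
Proof.
apply/eqP; rewrite eq_le variation_ge0// andbT.
apply: ge_ereal_sup => _ [n [F [mF tF UF ->]]].
rewrite big1// => i _; rewrite (_ : F i = set0) ?m0 ?normr0//.
by apply/seteqP; split=> // x Fx; rewrite -UF; exists i.
Qed.

(** A partition of A and one of B concatenate to a partition of the union. The two suprema are then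
    taken one after the other by subtraction, once the case of an infinite right-hand side is set
    aside. *)
Lemma variation_superadditive A B : measurable A -> measurable B ->
  A `&` B = set0 -> (V A + V B <= V (A `|` B))%E.
Proof.
move=> mA mB AB.
pose VS C := [set y | exists n (F : 'I_n -> set S), [/\ forall i, measurable (F i),
  trivIset setT F, \bigcup_i F i = C & y = (\sum_(i < n) `|m (F i)|)%:E]].
have h x y : VS A x -> VS B y -> (x + y <= V (A `|` B))%E.
  move=> [n [F [mF tF UF ->]]] [k [G [mG tG UG ->]]].
  pose H (i : 'I_(n + k)) := match fintype.split i with inl a => F a | inr b => G b end.
  have HF a : H (lshift k a) = F a by rewrite /H (unsplitK (inl a)).
  have HG b : H (rshift n b) = G b by rewrite /H (unsplitK (inr b)).
  have FG a b x0 : F a x0 -> G b x0 -> False.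
    move=> Fx Gx; suff : (A `&` B) x0 by rewrite AB.
    by split; [rewrite -UF; exists a|rewrite -UG; exists b].
  have := @variation_ub (n + k) H (A `|` B); rewrite big_split_ord/= EFinD.
  rewrite (eq_bigr (fun a => `|m (F a)|)); last by move=> a _; rewrite HF.
  rewrite [X in (_ + X%:E)%E](eq_bigr (fun b => `|m (G b)|)); last by move=> b _; rewrite HG.
  apply.
  - by move=> i; rewrite /H; case: fintype.split.
  - move=> i j _ _; rewrite -(splitK i) -(splitK j).
    case: (fintype.split i) => a; case: (fintype.split j) => b; rewrite /unsplit ?HF ?HG => -[x0 [h1 h2]].
    + by rewrite (tF a b)//; exists x0.
    + by case: (FG _ _ _ h1 h2).
    + by case: (FG _ _ _ h2 h1).
    + by rewrite (tG a b)//; exists x0.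
  - apply/seteqP; split=> x0.
      move=> [i _]; rewrite -(splitK i); case: (fintype.split i) => a; rewrite /unsplit ?HF ?HG => hx.
        by left; rewrite -UF; exists a.
      by right; rewrite -UG; exists a.
    rewrite -UF -UG => -[[i _ hx]|[i _ hx]]; first by exists (lshift k i); rewrite ?HF.
    by exists (rshift n i); rewrite ?HG.
have VA := variation_ge0 mA; have VB := variation_ge0 mB.
have [->|Ay] := eqVneq (V (A `|` B)) +oo%E; first by rewrite leey.
have AUfin : V (A `|` B) \is a fin_num.
  by rewrite ge0_fin_numE ?ltey// variation_ge0//; exact: measurableU.
have h' y : VS B y -> (V A <= V (A `|` B) - y)%E.
  move=> yB; have yfin : y \is a fin_num by case: yB => n [F [_ _ _ ->]].
  by apply: ge_ereal_sup => x xA; rewrite leeBrDr//; exact: h.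
(* The one-cell partition of B already bounds V A by a finite number. *)
have VAfin : V A \is a fin_num.
  have [n [F [nF]]] : exists n (F : 'I_n -> set S), VS B (\sum_(i < n) `|m (F i)|)%:E.
    exists 1%N, (fun=> B), 1%N, (fun=> B); split => //.
      by move=> i j _ _ _; rewrite !ord1.
    by apply/seteqP; split=> [x [i]//|x Bx]; exists ord0.
  move=> hF; have yB : VS B (\sum_(i < n) `|m (F i)|)%:E by exists nF.
  rewrite ge0_fin_numE//; apply: le_lt_trans (h' _ yB) _.
  by rewrite -(fineK AUfin) -EFinB ltry.
rewrite addeC -leeBrDr//; apply: ge_ereal_sup => y yB.
have yfin : y \is a fin_num by case: yB => n [F [_ _ _ ->]].
by rewrite leeBrDr// addeC -leeBrDr//; exact: h'.
Qed.

Lemma le_variation A B : measurable A -> measurable B -> A `<=` B -> (V A <= V B)%E.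
Proof.
move=> mA mB AB; rewrite -(setDUK AB).
have mD : measurable (B `\` A) by exact: measurableD.
apply: le_trans (variation_superadditive mA mD _); last first.
  by rewrite setDE setICA setICr setI0.
by rewrite leeDl// variation_ge0.
Qed.

(** For the upper bound a partition E of the union is cut by the F i: countable additivity recovers
    each [m (E j)] from its pieces, and for fixed i the pieces [E j] [&] [F i] partition [F i]. The
    lower bound is superadditivity with monotonicity. *)
Lemma variation_sigma_additive (F : (set S)^nat) : (forall i, measurable (F i)) ->
  trivIset setT F -> \sum_(0 <= i < n) V (F i) @[n --> \oo] --> V (\bigcup_i F i).
Proof.
move=> mF tF; have V0 i : (0 <= V (F i))%E by exact: variation_ge0.
have mU : measurable (\bigcup_i F i) by exact: bigcup_measurable.
have -> : V (\bigcup_i F i) = (\sum_(0 <= i <oo) V (F i))%E; last first.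
  by apply: is_cvg_nneseries => i _ _.
apply/eqP; rewrite eq_le; apply/andP; split.
  apply: ge_ereal_sup => _ [n [E [mE tE UE ->]]].
  have mEF j i : measurable (E j `&` F i) by exact: measurableI.
  have bnd N : ((\sum_(j < n) `|\sum_(0 <= i < N) m (E j `&` F i)|)%:E <=
      \sum_(0 <= i <oo) V (F i))%E.
    apply: (@le_trans _ _ (\sum_(0 <= i < N) V (F i))%E); last first.
      exact: nneseries_lim_ge.
    apply: (@le_trans _ _ (\sum_(0 <= i < N) (\sum_(j < n) `|m (E j `&` F i)|)%:E)%E).
      rewrite sumEFin lee_fin exchange_big/=; apply: ler_sum => j _.
      exact: ler_norm_sum.
    apply: lee_sum => i _; apply: variation_ub => //.
      by move=> a b _ _ [x [[Ea _] [Eb _]]]; apply: tE => //; exists x.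
    rewrite -setI_bigcupl UE; apply/setIidPr => x Fx; exact: (ex_intro2 _ _ i).
  have lim : (\sum_(j < n) `|\sum_(0 <= i < N) m (E j `&` F i)|) @[N --> \oo] -->
      \sum_(j < n) `|m (E j)|.
    apply: cvg_big => [|j _]; first exact: add_continuous.
    apply: cvg_norm.
    have EjU : \bigcup_i (E j `&` F i) = E j.
      by rewrite -setI_bigcupr -UE; apply/setIidPl => x Ex; exists j.
    rewrite -[X in _ --> m X]EjU; apply: mca => //.
    by move=> a b _ _ [x [[_ Fa] [_ Fb]]]; apply: tF => //; exists x.
  have limE : ((\sum_(j < n) `|\sum_(0 <= i < N) m (E j `&` F i)|)%:E @[N --> \oo] -->
      (\sum_(j < n) `|m (E j)|)%:E)%E by apply: cvg_EFin => //; exact: nearW.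
  rewrite -(cvg_lim _ limE)//; apply: lime_le; first by apply/cvg_ex; eexists; exact: limE.
  exact: nearW.
apply: lime_le; first by apply: is_cvg_nneseries => i _ _.
apply: nearW => N.
apply: (@le_trans _ _ (V (\big[setU/set0]_(i < N) F i))); last first.
  apply: le_variation => //; first exact: bigsetU_measurable.
  by rewrite -bigcup_seq => x [i _ Fi]; exists i.
elim: N => [|N IH]; first by rewrite big_geq// big_ord0 variation0.
rewrite big_nat_recr// big_ord_recr/=.
apply: le_trans (leeD IH (lexx _)) _; apply: variation_superadditive => //.
  exact: bigsetU_measurable.
apply/seteqP; split=> // x []; rewrite -bigcup_seq => -[i _ Fi] FN.
have := tF (val i) N I I (ex_intro _ x (conj Fi FN)).
by move=> iN; have := ltn_ord i; rewrite iN ltnn.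
Qed.

(** A non-measurable A has no finite partition into measurable sets, so V A is the supremum of the
    empty set, -oo; the maximum with 0 restores the nonnegativity required of a measure on all sets.
    Carrying the additivity of m in the term lets the measure structure be inferred from it. *)
Definition variation_measure (_ : countably_additive m) A : \bar R := maxe 0%E (V A).

Lemma variation_measureE A : measurable A -> variation_measure mca A = V A.
Proof. by move=> mA; apply/max_idPr/variation_ge0. Qed.

Let vm0 : variation_measure mca set0 = 0%E.
Proof. by rewrite variation_measureE// variation0. Qed.

Let vm_ge0 A : (0 <= variation_measure mca A)%E.
Proof. by rewrite le_max lexx. Qed.

Let vm_sigma : semi_sigma_additive (variation_measure mca).
Proof.
move=> F mF tF mU; rewrite variation_measureE//.
under eq_fun do under eq_bigr do rewrite variation_measureE//.
exact: variation_sigma_additive.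
Qed.

HB.instance Definition _ := isMeasure.Build _ _ _ (variation_measure mca) vm0 vm_ge0 vm_sigma.

End variation_measure.

Section finite_variation.
Context d (S : measurableType d) (R : realType) (X : normedModType R).
Variable m : set S -> X.
Definition finite_variation_measure (mca : countably_additive m)
  (_ : (Defs.variation m setT < +oo)%E) : set S -> \bar R := variation_measure mca.

Hypothesis mca : countably_additive m.
Hypothesis mfin : (Defs.variation m setT < +oo)%E.

HB.instance Definition _ := Measure.on (finite_variation_measure mca mfin).

Let fv_fin : fin_num_fun (finite_variation_measure mca mfin).
Proof.
move=> A mA; rewrite ge0_fin_numE//.
rewrite [finite_variation_measure _ _ _]variation_measureE//.
by apply: le_lt_trans mfin; exact: le_variation.
Qed.

HB.instance Definition _ := Measure_isFinite.Build _ _ _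
  (finite_variation_measure mca mfin) fv_fin.

Lemma finite_variation_measureE A : measurable A ->
  finite_variation_measure mca mfin A = Defs.variation m A.
Proof. exact: variation_measureE. Qed.

End finite_variation.

(** * Invariance of the Radon-Nikodym property under isomorphism *)

Section transport.
Context (R : realType) (X Y : normedModType R).
Import HBNNSimple.

(** For f possibly non-measurable: a simple function below C f, divided by C, lies below f. *)
Lemma le_lower_integralZl d (T : measurableType d) (mu : {measure set T -> \bar R})
    (f : T -> \bar R) (C : R) : 0 < C -> (forall x, (0 <= f x)%E) ->
  (\int[mu]_x (C%:E * f x) <= C%:E * \int[mu]_x f x)%E.
Proof.
move=> C0 f0; rewrite ge0_integralTE; last by move=> x; rewrite mule_ge0// lee_fin ltW.
apply: ge_ereal_sup => _ [h /= hf <-].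
have C0' : 0 <= C^-1 by rewrite invr_ge0 ltW.
pose k : {nnsfun T >-> R} := scale_nnsfun h C0'.
have kf x : ((k x)%:E <= f x)%E.
  change ((C^-1 * h x)%:E <= f x)%E; rewrite EFinM.
  by rewrite muleC lee_pdivrMr// muleC; exact: hf.
have -> : sintegral mu h = (C%:E * sintegral mu k)%E.
  rewrite -sintegralrM; apply: eq_sintegral => x.
  change (h x = C * (C^-1 * h x)); by rewrite mulrA divff ?mul1r// gt_eqF.
apply: lee_wpmul2l; first by rewrite lee_fin ltW.
by rewrite ge0_integralTE//; apply: ereal_sup_ubound; exists k.
Qed.

(** If k is a density of g o m, then f o k is one of m: f maps simple functions to simple functions,
    commutes with their integrals, and is continuous. The bound on g keeps the variation finite. *)
Lemma rnp_isomorphic (f : X -> Y) (g : Y -> X) (C : R) : linear f -> 0 < C ->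
  cancel f g -> cancel g f ->
  (forall x, `|f x| <= C * `|x|) -> (forall y, `|g y| <= C * `|y|) ->
  radon_nikodym_property X -> radon_nikodym_property Y.
Proof.
move=> fl C0 fK gK fC gC rX d S nu m mca mv mac.
have fD x y : f (x + y) = f x + f y by rewrite -[x]scale1r fl !scale1r.
have f0 : f 0 = 0.
  by apply: (addrI (f 0)); rewrite -fD !addr0.
have fZ a x : f (a *: x) = a *: f x by rewrite -[a *: x]addr0 fl f0 addr0.
have fB x y : f (x - y) = f x - f y by rewrite fD -[- y]scaleN1r fZ scaleN1r.
have fS n (F : 'I_n -> X) : f (\sum_(i < n) F i) = \sum_(i < n) f (F i).
  by apply: (big_morph f).
have gB x y : g (x - y) = g x - g y by apply: (can_inj fK); rewrite gK fB !gK.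
have gS n (F : 'I_n -> Y) : g (\sum_(i < n) F i) = \sum_(i < n) g (F i).
  by apply: (can_inj fK); rewrite gK fS; apply: eq_bigr => i _; rewrite gK.
have g0 : g 0 = 0 by rewrite -f0 fK.
have cvgb (U V : normedModType R) (h : U -> V) (hB : forall x y, h (x - y) = h x - h y)
    (hC : forall x, `|h x| <= C * `|x|) (u : nat -> U) (l : U) :
    u n @[n --> \oo] --> l -> h (u n) @[n --> \oo] --> h l.
  move=> /cvgrPdist_le ul; apply/cvgrPdist_le => e e0.
  have := ul (e / C) (divr_gt0 e0 C0); apply: filterS => n /= un.
  rewrite -hB; apply: le_trans (hC _) _.
  by rewrite mulrC -ler_pdivlMr.
have fcvg := cvgb _ _ f fB fC; have gcvg := cvgb _ _ g gB gC.
pose m' A := g (m A).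
have [||| k [[[s [ss sk]] [s2 [ss2 s2k]]] kint]] := rX d S nu m'.
- move=> F mF tF; have := gcvg _ _ (mca F mF tF).
  by under eq_fun do rewrite big_mkord gS -(big_mkord xpredT (fun i => m' (F i))).
- apply: (@le_lt_trans _ _ (C%:E * Defs.variation m setT)%E); last first.
    by apply: lte_mul_pinfty => //; rewrite ?lee_fin ?ltW.
  apply: ge_ereal_sup => _ [n [F [mF tF UF ->]]].
  apply: (@le_trans _ _ (C%:E * (\sum_(i < n) `|m (F i)|)%:E)%E).
    by rewrite -EFinM lee_fin mulr_sumr; apply: ler_sum => i _; exact: gC.
  by apply: lee_wpmul2l; [rewrite lee_fin ltW|exact: variation_ub].
- by move=> A mA A0; rewrite /m' mac.
have fsimple h : simple_function h -> simple_function (f \o h).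
  by move=> /simple_functionP[N [p [c [lp ->]]]]; exact: (simple_label (f \o c) lp).
have fappr h : approximates_in_mean nu h k -> approximates_in_mean nu (fun n => f \o h n) (f \o k).
  move=> [sh hk]; split; first by move=> n; exact: fsimple.
  apply: (@squeeze_cvge _ _ _ _ (cst 0%E) _ (fun n => (C%:E * \int[nu]_w (`|h n w - k w|)%:E)%E)).
  - apply: nearW => n; rewrite integral_ge0//=.
    apply: le_trans (le_lower_integralZl _ C0 _); last by move=> x; rewrite lee_fin.
    apply: ae_le_lower_integral.
    + by move=> x; rewrite lee_fin.
    + by move=> x; rewrite mule_ge0// lee_fin ltW.
    by apply: nearW => x; rewrite -EFinM lee_fin -fB.
  - exact: cvg_cst.
  - by rewrite -(mule0 C%:E); apply: cvgeZl.
exists (f \o k); split; first split.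
- exists (fun n => f \o s n); split; first by move=> n; exact: fsimple.
  by apply: filterS sk => w; exact: fcvg.
- by exists (fun n => f \o s2 n); exact: fappr.
move=> A mA; have [h hk hA] := kint A mA; exists (fun n => f \o h n); first exact: fappr.
have hE n : simple_integral nu A (f \o h n) = f (simple_integral nu A (h n)).
  have [N [p [c [lp ->]]]] := simple_functionP (hk.1 n).
  rewrite compA !(simple_integral_label _ _ lp mA) fS.
  by apply: eq_bigr => i _; rewrite fZ.
by have := fcvg _ _ hA; rewrite gK; under eq_fun do rewrite -hE.
Qed.

End transport.

(** * Fatou's lemma, subgradients on the line and finite Orlicz functions *)

Section fatou_limit.
Context d (T : measurableType d) (R : realType) (mu : {measure set T -> \bar R}).

(** Only the bounds c n are required to converge; the integrals of the k n need not. *)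
Lemma fatou_cvg (k : nat -> T -> \bar R) (l : T -> \bar R) (c : nat -> \bar R)
    (C : \bar R) :
  (forall n, measurable_fun setT (k n)) -> (forall n x, (0 <= k n x)%E) ->
  measurable_fun setT l -> (forall x, (0 <= l x)%E) ->
  {ae mu, forall x, k n x @[n --> \oo] --> l x} ->
  (forall n, (\int[mu]_x k n x <= c n)%E) -> c n @[n --> \oo] --> C ->
  (\int[mu]_x l x <= C)%E.
Proof.
move=> mk k0 ml l0 kl kc cC.
have := fatou mu measurableT mk (fun n x _ => k0 n x).
have -> : (\int[mu]_x limn_einf (k^~ x) = \int[mu]_x l x)%E.
  apply: ge0_ae_eq_integral => //.
  - rewrite (_ : (fun x => _) = (fun x => - limn_esup (fun n => - k n x)))%E.
      apply: measurableT_comp => //; apply: measurable_fun_limn_esup => n.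
      exact: measurableT_comp.
    apply/funext => x; rewrite -limn_einfN; congr limn_einf; apply/funext => n.
    by rewrite /= oppeK.
  - move=> x _; rewrite limn_einf_lim; apply: lime_ge; first exact: is_cvg_einfs.
    by apply: nearW => n; apply: le_ereal_inf_tmp => _ [m _ <-].
  apply: filterS kl => x kl _; rewrite is_cvg_limn_einfE; first exact: cvg_lim.
  by apply/cvg_ex; exists (l x).
move/le_trans; apply; rewrite -(cvg_lim _ cC)// -is_cvg_limn_einfE; last first.
  by apply/cvg_ex; exists C.
rewrite !limn_einf_lim; apply: lee_lim; [exact: is_cvg_einfs..|].
apply: nearW => n; apply: le_ereal_inf_tmp => _ [m nm <-].
by apply: le_trans (kc m); apply: ereal_inf_lbound; exists m.
Qed.

Lemma integral_bigcup_geometric (D : nat -> set T) (f : T -> \bar R) :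
  (forall n, measurable (D n)) -> trivIset setT D -> measurable_fun setT f ->
  (forall x, (0 <= f x)%E) ->
  (forall n, (\int[mu]_(x in D n) f x <= (2^-1 ^+ n.+1)%:E)%E) ->
  (\int[mu]_(x in \bigcup_n D n) f x <= 1)%E.
Proof.
move=> mD tD mf f0 h; rewrite ge0_integral_bigcup//; last first.
  exact: measurable_funTS.
apply: lime_le; first by apply: is_cvg_nneseries => n _ _; exact: integral_ge0.
apply: nearW => N.
apply: (@le_trans _ _ (1 - 2^-1 ^+ N)%:E); last by rewrite lee_fin gerBl exprn_ge0// invr_ge0.
elim: N => [|N IH]; first by rewrite big_geq// expr0 subrr.
rewrite big_nat_recr//=; apply: le_trans (leeD IH (h N)) _.
by rewrite -EFinD lee_fin exprS; set z := _ ^+ N; clearbody z; lra.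
Qed.

End fatou_limit.

Section subgradient.
Context (R : realType) (f : R -> R).
Hypothesis fconvex : forall t x y : R, 0 <= t <= 1 ->
  f (t * x + (1 - t) * y) <= t * f x + (1 - t) * f y.

Let slope (x y z : R) : x < y -> y < z -> (f y - f x) / (y - x) <= (f z - f y) / (z - y).
Proof.
move=> xy yz; have yx0 : 0 < y - x by rewrite subr_gt0.
have zy0 : 0 < z - y by rewrite subr_gt0.
have zx0 : 0 < z - x by rewrite subr_gt0 (lt_trans xy).
have t01 : 0 <= (z - y) / (z - x) <= 1.
  by rewrite divr_ge0 ?(ltW zy0) ?(ltW zx0)//= ler_pdivrMr// mul1r lerB// ltW.
have := fconvex x z t01.
have -> : (z - y) / (z - x) * x + (1 - (z - y) / (z - x)) * z = y.
  by field; rewrite gt_eqF.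
have -> : 1 - (z - y) / (z - x) = (y - x) / (z - x) by field; rewrite gt_eqF.
move=> h; rewrite ler_pdivrMr// mulrAC ler_pdivlMr//.
have := ler_wpM2r (ltW zx0) h.
have -> : ((z - y) / (z - x) * f x + (y - x) / (z - x) * f z) * (z - x) =
  (z - y) * f x + (y - x) * f z by field; rewrite gt_eqF.
lra.
Qed.

(** The supremum of the difference quotients on the left of x works: by convexity it is bounded by
    each quotient on the right. *)
Lemma ex_subgradient x : exists p, forall y, f x + p * (y - x) <= f y.
Proof.
pose A := [set (f x - f y) / (x - y) | y in [set y | y < x]].
have ubA z : x < z -> ubound A ((f z - f x) / (z - x)).
  by move=> xz _ [y yx <-]; exact: slope.
have hA : has_sup A.
  split; first by exists ((f x - f (x - 1)) / (x - (x - 1))), (x - 1) => //=; rewrite ltrBlDr ltrDl.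
  by exists ((f (x + 1) - f x) / (x + 1 - x)); apply: ubA; rewrite ltrDl.
exists (sup A) => y; have [yx|xy|->] := ltgtP y x; last by rewrite subrr mulr0 addr0.
  have : (f x - f y) / (x - y) <= sup A by apply: ub_le_sup; [exact: hA.2|exists y].
  by rewrite ler_pdivrMr ?subr_gt0//; lra.
have : sup A <= (f y - f x) / (y - x) by apply: ge_sup; [exact: hA.1|exact: ubA].
by rewrite ler_pdivlMr ?subr_gt0//; lra.
Qed.

(** An arbitrary choice is harmless: adding the subgradient inequalities at two points shows that
    any choice is nondecreasing, hence measurable and bounded on bounded sets. *)
Definition subgradient x : R := sval (cid (ex_subgradient x)).

Lemma subgradientP x y : f x + subgradient x * (y - x) <= f y.
Proof. by rewrite /subgradient; case: cid => p. Qed.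

Lemma subgradient_nondecreasing : {homo subgradient : x y / x <= y}.
Proof.
move=> x y; rewrite le_eqVlt => /predU1P[->//|xy].
have h1 := subgradientP x y; have h2 := subgradientP y x.
by rewrite -(@ler_pM2r _ (y - x)) ?subr_gt0//; lra.
Qed.

Lemma subgradient_measurable : measurable_fun setT subgradient.
Proof.
by apply: nondecreasing_measurable => // x y; exact: subgradient_nondecreasing.
Qed.

Lemma subgradient_bounded (N x : R) : `|x| <= N ->
  `|subgradient x| <= Num.max `|subgradient N| `|subgradient (- N)|.
Proof.
rewrite ler_norml => /andP[Nx xN]; rewrite le_max !ler_norml.
have h1 := subgradient_nondecreasing Nx; have h2 := subgradient_nondecreasing xN.
have [p0|p0] := leP 0 (subgradient x).
  apply/orP; left; rewrite (le_trans h2 (ler_norm _)) andbT.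
  by rewrite (le_trans _ p0)// oppr_le0.
apply/orP; right; rewrite (ltW (lt_le_trans p0 _))// andbT lerNl.
by rewrite -normrN; apply: le_trans (ler_norm _); rewrite lerN2.
Qed.

(** The slopes are bounded near x, so f is Lipschitz there. *)
Lemma convex_continuous : continuous f.
Proof.
move=> x; apply/cvgrPdist_le => e e0.
pose C := Num.max `|subgradient (`|x| + 1)| `|subgradient (- (`|x| + 1))|.
have C0 : 0 <= C by rewrite le_max normr_ge0.
(* The 1 keeps y in the interval where C bounds the slopes; C + 1 is positive even when C = 0. *)
have d0 : 0 < Num.min 1 (e / (C + 1)) by rewrite lt_min ltr01 divr_gt0// ltr_wpDl.
have bnd a b : `|a| <= `|x| + 1 -> f a - f b <= C * `|b - a|.
  move=> ha; have := subgradientP a b => h.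
  apply: (@le_trans _ _ (- (subgradient a * (b - a)))); first lra.
  apply: le_trans (ler_norm _) _; rewrite normrN normrM ler_wpM2r//.
  exact: subgradient_bounded.
near=> y.
have xy : `|x - y| < Num.min 1 (e / (C + 1)) by near: y; exact: cvgr_dist_lt.
move: xy; rewrite lt_min => /andP[xy1 xye].
have hy : `|y| <= `|x| + 1.
  rewrite -lerBlDl; apply: le_trans (lerB_dist _ _) _.
  by rewrite distrC ltW.
have Ce : C * `|x - y| <= e.
  move: (ltW xye); rewrite ler_pdivlMr ?ltr_wpDl// => h; apply: le_trans h.
  by rewrite mulrC ler_wpM2l// lerDl.
rewrite ler_norml; apply/andP; split.
  rewrite lerNl opprB; apply: le_trans (bnd _ _ hy) _ => //.
by apply: le_trans (bnd x y _) _; rewrite ?lerDl// distrC.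
Unshelve. all: by end_near. Qed.

End subgradient.

Section finite_orlicz_function.
Context (R : realType) (phi : orlicz_function R).
Hypothesis phi_finite : finite_orlicz phi.

(** The even extension is finite and convex on the whole line, so that subgradients are available
    for signed arguments. *)
Definition even_ext (x : R) : R := fine (phi `|x|).
Local Notation Phi := even_ext.

Lemma even_extE x : phi `|x| = (Phi x)%:E.
Proof.
have [_ p0 _ _ _] := orlicz_funP phi.
by rewrite fineK// ge0_fin_numE ?p0// phi_finite.
Qed.

Lemma even_ext_fine u : 0 <= u -> phi u = (Phi u)%:E.
Proof. by move=> u0; rewrite -even_extE ger0_norm. Qed.

Lemma even_ext_ge0 x : 0 <= Phi x.
Proof. by have [_ p0 _ _ _] := orlicz_funP phi; rewrite fine_ge0// p0. Qed.

Lemma even_ext0 : Phi 0 = 0.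
Proof. by have [p0 _ _ _ _] := orlicz_funP phi; rewrite /Phi normr0 p0. Qed.

Lemma even_ext_norm x : Phi `|x| = Phi x.
Proof. by rewrite /Phi normr_id. Qed.

Lemma le_even_ext x y : `|x| <= `|y| -> Phi x <= Phi y.
Proof.
by move=> xy; have [_ _ h _] := orlicz_gauge phi; rewrite -lee_fin -!even_extE h.
Qed.

Lemma even_ext_convex (t x y : R) : 0 <= t <= 1 ->
  Phi (t * x + (1 - t) * y) <= t * Phi x + (1 - t) * Phi y.
Proof.
move=> t01; have /andP[t0 t1] := t01; have [_ _ ple pc] := orlicz_gauge phi.
rewrite -lee_fin EFinD !EFinM -!even_extE; apply: le_trans (pc t _ _ t01 _ _) => //.
apply: ple => //; apply: le_trans (ler_normD _ _) _.
by rewrite !normrM (ger0_norm t0) (ger0_norm (_ : 0 <= 1 - t))// subr_ge0.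
Qed.

Lemma even_ext_continuous : continuous Phi.
Proof. exact/convex_continuous/even_ext_convex. Qed.

Lemma cvg_orlicz (u : nat -> R) l : u n @[n --> \oo] --> l ->
  phi `|u n| @[n --> \oo] --> phi `|l|.
Proof.
move=> ul; rewrite even_extE; under eq_fun do rewrite even_extE.
apply: cvg_EFin; first exact: nearW.
by apply: (cvg_comp _ _ ul); exact: even_ext_continuous.
Qed.

Lemma even_ext_measurable : measurable_fun setT Phi.
Proof. by apply: continuous_measurable_fun; exact: even_ext_continuous. Qed.

Lemma even_ext_contract (t x : R) : 0 <= t <= 1 -> Phi (t * x) <= t * Phi x.
Proof.
move=> t01; have := even_ext_convex x 0 t01.
by rewrite !mulr0 even_ext0 mulr0 !addr0.
Qed.

Lemma even_ext_half x y : Phi (x + y) <= Phi (2 * x) + Phi (2 * y).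
Proof.
have h : 0 <= (2^-1 : R) <= 1 by lra.
have := even_ext_convex (2 * x) (2 * y) h.
have -> : 2^-1 * (2 * x) + (1 - 2^-1) * (2 * y) = x + y by lra.
have := even_ext_ge0 (2 * x); have := even_ext_ge0 (2 * y); lra.
Qed.

(** Beyond a point u with phi u > 0, convexity and phi 0 = 0 force phi to grow at least like the
    chord with slope phi u / u. *)
Lemma even_ext_growth : exists2 a : R, 0 < a &
  exists2 b : R, 0 < b & forall x, `|x| <= a + b * Phi x.
Proof.
have [_ _ _ _ [[u u0 pu] _]] := orlicz_funP phi.
have pu0 : 0 < Phi u.
  rewrite lt_neqAle even_ext_ge0 andbT eq_sym; apply: contra pu => /eqP pu.
  by rewrite even_ext_fine ?ltW// pu.
exists u => //; exists (u / Phi u); first exact: divr_gt0.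
move=> x; have [xu|ux] := leP `|x| u.
  by rewrite (le_trans xu)// lerDl mulr_ge0 ?even_ext_ge0// divr_ge0// ltW.
have x0 : 0 < `|x| by exact: lt_trans ux.
have t01 : 0 <= u / `|x| <= 1 by rewrite ler_pdivrMr// mul1r (ltW ux) divr_ge0// ltW.
have := even_ext_contract `|x| t01; rewrite divfK ?gt_eqF// even_ext_norm => h.
suff : `|x| <= u / Phi u * Phi x by have := u0; lra.
by rewrite mulrAC ler_pdivlMr// mulrC -ler_pdivlMr// mulrAC.
Qed.

End finite_orlicz_function.

(** * Modulars and the equivalence of the Luxemburg and Orlicz norms *)

Section norms.
Context d (T : measurableType d) (R : realType).
Variables (mu : {measure set T -> \bar R}) (phi : orlicz_function R).
Implicit Types (f g : T -> R) (e l : R).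
Local Notation I f := (modular mu phi f%R).

Let phiG : gauge phi. Proof. exact: orlicz_gauge. Qed.

Lemma luxemburg_norm_le f e : 0 < e -> (I (fun x => f x / e) <= 1)%E ->
  luxemburg_norm mu phi f <= e.
Proof. by move=> e0 he; apply: ge_inf; [exists 0 => ? [/ltW]|split]. Qed.

(** With r the modular of l f, the number (1 + r) / l is the value at l of the Amemiya expression
    for the Orlicz norm. Convexity contracts the modular by the factor 1 / (1 + r), and r / (1 + r)
    <= 1. *)
Lemma modular_amemiya f l (r : R) : measurable_fun setT f -> 0 < l -> 0 <= r ->
  (I (fun x => l * f x) <= r%:E)%E -> (I (fun x => f x / ((1 + r) / l)) <= 1)%E.
Proof.
move=> mf l0 r0 h; have r1 : 0 < 1 + r by rewrite ltr_pwDl.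
have t01 : 0 <= (1 + r)^-1 <= 1 by rewrite invr_ge0 ltW//= invf_le1// lerDl.
have mlf : measurable_fun setT (fun x => l * f x) by exact: measurable_funM.
have := modular_contract mu phiG t01 mlf.
have -> : (fun x => (1 + r)^-1 * (l * f x)) = (fun x => f x / ((1 + r) / l)).
  by apply/funext => x; field; rewrite !gt_eqF.
move/le_trans; apply; apply: (@le_trans _ _ ((1 + r)^-1%:E * r%:E)%E).
  by apply: lee_wpmul2l => //; rewrite lee_fin invr_ge0 ltW.
by rewrite -EFinM lee_fin mulrC ler_pdivrMr// mul1r lerDr.
Qed.

Lemma luxemburg_norm_modular f l (r : R) : measurable_fun setT f -> 0 < l -> 0 <= r ->
  (I (fun x => l * f x) <= r%:E)%E -> luxemburg_norm mu phi f <= (1 + r) / l.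
Proof.
move=> mf l0 r0 h; apply: luxemburg_norm_le; last exact: modular_amemiya.
by rewrite divr_gt0// ltr_pwDl.
Qed.

Let luxemburg_has_inf f : f \in orlicz_class mu phi ->
  has_inf [set e : R | 0 < e /\ (I (fun x => f x / e) <= 1)%E].
Proof.
move=> /orlicz_classP[mf [l l0 lf]]; split; last by exists 0 => ? [/ltW].
have M0 : (0 <= I (fun x => l * f x))%E by exact: modular_ge0.
have r0 := fine_ge0 M0.
exists ((1 + fine (I (fun x => l * f x))) / l); split.
  by rewrite divr_gt0// ltr_pwDl.
by apply: modular_amemiya => //; rewrite fineK// ge0_fin_numE.
Qed.

Lemma modular_norm_lt f e : f \in orlicz_class mu phi ->
  luxemburg_norm mu phi f < e -> (I (fun x => f x / e) <= 1)%E.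
Proof.
move=> fO fe; have mf := orlicz_class_measurable fO.
have fe' : 0 < e - luxemburg_norm mu phi f by rewrite subr_gt0.
have [e' [e'0 he']] := inf_adherent fe' (luxemburg_has_inf fO).
rewrite addrC subrK => e'e.
apply: le_trans he'; apply: le_modular => //; [exact: measurable_funM..|].
move=> x; rewrite !normrM ler_wpM2l// !normfV lef_pV2 ?posrE ?normr_gt0 ?gt_eqF//.
  by rewrite !gtr0_norm// ?ltW// (lt_trans e'0).
exact: lt_trans e'e.
Qed.

Lemma luxemburg_norm_ge0 f : f \in orlicz_class mu phi -> 0 <= luxemburg_norm mu phi f.
Proof.
by move=> fO; apply: lb_le_inf; [case: (luxemburg_has_inf fO)|move=> e [/ltW]].
Qed.

(** The infimum defining the norm is approached along the divisors 1 + 1/(n + 1), which exceed the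
    norm; finiteness of phi makes it continuous, and Fatou's lemma applies. *)
Lemma modular_norm_le1 f : finite_orlicz phi -> f \in orlicz_class mu phi ->
  luxemburg_norm mu phi f <= 1 -> (I f <= 1)%E.
Proof.
move=> pf fO f1; have mf := orlicz_class_measurable fO.
pose k n x := phi `|f x / (1 + n.+1%:R^-1)|.
have mk n : measurable_fun setT (k n).
  by apply: gauge_measurable => //; exact: measurable_funM.
have k0 n x : (0 <= k n x)%E by have [_ h _ _] := phiG; exact: h.
have kcvg x : k n x @[n --> \oo] --> phi `|f x|.
  have h1 : (f x / (1 + n.+1%:R^-1)) @[n --> \oo] --> f x / 1.
    apply: cvgM; first exact: cvg_cst.
    apply: cvgV; first exact: oner_neq0.
    rewrite -[in X in _ --> X](addr0 1); apply: cvgD; first exact: cvg_cst.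
    exact: cvg_harmonic.
  by rewrite divr1 in h1; exact: cvg_orlicz.
apply: (fatou_cvg mk k0 _ _ _ _ (cvg_cst 1%E)).
- exact: gauge_measurable.
- by move=> x; have [_ h _ _] := phiG; exact: h.
- exact: nearW.
by move=> n; apply: modular_norm_lt => //; apply: le_lt_trans f1 _; rewrite ltrDl.
Qed.

End norms.

Section norm_equivalence.
Context d (T : measurableType d) (R : realType).
Variables (mu : {sigma_finite_measure set T -> \bar R}) (phi : orlicz_function R).
Hypothesis phi_finite : finite_orlicz phi.
Implicit Types (f g : T -> R) (e l : R).
Local Notation I f := (modular mu phi f%R).
Local Notation Is g := (modular mu (complementary phi) g%R).
Local Notation Phi := (even_ext phi).

Let phiG : gauge phi. Proof. exact: orlicz_gauge. Qed.
Let psiG : gauge (complementary phi). Proof. exact: complementary_gauge. Qed.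

Lemma integral_le_orlicz_norm f g : f \in orlicz_class mu phi ->
  measurable_fun setT g -> (Is g <= 1)%E ->
  (\int[mu]_x (f x * g x)%:E <= (orlicz_norm mu phi f)%:E)%E.
Proof. by move=> fO mg g1; rewrite orlicz_norm_fin//; apply: ereal_sup_ubound; exists g. Qed.

Lemma orlicz_norm_ge0 f : f \in orlicz_class mu phi -> 0 <= orlicz_norm mu phi f.
Proof.
move=> fO; have := integral_le_orlicz_norm fO (measurable_cst (0 : R)).
rewrite modular0// => /(_ lee01); rewrite -lee_fin; apply: le_trans.
by under eq_integral do rewrite mulr0; rewrite integral0.
Qed.

(** For e above the Luxemburg norm, Young's inequality for f / e and g bounds the pairing by e (1 +
    1). *)
Lemma orlicz_norm_le_luxemburg f : f \in orlicz_class mu phi ->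
  orlicz_norm mu phi f <= 2 * luxemburg_norm mu phi f.
Proof.
move=> fO; have mf := orlicz_class_measurable fO.
suff h e : luxemburg_norm mu phi f < e -> orlicz_norm mu phi f <= 2 * e.
  apply/ler_addgt0Pr => e e0; have := h (luxemburg_norm mu phi f + e / 2).
  by rewrite ltrDl divr_gt0// => /(_ isT); lra.
move=> fe; have e0 : 0 < e by exact: le_lt_trans (luxemburg_norm_ge0 fO) fe.
have Ife := modular_norm_lt fO fe.
rewrite -lee_fin orlicz_norm_fin//; apply: ge_ereal_sup => _ [g [mg g1] <-].
have mfe : measurable_fun setT (fun x => f x / e) by exact: measurable_funM.
have m1 := gauge_measurable phiG mfe; have m2 := gauge_measurable psiG mg.
have [_ phi0 _ _] := phiG; have [_ psi0 _ _] := psiG.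
have mfg : measurable_fun setT (fun x => (f x * g x)%:E).
  by apply/measurable_EFinP; exact: measurable_funM.
apply: le_trans (lee_abs _) _; apply: le_trans (le_abse_integral _ _ _) _ => //.
apply: (@le_trans _ _ (\int[mu]_x (e%:E * (phi `|f x / e|%R + complementary phi `|g x|%R)))%E).
  apply: ge0_le_integral => //.
  - exact: measurableT_comp.
  - by apply: measurable_funeM; exact: emeasurable_funD.
  move=> x _; have := young phi (normr_ge0 (f x / e)) (normr_ge0 (g x)).
  move=> /(lee_wpmul2l (x := e%:E)); rewrite lee_fin => /(_ (ltW e0)).
  apply: le_trans; rewrite -EFinM lee_fin !normrM normfV (gtr0_norm e0).
  by rewrite mulrA mulrCA divff ?gt_eqF// mulr1.
rewrite ge0_integralZl//; last 3 first.
- exact: emeasurable_funD.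
- by move=> x _; rewrite adde_ge0 ?phi0 ?psi0.
- by rewrite lee_fin ltW.
rewrite ge0_integralD//; last 2 first.
- by move=> x _; exact: phi0.
- by move=> x _; exact: psi0.
rewrite mulrC EFinM; apply: lee_wpmul2l; first by rewrite lee_fin ltW.
by rewrite (_ : 2%:E = 1 + 1)%E ?leeD// -EFinD.
Qed.

Let p := subgradient (even_ext_convex phi_finite).
Let pP x y : Phi x + p x * (y - x) <= Phi y.
Proof. exact: subgradientP. Qed.

(** Young's inequality is an equality at a subgradient. Giving v the sign of p x turns the
    subgradient inequality into a bound on [|p x| * v - phi v]. *)
Let young_eq x : (complementary phi `|p x| <= (x * p x - Phi x)%:E)%E.
Proof.
apply: ge_ereal_sup => _ [v v0 <-]; rewrite even_ext_fine// -EFinB lee_fin.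
have := pP x (Num.sg (p x) * v).
have -> : p x * (Num.sg (p x) * v - x) = `|p x| * v - x * p x.
  by rewrite mulrBr mulrA [p x * Num.sg _]mulrC -normrEsg (mulrC x).
have : Phi (Num.sg (p x) * v) <= Phi v.
  apply: le_even_ext => //; rewrite normrM normr_sg.
  by case: (_ != _); rewrite ?mul1r// mul0r.
by lra.
Qed.

Let b x := x * p x - Phi x.
Let b_ge0 x : 0 <= b x.
Proof. by have := pP x 0; rewrite even_ext0 /b; lra. Qed.

(** Truncations h of f, bounded and supported in sets of finite measure, are tested against g =
    p(h): the pairing is I h + B, where B is the integral of b(h) and dominates Is g. If B <= 1, g
    is admissible and I h + B <= 1. If B > 1, g / B is admissible and I h + B <= B, so I h vanishes.
    Truncation makes both terms finite, and Fatou's lemma removes it. *)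
Lemma modular_orlicz_norm_le1 f : f \in orlicz_class mu phi ->
  orlicz_norm mu phi f <= 1 -> (I f <= 1)%E.
Proof.
move=> fO f1; have mf := orlicz_class_measurable fO.
have [F [UF ndF mF]] := (sigma_finiteP _ _).1 (sigma_finiteT mu).
pose E n := F n `&` [set x | `|f x| <= n%:R].
have mE n : measurable (E n).
  apply: measurableI; first exact: (mF n).1.
  rewrite -[X in measurable X]setTI.
  by apply: measurable_fun_le => //; exact: measurableT_comp.
pose h n x := f x * \1_(E n) x.
have mh n : measurable_fun setT (h n) by apply: measurable_funM => //; exact: measurable_indic.
have hE n x : x \in E n -> h n x = f x by move=> xE; rewrite /h indicE xE mulr1.
have h0 n x : x \notin E n -> h n x = 0 by move=> xE; rewrite /h indicE (negbTE xE) mulr0.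
have mp : measurable_fun setT p by exact: subgradient_measurable.
have mPhi : measurable_fun setT Phi by exact: even_ext_measurable.
have mb : measurable_fun setT b.
  by apply: measurable_funB => //; apply: measurable_funM.
have Ih n : (I (h n) <= 1)%E.
  have bound (k : R -> R) (C : R) : measurable_fun setT k -> (forall x, 0 <= k x) -> k 0 = 0 ->
      (forall x, `|x| <= n%:R -> k x <= C) -> (\int[mu]_x (k (h n x))%:E < +oo)%E.
    move=> mk k0 kz kC; apply: (@le_lt_trans _ _ (\int[mu]_x (C%:E * (\1_(E n) x)%:E))%E).
      apply: ge0_le_integral => //.
      - by move=> x _; rewrite lee_fin.
      - by apply/measurable_EFinP; exact: measurableT_comp.
      - by apply: measurable_funeM; apply/measurable_EFinP; exact: measurable_indic.
      - move=> x _; rewrite -EFinM lee_fin indicE; case: (boolP (x \in E n)) => xE.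
          by rewrite hE// mulr1; apply: kC; case/set_mem: xE.
        by rewrite h0// kz mulr0.
    have C0 : 0 <= C by apply: le_trans (k0 0) (kC _ _); rewrite normr0.
    rewrite ge0_integralZl//; last by apply/measurable_EFinP; exact: measurable_indic.
    rewrite integral_indic// setIT lte_mul_pinfty//.
    by apply: le_lt_trans (mF n).2; apply: le_measure; rewrite ?inE//; [exact: (mF n).1|move=> x []].
  have Phile x : `|x| <= n%:R -> Phi x <= Phi n%:R.
    by move=> xn; apply: le_even_ext => //; rewrite normr_nat.
  have Ifin : (I (h n) < +oo)%E.
    rewrite /modular; under eq_integral do rewrite even_extE//.
    by apply: (bound _ (Phi n%:R)) => //; [exact: even_ext_ge0|exact: even_ext0].
  pose B := (\int[mu]_x (b (h n x))%:E)%E.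
  have Bfin : (B < +oo)%E.
    pose C := Num.max `|p n%:R| `|p (- n%:R)|.
    apply: (bound _ (n%:R * C)) => //; first by rewrite /b mul0r even_ext0 subrr.
    move=> x xn; rewrite /b lerBlDr; apply: le_trans (ler_norm _) _.
    rewrite normrM -[leLHS]addr0 lerD ?even_ext_ge0//; apply: ler_pM => //.
    exact: subgradient_bounded.
  have B0 : (0 <= B)%E by apply: integral_ge0 => x _; rewrite lee_fin.
  pose g x := p (h n x).
  have mg : measurable_fun setT g by exact: measurableT_comp.
  have IB : (\int[mu]_x (h n x * g x)%:E = I (h n) + B)%E.
    rewrite /modular; under [X in (_ = X + _)%E]eq_integral do rewrite even_extE//.
    rewrite -ge0_integralD//; last 4 first.
    - by move=> x _; rewrite lee_fin even_ext_ge0.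
    - by apply/measurable_EFinP; exact: measurableT_comp.
    - by move=> x _; rewrite lee_fin.
    - by apply/measurable_EFinP; exact: measurableT_comp.
    by apply: eq_integral => x _; rewrite -EFinD /b; congr EFin; rewrite addrC subrK.
  have Isg : (Is g <= B)%E.
    apply: ge0_le_integral => //.
    - by move=> x _; have [_ q _ _] := psiG; exact: q.
    - exact: gauge_measurable.
    - by apply/measurable_EFinP; exact: measurableT_comp.
    - by move=> x _; exact: young_eq.
  (* for c >= 1 with Is(g/c) <= 1, testing f against g/c on E n *)
  have test c : 0 < c -> (Is (fun x => c^-1 * g x) <= 1)%E -> (I (h n) + B <= c%:E)%E.
    move=> c0 gc; pose g1 x := \1_(E n) x * (c^-1 * g x).
    have mcg : measurable_fun setT (fun x => c^-1 * g x) by exact: measurable_funM.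
    have mg1 : measurable_fun setT g1 by apply: measurable_funM => //; exact: measurable_indic.
    have g11 : (Is g1 <= 1)%E.
      apply: le_trans gc; apply: le_modular => // x; rewrite normrM ler_piMl//.
      by rewrite indicE; case: (x \in E n); rewrite ?normr1// normr0.
    have := integral_le_orlicz_norm fO mg1 g11.
    have -> : (\int[mu]_x (f x * g1 x)%:E = c^-1%:E * (I (h n) + B))%E.
      rewrite -IB -ge0_integralZl//; last 3 first.
      - by apply/measurable_EFinP; exact: measurable_funM.
      - move=> x _; rewrite lee_fin; have := b_ge0 (h n x); have := even_ext_ge0 phi (h n x).
        by rewrite /b /g; lra.
      - by rewrite lee_fin invr_ge0 ltW.
      by apply: eq_integral => x _; rewrite -EFinM /g1 /h; congr EFin; ring.
    have f1' : ((orlicz_norm mu phi f)%:E <= 1)%E by rewrite lee_fin.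
    move=> /le_trans/(_ f1').
    by rewrite muleC lee_pdivrMr// mul1e.
  have Ifin' : I (h n) \is a fin_num by rewrite ge0_fin_numE// modular_ge0.
  have Bfin' : B \is a fin_num by rewrite ge0_fin_numE.
  have [B1|B1] := leP B 1%E.
    have := test 1 ltr01; rewrite invr1; under eq_fun do rewrite mul1r.
    move=> /(_ (le_trans Isg B1)); apply: le_trans.
    by rewrite leeDl.
  have Bgt1 : 1 < fine B by rewrite -lte_fin fineK.
  have : (I (h n) + B <= B)%E.
    rewrite -{2}(fineK Bfin'); apply: test; first exact: lt_trans Bgt1.
    have t01 : 0 <= (fine B)^-1 <= 1.
      by rewrite invr_ge0 (ltW (lt_trans _ Bgt1))//= invf_le1 ?(lt_trans _ Bgt1)// ltW.
    apply: le_trans (modular_contract _ psiG t01 mg) _.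
    apply: le_trans (lee_wpmul2l _ Isg) _; first by rewrite lee_fin; case/andP: t01.
    by rewrite -(fineK Bfin') -EFinM mulVf// gt_eqF// (lt_trans _ Bgt1).
  by rewrite -leeBrDr// subee// => h1; apply: le_trans h1 _.
have mk n : measurable_fun setT (fun x => phi `|h n x|) by exact: gauge_measurable.
apply: (fatou_cvg mk _ _ _ _ Ih (cvg_cst 1%E)).
- by move=> n x; have [_ q _ _] := phiG; exact: q.
- exact: gauge_measurable.
- by move=> x; have [_ q _ _] := phiG; exact: q.
apply: nearW => x; apply: cvg_near_cst.
have : setT x by []; rewrite UF => -[n _ Fn].
exists (maxn n (Num.truncn `|f x|).+1) => // k /=; rewrite geq_max => /andP[nk fk].
rewrite hE//; apply/mem_set; split.
  by have /subsetPset := ndF _ _ nk; exact.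
apply: (@le_trans _ _ (Num.truncn `|f x|).+1%:R); last by rewrite ler_nat.
by rewrite ltW// truncnS_gt.
Qed.

Lemma luxemburg_norm_le_orlicz f : f \in orlicz_class mu phi ->
  luxemburg_norm mu phi f <= orlicz_norm mu phi f.
Proof.
move=> fO; have n0 := orlicz_norm_ge0 fO.
apply/ler_addgt0Pr => e e0; set c := _ + e.
have c0 : 0 < c by rewrite ltr_wpDl.
apply: luxemburg_norm_le => //.
have -> : (fun x => f x / c) = c^-1 *: f + 0 by apply/funext => x; rewrite addr0 mulrC.
have cO : c^-1 *: f + 0 \in orlicz_class mu phi by rewrite orlicz_class_linear// orlicz_class0.
apply: modular_orlicz_norm_le1 => //; rewrite addr0 in cO *.
by rewrite orlicz_normZ// gtr0_norm ?invr_gt0// mulrC ler_pdivrMr// mul1r lerDl ltW.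
Qed.

Lemma rnp_L_phi0 : radon_nikodym_property (L_phi0 mu phi) <->
  radon_nikodym_property (L_phi mu phi).
Proof.
have le1 (x : L_phi mu phi) : `|(x : L_phi0 mu phi)| <= 2 * `|x|.
  by rewrite L_phi_normE L_phi0_normE orlicz_norm_le_luxemburg// orlicz_eltP.
have le2 (x : L_phi0 mu phi) : `|(x : L_phi mu phi)| <= 2 * `|x|.
  rewrite L_phi_normE L_phi0_normE.
  have := luxemburg_norm_le_orlicz (orlicz_eltP (orlicz_repr x)).
  have := orlicz_norm_ge0 (orlicz_eltP (orlicz_repr x)); lra.
split.
  by apply: (@rnp_isomorphic R (L_phi0 mu phi) (L_phi mu phi) id id 2).
by apply: (@rnp_isomorphic R (L_phi mu phi) (L_phi0 mu phi) id id 2).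
Qed.

End norm_equivalence.

(** * Subsets of controlled measure in a non-atomic measure space *)

Section non_atomic_measures.
Context d (T : measurableType d) (R : realType).
Variable mu : {sigma_finite_measure set T -> \bar R}.
Hypothesis mu_non_atomic : non_atomic mu.
Implicit Types (A B E : set T).

Lemma finite_positive_subset E : measurable E -> (0 < mu E)%E ->
  exists A, [/\ measurable A, A `<=` E, (0 < mu A)%E & (mu A < +oo)%E].
Proof.
move=> mE E0; have [F UF mF] := sigma_finiteT mu.
have mEF n : measurable (E `&` F n) by apply: measurableI => //; exact: (mF n).1.
have [n En] : exists n, (0 < mu (E `&` F n))%E.
  apply: contrapT => h; suff : mu.-negligible E.
    by move/(negligibleP _ mE) => EE; rewrite EE ltxx in E0.
  apply: (@negligibleS _ _ _ _ (\bigcup_n (E `&` F n))).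
    by rewrite -setI_bigcupr -UF setIT.
  apply: negligible_bigcup => n; apply/negligibleP => //.
  apply/eqP; rewrite eq_le measure_ge0 andbT leNgt; apply/negP => En.
  by apply: h; exists n.
exists (E `&` F n); split => //.
by apply: le_lt_trans (mF n).2; apply: le_measure; rewrite ?inE//; exact: (mF n).1.
Qed.

(** Non-atomicity splits a set of finite measure into two parts of positive measure, one of which
    has at most half the measure; this is iterated. *)
Lemma small_positive_subset E (e : R) : measurable E -> (0 < mu E)%E -> 0 < e ->
  exists A, [/\ measurable A, A `<=` E, (0 < mu A)%E & (mu A <= e%:E)%E].
Proof.
move=> mE0 E00 e0; have [E' [mE E'E E0 Efin]] := finite_positive_subset mE0 E00.
suff [A [mA AE A0 Ae]] : exists A, [/\ measurable A, A `<=` E', (0 < mu A)%E & (mu A <= e%:E)%E].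
  by exists A; split => //; exact: subset_trans E'E.
have Efin' : mu E' \is a fin_num by rewrite ge0_fin_numE.
have step n : exists A, [/\ measurable A, A `<=` E', (0 < mu A)%E &
    (mu A <= (fine (mu E') / 2 ^+ n)%:E)%E].
  elim: n => [|n [A [mA AE A0 An]]].
    by exists E'; split => //; rewrite expr0 divr1 fineK.
  have Afin : mu A \is a fin_num by rewrite ge0_fin_numE// (le_lt_trans An)// ltry.
  have [B [mB BA B0 BltA]] := mu_non_atomic mA A0.
  have Bfin : mu B \is a fin_num by rewrite ge0_fin_numE// (lt_trans BltA)// -ge0_fin_numE.
  have mD : measurable (A `\` B) by exact: measurableD.
  have DE : mu (A `\` B) = (mu A - mu B)%E.
    by rewrite measureD// ?(setIidr BA)// -ge0_fin_numE.
  have half : fine (mu E') / 2 ^+ n.+1 = fine (mu E') / 2 ^+ n / 2.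
    by rewrite exprS; field; rewrite expf_neq0.
  have An' : fine (mu A) <= fine (mu E') / 2 ^+ n by rewrite -lee_fin fineK.
  have BltA' : fine (mu B) < fine (mu A) by rewrite fine_lt.
  have [hB|hB] := leP (fine (mu B)) (fine (mu A) / 2).
    exists B; split => //; first exact: subset_trans AE.
    by rewrite -(fineK Bfin) lee_fin half; lra.
  exists (A `\` B); split => //.
  - by apply: subset_trans AE; exact: subDsetl.
  - by rewrite DE -(fineK Afin) -(fineK Bfin) -EFinB lte_fin subr_gt0.
  - by rewrite DE -(fineK Afin) -(fineK Bfin) -EFinB lee_fin half; lra.
pose n := (Num.truncn (fine (mu E') / e)).+1.
have [A [mA AE A0 An]] := step n; exists A; split => //.
apply: le_trans An _; rewrite lee_fin ler_pdivrMr ?exprn_gt0//.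
rewrite mulrC -ler_pdivrMr//; apply: (@le_trans _ _ n%:R); first by rewrite ltW// truncnS_gt.
by rewrite -natrX ler_nat ltnW// ltn_expl.
Qed.

(* If no subset had measure in [a, 2a], the subsets of measure at most 2a
   would have measure < a and be closed under countable unions. *)
Lemma intermediate_subset B (a : R) : measurable B -> 0 < a -> (a%:E < mu B)%E ->
  exists A, [/\ measurable A, A `<=` B, (a%:E <= mu A)%E & (mu A <= (2 * a)%:E)%E].
Proof.
move=> mB a0 aB; apply: contrapT => h.
have lta A : measurable A -> A `<=` B -> (mu A <= (2 * a)%:E)%E -> (mu A < a%:E)%E.
  by move=> mA AB A2; rewrite ltNge; apply/negP => aA; apply: h; exists A.
have aa : (2 * a)%:E = (a%:E + a%:E)%E by rewrite -EFinD mulr_natl.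
have le2a : (a%:E <= (2 * a)%:E)%E by rewrite lee_fin; lra.
pose F := [set mu A | A in [set A | [/\ measurable A, A `<=` B & (mu A < a%:E)%E]]].
have F0 : F 0%E by exists set0; [split => //; rewrite measure0 lte_fin|rewrite measure0].
have sa : (ereal_sup F <= a%:E)%E by apply: ge_ereal_sup => _ [A [_ _ Aa] <-]; exact: ltW.
have s0 : (0 <= ereal_sup F)%E by exact: ereal_sup_ubound.
have sfin : ereal_sup F \is a fin_num by rewrite ge0_fin_numE// (le_lt_trans sa)// ltry.
have /choice[A HA] : forall n : nat, exists A, [/\ measurable A, A `<=` B, (mu A < a%:E)%E &
    (ereal_sup F - n.+1%:R^-1%:E < mu A)%E].
  move=> n; have n0 : 0 < (n.+1%:R^-1 : R) by rewrite invr_gt0.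
  have [_ [A [mA AB Aa] <-] hA] := ub_ereal_sup_adherent n0 sfin.
  by exists A.
have HU n : [/\ measurable (\big[setU/set0]_(i < n) A i), \big[setU/set0]_(i < n) A i `<=` B &
    (mu (\big[setU/set0]_(i < n) A i) < a%:E)%E].
  elim: n => [|n [mU UB Ua]]; first by rewrite big_ord0; split => //; rewrite measure0 lte_fin.
  have [mA AB Aa _] := HA n; rewrite big_ord_recr/=; split; first exact: measurableU.
    by move=> x []; [exact: UB|exact: AB].
  apply: lta; [exact: measurableU|by move=> x []; [exact: UB|exact: AB]|].
  apply: le_trans (measureU2 _ _ _) _ => //.
  by rewrite aa leeD// ltW.
pose U := \bigcup_n A n.
have mU : measurable U by apply: bigcup_measurable => n _; case: (HA n).
have UB : U `<=` B by move=> x [n _]; case: (HA n) => _ + _ _; exact.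
have Ua : (mu U <= a%:E)%E.
  have Ucvg : (mu (\big[setU/set0]_(i < n.+1) A i) @[n --> \oo] --> mu U)%E.
    rewrite /U -bigcup_bigsetU_bigcup; apply: nondecreasing_cvg_mu.
    - by move=> n; case: (HU n.+1).
    - by rewrite bigcup_bigsetU_bigcup.
    - by move=> n m nm; apply/subsetPset; exact: subset_bigsetU.
  rewrite -(cvg_lim _ Ucvg)//; apply: lime_le; first by apply/cvg_ex; eexists; exact: Ucvg.
  by apply: nearW => n; case: (HU n.+1) => _ _ /ltW.
have Ua' : (mu U < a%:E)%E by apply: lta => //; exact: le_trans le2a.
have Us : mu U = ereal_sup F.
  apply/eqP; rewrite eq_le; apply/andP; split; first by apply: ereal_sup_ubound; exists U.
  apply/lee_addgt0Pr => e e0; rewrite -leeBlDr//.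
  have [n] := ltr_add_invr e0; rewrite add0r => ne.
  have [mA AB Aa hA] := HA n.
  apply: (@le_trans _ _ (ereal_sup F - n.+1%:R^-1%:E)%E).
    by rewrite leeB// lee_fin ltW.
  apply: le_trans (ltW hA) _; apply: le_measure; rewrite ?inE//.
  by move=> x Ax; exists n.
have Ufin : mu U \is a fin_num by rewrite Us.
have mD : measurable (B `\` U) by exact: measurableD.
have D0 : (0 < mu (B `\` U))%E.
  rewrite lt0e measure_ge0 andbT; apply/eqP => D0.
  suff : (mu B <= mu U)%E by rewrite leNgt (lt_trans Ua').
  rewrite -(setDUK UB); apply: le_trans (measureU2 _ _ _) _ => //.
  by rewrite [X in (_ + X)%E]D0 adde0.
(* The union of U and A' has measure at most 2a, hence less than a by [lta]; so it competes in the
   supremum F, which U already attains, although A' has positive measure. *)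
have [A' [mA' A'D A'0 A'a]] := small_positive_subset mD D0 a0.
have UA' : mu (U `|` A') = (mu U + mu A')%E.
  rewrite measureU//; apply/seteqP; split=> // x [Ux /A'D[_]]; exact.
have : (mu (U `|` A') <= ereal_sup F)%E.
  apply: ereal_sup_ubound; exists (U `|` A') => //.
  have UA'B : U `|` A' `<=` B by move=> x [/UB//|/A'D[]].
  split => //; first exact: measurableU.
  apply: lta => //; first exact: measurableU.
  by rewrite UA' aa leeD// ltW.
rewrite UA' -Us -[X in (_ <= X)%E]adde0 leeD2lE//.
by rewrite leNgt A'0.
Qed.

End non_atomic_measures.

(** * Necessity: growth of phi at infinity *)

Section L_phi_elements.
Context d (T : measurableType d) (R : realType).
Variables (mu : {sigma_finite_measure set T -> \bar R}) (phi : orlicz_function R).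
Implicit Types (f g : T -> R) (x y : L_phi mu phi).
Local Notation I f := (modular mu phi f%R).
Local Notation lux := (luxemburg_norm mu phi).

Let phiG : gauge phi. Proof. exact: orlicz_gauge. Qed.

Lemma le_luxemburg_norm f g : measurable_fun setT f -> g \in orlicz_class mu phi ->
  (forall t, `|f t| <= `|g t|) -> f \in orlicz_class mu phi /\ lux f <= lux g.
Proof.
move=> mf gO fg; have mg := orlicz_class_measurable gO.
have fO : f \in orlicz_class mu phi.
  have [_ [l l0 lg]] := orlicz_classP _ _ _ gO.
  apply/orlicz_classP; split => //; exists l => //; apply: le_lt_trans lg.
  apply: le_modular => //; [exact: measurable_funM..|].
  by move=> t; rewrite !normrM ler_wpM2l.
split => //; apply/ler_addgt0Pr => e e0.
have ge : lux g < lux g + e by rewrite ltrDl.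
apply: luxemburg_norm_le; first exact: le_lt_trans (luxemburg_norm_ge0 gO) ge.
apply: le_trans (modular_norm_lt gO ge); apply: le_modular => //; [exact: measurable_funM..|].
by move=> t; rewrite !normrM ler_wpM2r.
Qed.

Lemma orlicz_repr_class x : (orlicz_repr x : T -> R) \in orlicz_class mu phi.
Proof. exact: orlicz_eltP. Qed.

Lemma orlicz_repr_measurable x : measurable_fun setT (orlicz_repr x : T -> R).
Proof. exact/orlicz_class_measurable/orlicz_repr_class. Qed.

Lemma L_phi_norm_ae x f : measurable_fun setT f ->
  (orlicz_repr x : T -> R) = f %[ae mu] -> `|x| = lux f.
Proof.
move=> mf xf; rewrite L_phi_normE (ae_eq_luxemburg_norm _ _ mf xf)//.
exact: orlicz_repr_measurable.
Qed.

Lemma orlicz_repr_lin x y (a : R) :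
  (orlicz_repr (x - a *: y : L_phi mu phi) : T -> R) =
  (fun t => orlicz_repr x t - a * orlicz_repr y t) %[ae mu].
Proof.
apply: filterS2 (orlicz_reprD x (- (a *: y) : L_phi mu phi))
  (orlicz_reprZ (- a) y) => t h1 h2 _.
by rewrite h1// -scaleNr !fctE h2// fctE /GRing.scale/= mulNr.
Qed.

Definition L_phi_of f (fO : f \in orlicz_class mu phi) : L_phi mu phi :=
  orlicz_pi (OrliczElt fO).

Lemma repr_L_phi_of f (fO : f \in orlicz_class mu phi) :
  (orlicz_repr (L_phi_of fO) : T -> R) = f %[ae mu].
Proof. exact: (repr_pi_ae (OrliczElt fO)). Qed.

Lemma L_phi_of_norm f (fO : f \in orlicz_class mu phi) : `|L_phi_of fO| = lux f.
Proof.
apply: L_phi_norm_ae; last exact: repr_L_phi_of.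
exact: orlicz_class_measurable fO.
Qed.

Lemma L_phi_ofD f g h (fO : f \in orlicz_class mu phi) (gO : g \in orlicz_class mu phi)
    (hO : h \in orlicz_class mu phi) : (forall t, h t = f t + g t) ->
  L_phi_of hO = L_phi_of fO + L_phi_of gO.
Proof.
move=> hfg; rewrite /L_phi_of -[RHS](orlicz_piD (OrliczElt fO) (OrliczElt gO)).
by apply/pi_eqP; apply: nearW => t _; exact: hfg.
Qed.

End L_phi_elements.

Section not_N_function.
Context d (T : measurableType d) (R : realType).
Variables (mu : {sigma_finite_measure set T -> \bar R}) (phi : orlicz_function R).
Hypothesis mu_non_atomic : non_atomic mu.
Hypothesis mu_pos : (0 < mu setT)%E.
Hypothesis phi_finite : finite_orlicz phi.
Local Notation I f := (modular mu phi f%R).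
Local Notation Phi := (even_ext phi).
Local Notation lux := (luxemburg_norm mu phi).

Let phiG : gauge phi. Proof. exact: orlicz_gauge. Qed.

(** By convexity Phi u / u is nondecreasing for u > 0, so it tends to infinity unless it is
    bounded. *)
Lemma not_N_function_linear : ~ N_function_at_infinity phi ->
  exists2 l : R, 0 < l & forall u, Phi u <= l * `|u|.
Proof.
move=> h; apply: contrapT => hl; apply: h.
apply/cvgeyPge => A; pose M := Num.max 1 A.
have M0 : 0 < M by rewrite lt_max ltr01.
have [u0 hu0] : exists u, M * `|u| < Phi u.
  apply: contrapT => hu; apply: hl; exists M => // u.
  by rewrite leNgt; apply/negP => uu; apply: hu; exists u.
have u00 : 0 < `|u0|.
  by rewrite normr_gt0; apply: contraTneq hu0 => ->; rewrite even_ext0 normr0 mulr0 ltxx.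
near=> u; have uu0 : `|u0| <= u by near: u; exact: nbhs_pinfty_ge.
have u0' : 0 < u by exact: lt_le_trans uu0.
rewrite even_ext_fine ?(ltW u0')// -EFinM lee_fin ler_pdivlMr//.
have t01 : 0 <= `|u0| / u <= 1 by rewrite divr_ge0 ?(ltW u0')//= ler_pdivrMr// mul1r.
have := even_ext_contract phi_finite u t01; rewrite divfK ?gt_eqF// even_ext_norm => h.
have AM : A <= M by rewrite le_max lexx orbT.
apply: (@le_trans _ _ (M * u)); first by rewrite ler_wpM2r// ltW.
rewrite -(@ler_pM2l _ `|u0|)//.
have : M * `|u0| <= `|u0| / u * Phi u by apply: le_trans h; exact: ltW.
by rewrite mulrAC ler_pdivlMr//; lra.
Unshelve. all: by end_near. Qed.

(** On a set of finite measure L_phi embeds into L^1: integrate [|f / e| <= a + b * Phi (f / e)] for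
    e slightly above the norm of f, where the modular of f / e is at most 1. *)
Lemma integral_le_luxemburg_norm (B : set T) : measurable B -> (mu B < +oo)%E ->
  exists2 K : R, 0 < K & forall f, f \in orlicz_class mu phi ->
    (\int[mu]_(x in B) (`|f x|)%:E <= (K * lux f)%:E)%E.
Proof.
move=> mB Boo; have [a a0 [b b0 hab]] := even_ext_growth phi_finite.
have Bfin : mu B \is a fin_num by rewrite ge0_fin_numE.
pose K := a * fine (mu B) + b.
have K0 : 0 < K by rewrite ltr_wpDl// mulr_ge0 ?fine_ge0// ltW.
exists K => // f fO; have mf := orlicz_class_measurable fO.
apply/lee_addgt0Pr => r r0; set e := lux f + r / K.
have ef : lux f < e by rewrite ltrDl divr_gt0.
have e0 : 0 < e by exact: le_lt_trans (luxemburg_norm_ge0 fO) ef.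
have -> : ((K * lux f)%:E + r%:E = (e * K)%:E)%E.
  by rewrite -EFinD /e; congr EFin; field; rewrite gt_eqF.
have mfe : measurable_fun setT (fun x => f x / e) by exact: measurable_funM.
have mPf : measurable_fun setT (fun x => (Phi (f x / e))%:E).
  by apply/measurable_EFinP; apply: measurableT_comp mfe; exact: even_ext_measurable.
apply: (@le_trans _ _ (\int[mu]_(x in B) (e%:E * (a%:E + b%:E * (Phi (f x / e))%:E)))%E).
  apply: ge0_le_integral => //.
  - by apply/measurable_EFinP; apply: measurable_funTS; exact: measurableT_comp.
  - apply: measurable_funeM; apply: emeasurable_funD => //.
    by apply: measurable_funeM; exact: measurable_funTS.
  move=> x _; rewrite [X in (_ <= X)%E](_ : _ = (e * (a + b * Phi (f x / e)))%:E)// lee_fin.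
  have := hab (f x / e); rewrite normrM normfV (gtr0_norm e0) ler_pdivrMr//.
  by rewrite mulrC.
rewrite ge0_integralZl//; last 3 first.
- apply: emeasurable_funD => //.
  by apply: measurable_funeM; exact: measurable_funTS.
- by move=> x _; rewrite -EFinM -EFinD lee_fin addr_ge0 ?mulr_ge0 ?even_ext_ge0// ltW.
- by rewrite lee_fin ltW.
rewrite EFinM; apply: lee_wpmul2l; first by rewrite lee_fin ltW.
rewrite ge0_integralD//; last 3 first.
- by move=> x _; rewrite lee_fin ltW.
- by move=> x _; rewrite -EFinM lee_fin mulr_ge0 ?even_ext_ge0// ltW.
- by apply: measurable_funeM; exact: measurable_funTS.
rewrite integral_cst// ge0_integralZl//; last 3 first.
- exact: measurable_funTS.
- by move=> x _; rewrite lee_fin even_ext_ge0.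
- by rewrite lee_fin ltW.
rewrite EFinD EFinM fineK// leeD2l// -[leRHS]mule1.
apply: lee_wpmul2l; first by rewrite lee_fin ltW.
apply: le_trans (modular_norm_lt fO ef).
rewrite /modular; under [leRHS]eq_integral do rewrite even_extE//.
apply: ge0_subset_integral => //.
by move=> x _; rewrite lee_fin even_ext_ge0.
Qed.

(* If phi u <= l u, then A |-> \1_(A `&` B) is dominated by a multiple of mu.
   Its density would be nearly constant, equal to y, on some E; but y is bounded
   by some N on part of E, so it is not close to \1_A / mu A for small A there. *)
Lemma rnp_N_function : radon_nikodym_property (L_phi mu phi) -> N_function_at_infinity phi.
Proof.
move=> rnp; apply: contrapT => /not_N_function_linear[l l0 hl].
have half_le (x : R) : x <= 2^-1 -> 2^-1 <= 1 - x by lra.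
have quarter (x : R) : 0 < x -> 4^-1 * x < 2^-1 * x by lra.
have [B [mB _ B0 Boo]] := finite_positive_subset measurableT mu_pos.
have [K K0 hK] := integral_le_luxemburg_norm mB Boo.
pose nu := mfrestr mB Boo.
have mAB A : measurable A -> measurable (A `&` B) by move=> mA; exact: measurableI.
(* A vector measure is a function on all sets, so non-measurable ones receive the value 0. *)
pose f A : T -> R := \1_(if `[< measurable A >] then A `&` B else set0).
have fE A : measurable A -> f A = \1_(A `&` B) by move=> mA; rewrite /f asboolT.
have mf A : measurable_fun setT (f A).
  by apply: measurable_indic; case: asboolP => // mA; exact: mAB.
have nuE A : nu A = mu (A `&` B) by [].
have ABfin A : measurable A -> mu (A `&` B) \is a fin_num.
  move=> mA; rewrite ge0_fin_numE//; apply: (le_lt_trans _ Boo).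
  by apply: le_measure; rewrite ?inE//; exact: mAB.
have If A (e : R) : measurable A -> 0 < e -> (I (fun x => f A x / e) <= (l / e)%:E * mu (A `&` B))%E.
  move=> mA e0; apply: (@le_trans _ _ (\int[mu]_x ((l / e)%:E * (f A x)%:E))%E).
    apply: ge0_le_integral => //.
    - by move=> x _; have [_ q _ _] := phiG; exact: q.
    - by apply: gauge_measurable => //; exact: measurable_funM.
    - by apply: measurable_funeM; exact/measurable_EFinP.
    move=> x _; rewrite even_extE// -EFinM lee_fin; apply: le_trans (hl _) _.
    rewrite normrM normfV (gtr0_norm e0) mulrAC mulrA -!mulrA ler_wpM2l ?(ltW l0)//.
    by rewrite ger0_norm// fE// indicE.
  rewrite ge0_integralZl//; last 3 first.
  - exact/measurable_EFinP.
  - by move=> x _; rewrite fE// lee_fin.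
  - by rewrite lee_fin divr_ge0// ltW.
  by rewrite fE// integral_indic ?setIT//; exact: mAB.
have fO A : f A \in orlicz_class mu phi.
  apply/orlicz_classP; split => //; exists 1 => //.
  have [mA|nmA] := pselect (measurable A); last first.
    rewrite (_ : (fun x => _) = fun=> 0) ?modular0//.
    by apply/funext => x; rewrite /f asboolF// indicE in_set0 mulr0.
  have := If A 1 mA ltr01; under eq_fun do rewrite divr1.
  under [X in _ -> (modular _ _ X < _)%E]eq_fun do rewrite mul1r.
  move/le_lt_trans; apply; rewrite -(fineK (ABfin _ mA)) -EFinM; exact: ltry.
pose m A := L_phi_of (fO A).
have mC A : measurable A -> `|m A| <= l * fine (nu A).
  move=> mA; rewrite L_phi_of_norm; apply/ler_addgt0Pr => r r0.
  have x0 : 0 <= l * fine (nu A) by rewrite mulr_ge0 ?fine_ge0// ltW.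
  have e0 : 0 < l * fine (nu A) + r by rewrite ltr_wpDl.
  apply: luxemburg_norm_le => //; apply: le_trans (If A _ mA e0) _.
  rewrite -(fineK (ABfin _ mA)) -EFinM lee_fin mulrAC ler_pdivrMr// mul1r.
  by rewrite -[leLHS]addr0 lerD// ltW.
have mfa : finitely_additive m.
  move=> A A' mA mA' AA'; apply: L_phi_ofD => t.
  rewrite !fE//; last exact: measurableU.
  rewrite setIUl !indicE in_setU.
  have [tA|] := boolP (t \in A `&` B); have [tA'|] := boolP (t \in A' `&` B); rewrite ?addr0 ?add0r//=.
  move: tA tA' => /set_mem[tA _] /set_mem[tA' _].
  by have : (A `&` A') t by []; rewrite AA'.
have [ca va ac] := bounded_additive_rnp_hyp mfa mC.
have [g [bg gm]] := rnp _ _ nu m ca va ac.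
(* With this eta the L^1 norm of the error on A is at most mu A / 4, whereas it will be bounded
   below by mu A / 2. *)
have eta0 : 0 < (4 * K)^-1 by rewrite invr_gt0 mulr_gt0.
have nuT : (0 < nu setT)%E by rewrite nuE setTI.
have [E [y [mE _ E0 hE]]] := density_nearly_constant bg gm eta0 measurableT nuT.
have E0' : (0 < mu (E `&` B))%E by [].
have hE' A : measurable A -> A `<=` E ->
    `|m A - fine (mu (A `&` B)) *: y| <= (4 * K)^-1 * fine (mu (A `&` B)) by exact: hE.
have my := orlicz_repr_measurable y.
pose C n := E `&` B `&` [set t | `|orlicz_repr y t| <= n.+1%:R].
have mC' n : measurable (C n).
  apply: measurableI; first exact: mAB.
  rewrite -[X in measurable X]setTI.
  by apply: measurable_fun_le => //; exact: measurableT_comp.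
have [n Cn] : exists n, (0 < mu (C n))%E.
  apply: contrapT => h; suff : mu.-negligible (E `&` B).
    move/(negligibleP _ (mAB _ mE)) => EB0.
    by move: E0'; rewrite EB0 ltxx.
  apply: (@negligibleS _ _ _ _ (\bigcup_n C n)).
    move=> t Et; exists (Num.truncn `|orlicz_repr y t|) => //; split => //=.
    by rewrite ltW// truncnS_gt.
  apply: negligible_bigcup => n; apply/negligibleP => //.
  apply/eqP; rewrite eq_le measure_ge0 andbT leNgt; apply/negP => En.
  by apply: h; exists n.
(* On C n the function y is at most n + 1 in absolute value, so for mu A below this bound [mu A * y]
   is at most 1/2 there. *)
have N0 : 0 < ((2 * n.+1%:R)^-1 : R) by rewrite invr_gt0 mulr_gt0.
have [A [mA AC A0 Ae]] := small_positive_subset mu_non_atomic (mC' n) Cn N0.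
have AB : A `&` B = A by apply/setIidPl => t /AC[[]].
have Afin : mu A \is a fin_num by rewrite -AB; exact: ABfin.
have Ap : 0 < fine (mu A) by rewrite fine_gt0// A0 ltey_eq Afin.
have AE : A `<=` E by move=> t /AC[[]].
have := hE' A mA AE; rewrite AB.
pose h t := f A t - fine (mu A) * orlicz_repr y t.
have mh : measurable_fun setT h by apply: measurable_funB => //; exact: measurable_funM.
have xh : (orlicz_repr (m A - fine (mu A) *: y : L_phi mu phi) : T -> R) = h %[ae mu].
  apply: filterS2 (orlicz_repr_lin (m A) y (fine (mu A))) (repr_L_phi_of (fO A)) => t h1 h2 _.
  by rewrite h1// h2.
rewrite (L_phi_norm_ae mh xh) => hlux.
have hO : h \in orlicz_class mu phi.
  have -> : h = - fine (mu A) *: (orlicz_repr y : T -> R) + f A.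
    by apply/funext => t; rewrite /h !fctE /GRing.scale/= mulNr addrC.
  exact: orlicz_class_linear (orlicz_repr_class y) (fO A).
have := hK h hO; rewrite leNgt => /negP; apply.
apply: (@lt_le_trans _ _ (\int[mu]_(x in A) (2^-1)%:E)%E); last first.
  apply: (@le_trans _ _ (\int[mu]_(x in A) (`|h x|)%:E)%E).
    apply: ge0_le_integral => //.
    - by apply/measurable_EFinP; apply: measurable_funTS; exact: measurableT_comp.
    move=> t At; rewrite lee_fin /h fE// indicE AB mem_set// mulr1n.
    have [_ /= yn] := AC _ At.
    have : `|fine (mu A) * orlicz_repr y t| <= 2^-1.
      rewrite normrM gtr0_norm//; apply: (@le_trans _ _ ((2 * n.+1%:R)^-1 * n.+1%:R)).
        by apply: ler_pM => //; [exact: ltW|rewrite -lee_fin fineK].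
      by rewrite invfM -mulrA mulVf// mulr1.
    by rewrite ler_norml => /andP[_ h2]; apply: le_trans (ler_norm _); exact: half_le.
  apply: ge0_subset_integral => //.
  - by apply/measurable_EFinP; apply: measurable_funTS; exact: measurableT_comp.
  - by rewrite -AB.
have -> : (\int[mu]_(_ in A) (2^-1)%:E = (2^-1 * fine (mu A))%:E)%E.
  by rewrite integral_cst// EFinM fineK.
rewrite lte_fin.
apply: (@le_lt_trans _ _ (K * ((4 * K)^-1 * fine (mu A)))); first by rewrite ler_wpM2l// ltW.
have -> : K * ((4 * K)^-1 * fine (mu A)) = 4^-1 * fine (mu A) by field; rewrite gt_eqF.
exact: quarter.
Qed.

End not_N_function.

(** * Necessity: the growth condition Delta2 *)

Section lebesgue_cuts.
Context (R : realType).

Definition unit_lebesgue : set (measurableTypeR R) -> \bar R :=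
  mrestr (@lebesgue_measure R) (measurable_itv `[0, 1]).
HB.instance Definition _ := Measure.on unit_lebesgue.

Let unit_lebesgue_fin : fin_num_fun unit_lebesgue.
Proof.
move=> A mA; rewrite ge0_fin_numE//.
apply: (@le_lt_trans _ _ (@lebesgue_measure R `[0%R, 1%R]%classic)).
  by apply: le_measure; rewrite ?inE//; apply: measurableI.
by rewrite lebesgue_measure_itv/= lte01 oppr0 adde0 ltry.
Qed.

HB.instance Definition _ := Measure_isFinite.Build _ _ _ unit_lebesgue unit_lebesgue_fin.

(** The half-lines with rational endpoint, indexed by the codes of the rationals; a number that
    codes no rational gives the cut at 0. *)
Definition rational_cut (n : nat) : set R :=
  [set x | x <= ratr (odflt 0 (unpickle n))].

Lemma rational_cutE (q : rat) : rational_cut (pickle q) = [set x | x <= ratr q].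
Proof. by rewrite /rational_cut pickleK. Qed.

Lemma measurable_rational_cut n : measurable (rational_cut n).
Proof. exact: measurable_itv `]-oo, ratr (odflt 0 (unpickle n))]. Qed.

(** If every cut left a null part of E on one side, let c be the supremum of the rationals whose
    left part is null. Up to a null set E would be contained in {c}, which is null as well. *)
Lemma lebesgue_split (E : set (measurableTypeR R)) : measurable E -> (0 < unit_lebesgue E)%E ->
  exists n, (0 < unit_lebesgue (E `&` rational_cut n))%E /\
            (0 < unit_lebesgue (E `\` rational_cut n))%E.
Proof.
move=> mE E0; apply: contrapT => h; pose nu := unit_lebesgue.
have mL n : measurable (E `&` rational_cut n).
  by apply: measurableI => //; exact: measurable_rational_cut.
have mR n : measurable (E `\` rational_cut n).
  by apply: measurableD => //; exact: measurable_rational_cut.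
have zero A : measurable A -> ~ (0 < nu A)%E -> nu A = 0%E.
  by move=> mA /negP; rewrite -leNgt => A0; apply/eqP; rewrite eq_le A0 measure_ge0.
pose Z := [set x : R | exists2 q : rat, x = ratr q & nu (E `&` rational_cut (pickle q)) = 0%E].
have nZ q : ~ Z (ratr q) -> nu (E `\` rational_cut (pickle q)) = 0%E.
  move=> qZ; apply: zero => // hq; apply: h; exists (pickle q); split => //.
  rewrite lt0e measure_ge0 andbT; apply/eqP => q0; apply: qZ; by exists q.
have ZE q : Z (ratr q) -> nu (E `&` rational_cut (pickle q)) = 0%E.
  by move=> [q' /fmorph_inj ->].
(* The measure lives on [0, 1], so the cut at -1 has a null left part, while no rational above 1 can
   belong to Z. *)
have Zinf : Z (ratr (-1)).
  exists (-1) => //; rewrite rational_cutE rmorphN1 /nu /unit_lebesgue /mrestr.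
  rewrite (_ : _ `&` _ = set0) ?measure0//; apply/seteqP; split=> // x [[_ /=]].
  by rewrite in_itv/= => x1 /andP[x0 _]; have := le_trans x0 x1; rewrite oppr_ge0 ler10.
have Zsup x : Z x -> x <= 1.
  move=> [q -> q0]; rewrite leNgt; apply/negP => q1.
  move: E0; rewrite (_ : unit_lebesgue E = nu (E `&` rational_cut (pickle q))); first by rewrite q0 ltxx.
  rewrite /nu /unit_lebesgue /mrestr; congr (lebesgue_measure _); apply/seteqP; split=> z /=.
    move=> [Ex xi]; split => //; split => //; rewrite rational_cutE/=.
    by move: xi; rewrite in_itv/= => /andP[_ /le_trans]; apply; exact: ltW.
  by move=> [[]].
have hZ : has_sup Z by split; [exists (ratr (-1))|exists 1 => x /Zsup].
pose c := sup Z.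
have below q : ratr q < c -> nu (E `&` rational_cut (pickle q)) = 0%E.
  move=> qc; have cq0 : 0 < c - ratr q by rewrite subr_gt0.
  have [_ [q' -> Zq']] := sup_adherent cq0 hZ.
  rewrite -/c subKr => qq'; apply/eqP; rewrite eq_le measure_ge0 andbT.
  rewrite -Zq'; apply: le_measure; rewrite ?inE// => x [Ex].
  by rewrite !rational_cutE/= => xq; split => //=; rewrite (le_trans xq)// ltW.
have above q : c < ratr q -> nu (E `\` rational_cut (pickle q)) = 0%E.
  move=> cq; apply: nZ => /(ub_le_sup hZ.2); by rewrite leNgt cq.
suff : nu.-negligible E by move/(negligibleP _ mE) => E00; rewrite E00 ltxx in E0.
pose L (q : nat) := if ratr (odflt 0 (unpickle q)) < c then E `&` rational_cut q else set0.
pose U (q : nat) := if c < ratr (odflt 0 (unpickle q)) then E `\` rational_cut q else set0.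
have c0 : nu.-negligible [set c].
  apply/negligibleP => //; apply/eqP; rewrite eq_le measure_ge0 andbT.
  rewrite -(lebesgue_measure_set1 c); apply: le_measure; rewrite ?inE//.
  by apply: measurableI.
apply: (@negligibleS _ _ _ _ (\bigcup_q L q `|` \bigcup_q U q `|` [set c])).
  move=> x Ex; have [xc|cx|->] := ltgtP x c; last by right.
    have [q] := rat_in_itvoo xc; rewrite in_itv/= => /andP[xq qc].
    left; left; exists (pickle q) => //; rewrite /L pickleK/= qc; split => //.
    by rewrite rational_cutE/= ltW.
  have [q] := rat_in_itvoo cx; rewrite in_itv/= => /andP[cq qx].
  left; right; exists (pickle q) => //; rewrite /U pickleK/= cq; split => //.
  by rewrite rational_cutE/=; apply/negP; rewrite -ltNge.
apply: negligibleU => //; apply: negligibleU; apply: negligible_bigcup => n.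
- rewrite /L; case: ifPn => [qc|_]; last exact: negligible_set0.
  apply/negligibleP => //; have := below _ qc.
  by rewrite !rational_cutE /rational_cut.
- rewrite /U; case: ifPn => [qc|_]; last exact: negligible_set0.
  apply/negligibleP => //; have := above _ qc.
  by rewrite !rational_cutE /rational_cut.
Qed.

End lebesgue_cuts.

Section not_Delta2.
Context d (T : measurableType d) (R : realType).
Variables (mu : {sigma_finite_measure set T -> \bar R}) (phi : orlicz_function R).
Hypothesis mu_non_atomic : non_atomic mu.
Hypothesis mu_pos : (0 < mu setT)%E.
Hypothesis phi_finite : finite_orlicz phi.
Local Notation I f := (modular mu phi f%R).
Local Notation Phi := (even_ext phi).
Local Notation lux := (luxemburg_norm mu phi).

Let phiG : gauge phi. Proof. exact: orlicz_gauge. Qed.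

(** For finite mu the condition concerns large arguments only, so its failure occurs beyond any
    u0. *)
Lemma not_Delta2_witness (K u0 : R) : 2 < K -> ~ appropriate_Delta2 mu phi ->
  exists u, [/\ 0 <= u, K * Phi u < Phi (2 * u) & mu setT = +oo%E \/ u0 <= u].
Proof.
move=> K2 hD; apply: contrapT => h; apply: hD; split => mT.
  exists K => // u u_ge0; have u2 : 0 <= 2 * u by rewrite mulr_ge0.
  rewrite !even_ext_fine// -EFinM lee_fin leNgt; apply/negP => hu; apply: h.
  by exists u; split => //; left.
pose v := Num.max 0 u0; have v0 : 0 <= v by rewrite le_max lexx.
exists K, v; split => //; first exact: phi_finite.
move=> u vu; have u_ge0 : 0 <= u by exact: le_trans vu.
have u2 : 0 <= 2 * u by rewrite mulr_ge0.
rewrite !even_ext_fine// -EFinM lee_fin leNgt; apply/negP => hu; apply: h.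
by exists u; split => //; right; apply: le_trans vu; rewrite le_max lexx orbT.
Qed.

(** The new piece A has measure between a and 2a for a = 2 / Phi (2u). Then Phi (2u) mu A >= 2,
    while Phi u mu A <= 4 Phi u / Phi (2u) <= 4 / K <= e. When mu is finite, u is taken so large
    that 2a is below the measure of the complement of U, so that A leaves room for further
    pieces. *)
Lemma not_Delta2_step (e : R) (U : set T) : ~ appropriate_Delta2 mu phi -> 0 < e ->
  measurable U -> (mu U < +oo)%E -> (0 < mu (~` U))%E ->
  exists u A, [/\ measurable A, A `&` U = set0, (mu A < +oo)%E & (0 < mu (~` (U `|` A)))%E] /\
    ((Phi u)%:E * mu A <= e%:E)%E /\ (1 < (Phi (2 * u))%:E * mu A)%E.
Proof.
move=> hD e0 mU Uoo Up; pose K := Num.max 3 (4 / e).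
have K2 : 2 < K by rewrite lt_max; apply/orP; left; lra.
have Ke : 4 / e <= K by rewrite le_max lexx orbT.
have mCU : measurable (~` U) by exact: measurableC.
(* The value 1 is a placeholder: an infinite complement exceeds 2a anyway. *)
pose r := if mu (~` U) == +oo%E then 1 else fine (mu (~` U)).
have r0 : 0 < r.
  rewrite /r; case: eqP => // /eqP CUoo; rewrite fine_gt0// Up/=.
  by rewrite ltey.
have [a0 a00 [b0 b00 hab]] := even_ext_growth phi_finite.
(* beyond this point the gauge exceeds 4 / r *)
pose u0 := a0 + b0 * (4 / r) + 1.
have [u [u_ge0 hu hur]] := not_Delta2_witness u0 K2 hD.
have P2 : 0 < Phi (2 * u).
  by apply: le_lt_trans hu; rewrite mulr_ge0 ?even_ext_ge0//; lra.
pose a := 2 / Phi (2 * u).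
have a_gt0 : 0 < a by rewrite divr_gt0.
have a2 : mu setT = +oo%E \/ (2 * a < r).
  case: hur => [->|u0u]; [by left|right].
  rewrite /a mulrA ltr_pdivrMr// -ltr_pdivrMl//.
  have -> : r^-1 * (2 * 2) = 4 / r by rewrite mulrC; congr (_ / _); lra.
  rewrite -(@ltr_pM2l _ b0)// -(@ltrD2l _ a0).
  apply: (@lt_le_trans _ _ u0); first by rewrite /u0 ltrDl.
  apply: le_trans (hab (2 * u)); apply: le_trans (ler_norm _); lra.
have CUoo : mu setT = +oo%E -> mu (~` U) = +oo%E.
  move=> Too; apply/eqP; rewrite -leye_eq -Too -(setUv U).
  apply: contraT; rewrite -ltNge => hlt.
  have : (mu (U `|` ~` U) < +oo)%E.
    apply: le_lt_trans (measureU2 _ _ _) _ => //; rewrite lte_add_pinfty//.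
    by apply: lt_le_trans hlt _; rewrite leey.
  by rewrite setUv Too ltxx.
have aU : ((2 * a)%:E < mu (~` U))%E.
  case: a2 => [/CUoo ->|]; first exact: ltry.
  rewrite /r; case: eqP => [-> _|/eqP CUf ar]; first exact: ltry.
  by rewrite -[ltRHS]fineK ?lte_fin// ge0_fin_numE// ltey.
have aU' : (a%:E < mu (~` U))%E by apply: le_lt_trans aU; rewrite lee_fin; lra.
have [A [mA AU aA A2a]] := intermediate_subset mu_non_atomic mCU a_gt0 aU'.
have Aoo : (mu A < +oo)%E by apply: le_lt_trans A2a _; exact: ltry.
have Afin : mu A \is a fin_num by rewrite ge0_fin_numE.
have aA' : a <= fine (mu A) by rewrite -lee_fin fineK.
have A2a' : fine (mu A) <= 2 * a by rewrite -lee_fin fineK.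
exists u, A; split; [split => //|split].
- by apply/seteqP; split=> // x [/AU].
- rewrite setCU -setDE lt0e measure_ge0 andbT; apply/eqP => z.
  suff : (mu (~` U) <= mu A)%E by rewrite leNgt (le_lt_trans A2a).
  have mD : measurable (~` U `\` A) by exact: measurableD.
  rewrite -(setDUK AU); apply: le_trans (measureU2 _ _ _) _ => //.
  by rewrite [X in (_ + X)%E]z adde0.
- rewrite -(fineK Afin) -EFinM lee_fin.
  apply: (@le_trans _ _ (Phi u * (2 * a))); first by rewrite ler_wpM2l// even_ext_ge0.
  have -> : Phi u * (2 * a) = 4 * Phi u / Phi (2 * u) by rewrite /a; field; rewrite gt_eqF.
  rewrite ler_pdivrMr//; apply: le_trans (ler_wpM2l (ltW e0) (ltW hu)).
  by rewrite mulrA ler_wpM2r ?even_ext_ge0// mulrC -ler_pdivrMr.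
- rewrite -(fineK Afin) -EFinM lte_fin; apply: (@lt_le_trans _ _ (Phi (2 * u) * a)).
    by rewrite /a mulrCA divff ?gt_eqF// mulr1 ltr1n.
  by rewrite ler_wpM2l// ltW.
Qed.

(* Disjointly supported functions spanning a copy of l^infty. *)
Lemma not_Delta2_disjoint : ~ appropriate_Delta2 mu phi ->
  exists (u : nat -> R) (D : nat -> set T),
    [/\ forall n, measurable (D n), trivIset setT D,
      forall n, ((Phi (u n))%:E * mu (D n) <= (2^-1 ^+ n.+1)%:E)%E &
      forall n, (1 < (Phi (2 * u n))%:E * mu (D n))%E].
Proof.
move=> hD.
have /choice[F HF] : forall nU : nat * set T, exists uA : R * set T,
    measurable nU.2 -> (mu nU.2 < +oo)%E -> (0 < mu (~` nU.2))%E ->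
    [/\ measurable uA.2, uA.2 `&` nU.2 = set0, (mu uA.2 < +oo)%E & (0 < mu (~` (nU.2 `|` uA.2)))%E] /\
    ((Phi uA.1)%:E * mu uA.2 <= (2^-1 ^+ nU.1.+1)%:E)%E /\ (1 < (Phi (2 * uA.1))%:E * mu uA.2)%E.
  move=> [n U] /=; have [mU|nmU] := pselect (measurable U); last by exists (0, set0).
  have [Uoo|] := boolP (mu U < +oo)%E; last by move=> ?; exists (0, set0).
  have [Up|] := boolP (0 < mu (~` U))%E; last by move=> ?; exists (0, set0).
  have e0 : 0 < (2^-1 ^+ n.+1 : R) by rewrite exprn_gt0// invr_gt0.
  have [u [A HA]] := not_Delta2_step hD e0 mU Uoo Up.
  by exists (u, A).
(* The union of the pieces chosen so far. It stays of finite measure with non-null complement, so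
   that the choice function F never returns its default value. *)
pose U := fix U n := if n is k.+1 then U k `|` (F (k, U k)).2 else set0.
have HU n : [/\ measurable (U n), (mu (U n) < +oo)%E & (0 < mu (~` U n))%E].
  elim: n => [|n [mU Uoo Up]] /=; first by rewrite measure0 setC0.
  have [[mA AU Aoo Cp] _] := HF (n, U n) mU Uoo Up; split => //.
    exact: measurableU.
  apply: le_lt_trans (measureU2 _ _ _) _ => //.
  by rewrite lte_add_pinfty.
have HA n := let: And3 mU Uoo Up := HU n in HF (n, U n) mU Uoo Up.
exists (fun n => (F (n, U n)).1), (fun n => (F (n, U n)).2).
have UA n k : (n < k)%N -> (F (n, U n)).2 `<=` U k.
  elim: k => // k IH; rewrite ltnS leq_eqVlt => /predU1P[->|nk] /=; first by right.
  by move=> x /(IH nk); left.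
split => [n|||].
- by have [[]] := HA n.
- have disj n k : (n < k)%N -> (F (n, U n)).2 `&` (F (k, U k)).2 = set0.
    move=> nk; have [[_ AU _ _] _] := HA k; apply/seteqP; split=> // x [xn xk].
    have : ((F (k, U k)).2 `&` U k) x by split => //; exact: UA xn.
    by rewrite AU.
  apply/trivIsetP => i j _ _; case: ltngtP => // [ij _|ji _]; first exact: disj.
  by rewrite setIC; exact: disj.
- by move=> n; have [_ []] := HA n.
- by move=> n; have [_ []] := HA n.
Qed.

(* The span of disjoint pieces of w is a copy of l^infty, in which the density
   of the measure A |-> (lambda (A `&` ]-oo, q_n]))_n would be the nowhere
   locally constant map s |-> (1_(s <= q_n))_n. *)
Lemma rnp_Delta2 : radon_nikodym_property (L_phi mu phi) -> appropriate_Delta2 mu phi.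
Proof.
move=> rnp; apply: contrapT => hD.
have quarter : (8^-1 + 8^-1 : R) < 2^-1 by lra.
have [u [D [mD tD Du D2u]]] := not_Delta2_disjoint hD.
(* The index of the piece containing t. Its default value 0 outside all pieces adds the complement
   of UD to the fibre of 0; w vanishes there. *)
pose kappa t : nat := xget 0%N [set n | D n t].
have kappaE n t : D n t -> kappa t = n.
  move=> Dt; rewrite /kappa; case: xgetP => [k _ /= Dk|/(_ n)//].
  by apply: (tD k n) => //; exists t.
pose UD := \bigcup_n D n.
have mUD : measurable UD by exact: bigcup_measurable.
have mkappa : measurable_fun setT kappa.
  apply: measurable_fun_cells => n.
  have [n0|n0] := eqVneq n 0%N; last first.
    rewrite (_ : kappa @^-1` [set n] = D n)//; apply/seteqP; split=> t /=; last exact: kappaE.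
    rewrite /kappa; case: xgetP => [k -> /= Dk <-//|_ z].
    by rewrite -z eqxx in n0.
  rewrite (_ : kappa @^-1` [set n] = D 0%N `|` ~` UD).
    by apply: measurableU => //; exact: measurableC.
  rewrite n0; apply/seteqP; split=> t /=.
    rewrite /kappa; case: xgetP => [k -> /= Dk <-|h _]; first by left.
    by right=> -[k _ Dk]; exact: (h k).
  move=> [/kappaE//|nUD]; rewrite /kappa; case: xgetP => // k _ /= Dk.
  by case: nUD; exists k.
pose w t := u (kappa t) * \1_UD t.
have wE n t : D n t -> w t = u n.
  by move=> Dt; rewrite /w (kappaE n)// indicE mem_set ?mulr1//; exists n.
have w0 t : ~ UD t -> w t = 0 by move=> ?; rewrite /w indicE memNset// mulr0.
have mseq (c : nat -> R) : measurable_fun setT (c \o kappa).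
  by apply: (measurableT_comp _ mkappa).
have mw : measurable_fun setT w.
  by apply: measurable_funM; [exact: mseq|exact: measurable_indic].
have Iw : (I w <= 1)%E.
  have -> : I w = (\int[mu]_(t in UD) phi `|w t|%R)%E.
    rewrite [RHS]integral_mkcond; apply: eq_integral => t _; rewrite /patch.
    case: ifPn => // /negP tU; rewrite w0 ?even_extE// ?even_ext0//.
    by move=> ?; apply: tU; exact: mem_set.
  apply: integral_bigcup_geometric => //.
  - exact: gauge_measurable.
  - by move=> t; have [_ q _ _] := phiG; exact: q.
  move=> n; rewrite (eq_integral (fun=> (Phi (u n))%:E)) ?integral_cst//.
  by move=> t /set_mem Dt; rewrite (wE n)// even_extE.
have wO : w \in orlicz_class mu phi.
  apply/orlicz_classP; split => //; exists 1 => //.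
  by under eq_fun do rewrite mul1r; apply: le_lt_trans Iw _; exact: ltry.
pose nu : {finite_measure set (measurableTypeR R) -> \bar R} := @unit_lebesgue R.
have nufin A : measurable A -> nu A \is a fin_num by move=> mA; exact: fin_num_measure.
have mAR A n : measurable A -> measurable (A `&` rational_cut n).
  by move=> mA; apply: measurableI => //; exact: measurable_rational_cut.
pose c (A : set (measurableTypeR R)) n := if `[< measurable A >] then fine (nu (A `&` rational_cut n)) else 0.
have cE A n : measurable A -> c A n = fine (nu (A `&` rational_cut n)) by move=> mA; rewrite /c asboolT.
have c0 A n : 0 <= c A n by rewrite /c; case: ifP => // _; exact: fine_ge0.
have cle A n : measurable A -> c A n <= fine (nu A).
  move=> mA; rewrite cE// fine_le ?nufin//; [exact: mAR|].
  by apply: le_measure; rewrite ?inE//; exact: mAR.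
pose f A t := c A (kappa t) * w t.
have mf A : measurable_fun setT (f A) by apply: measurable_funM => //; exact: mseq.
have fw A : measurable A -> f A \in orlicz_class mu phi /\ lux (f A) <= fine (nu A) * lux w.
  move=> mA; have nA0 : 0 <= fine (nu A) by exact: fine_ge0.
  have gO : fine (nu A) *: w + 0 \in orlicz_class mu phi by rewrite orlicz_class_linear// orlicz_class0.
  rewrite addr0 in gO; have [] := le_luxemburg_norm (mf A) gO.
    move=> t; rewrite !fctE /GRing.scale/= !normrM ler_wpM2r//.
    by rewrite !ger0_norm// cle.
  by rewrite luxemburg_normZ// ger0_norm.
have fO A : f A \in orlicz_class mu phi.
  have [mA|nmA] := pselect (measurable A); first by case: (fw A mA).
  rewrite (_ : f A = 0) ?orlicz_class0//; apply/funext => t.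
  by rewrite /f /c asboolF// mul0r.
pose m A := L_phi_of (fO A).
have mC A : measurable A -> `|m A| <= lux w * fine (nu A).
  by move=> mA; rewrite L_phi_of_norm mulrC; case: (fw A mA).
have mfa : finitely_additive m.
  move=> A B mA mB AB; apply: L_phi_ofD => t; rewrite /f -mulrDl !cE//; last exact: measurableU.
  congr (_ * _); rewrite -fineD ?nufin//; try exact: mAR.
  rewrite setIUl measureU//; try exact: mAR.
  by rewrite setIACA AB set0I.
have [ca va ac] := bounded_additive_rnp_hyp mfa mC.
have [g [bg gm]] := rnp _ _ nu m ca va ac.
have nuT : (0 < nu setT)%E.
  rewrite [nu setT]/(mrestr _ _ _) /mrestr setTI lebesgue_measure_itv/= lte01 oppr0 adde0.
  by rewrite lte_fin.
(* The two localised errors add up to at most 1/4, whereas w restricted to D n has norm at least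
   1/2, its double having modular greater than 1. *)
have eta0 : 0 < (8^-1 : R) by rewrite invr_gt0.
have [E [y [mE _ E0 hE]]] := density_nearly_constant bg gm eta0 measurableT nuT.
have [n [E1 E2]] := lebesgue_split mE E0.
have my := orlicz_repr_measurable y.
pose h A t := f A t - fine (nu A) * orlicz_repr y t.
have mh A : measurable_fun setT (h A) by apply: measurable_funB => //; exact: measurable_funM.
have hO A : h A \in orlicz_class mu phi.
  have -> : h A = - fine (nu A) *: (orlicz_repr y : T -> R) + f A.
    by apply/funext => t; rewrite /h !fctE /GRing.scale/= mulNr addrC.
  exact: orlicz_class_linear (orlicz_repr_class y) (fO A).
have hlux A : measurable A -> A `<=` E -> lux (h A) <= 8^-1 * fine (nu A).
  move=> mA AE.
  rewrite -(@L_phi_norm_ae _ _ _ mu phi (m A - fine (nu A) *: y) _ (mh A)) ?hE//.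
  apply: filterS2 (orlicz_repr_lin (m A) y (fine (nu A))) (repr_L_phi_of (fO A)) => t h1 h2 _.
  by rewrite h1// h2.
(* testing against the part of E in (resp. outside) the n-th cut shows that y
   is close to both w and 0 on D n *)
have loc A (k : T -> R) : measurable A -> A `<=` E -> (0 < nu A)%E -> measurable_fun setT k ->
    (forall t, D n t -> h A t = fine (nu A) * k t) -> (forall t, ~ D n t -> k t = 0) ->
    k \in orlicz_class mu phi /\ lux k <= 8^-1.
  move=> mA AE A0 mk hk k0.
  have Ap : 0 < fine (nu A) by rewrite fine_gt0// A0 ltey_eq nufin.
  pose k' := fine (nu A) *: k.
  have mk' : measurable_fun setT k' by exact: measurable_funM.
  have [k'O k'le] : k' \in orlicz_class mu phi /\ lux k' <= lux (h A).
    apply: le_luxemburg_norm => // t; rewrite /k' fctE /GRing.scale/=.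
    have [Dt|Dt] := pselect (D n t); first by rewrite hk.
    by rewrite k0// mulr0 normr0.
  have kO : k \in orlicz_class mu phi.
    have -> : k = (fine (nu A))^-1 *: k' + 0.
      by rewrite addr0 /k' scalerA mulVf ?gt_eqF// scale1r.
    by rewrite orlicz_class_linear// orlicz_class0.
  split => //; have := le_trans k'le (hlux A mA AE).
  by rewrite luxemburg_normZ// gtr0_norm// mulrC ler_pM2r.
have ind : measurable_fun setT (\1_(D n) : T -> R) by exact: measurable_indic.
have [] := loc (E `&` rational_cut n) (fun t => (w t - orlicz_repr y t) * \1_(D n) t).
- exact: mAR.
- exact: subIsetl.
- exact: E1.
- by apply: measurable_funM => //; exact: measurable_funB.
- move=> t Dt; rewrite /h /f (kappaE n)// cE; last exact: mAR.
  by rewrite -setIA setIid indicE mem_set// mulr1 mulrBr.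
- by move=> t Dt; rewrite indicE memNset// mulr0.
set k1 := (fun t => _) => k1O k1le.
have mD' : measurable (E `\` rational_cut n).
  by apply: measurableD => //; exact: measurable_rational_cut.
have [] := loc (E `\` rational_cut n) (fun t => - orlicz_repr y t * \1_(D n) t).
- exact: mD'.
- exact: subDsetl.
- exact: E2.
- by apply: measurable_funM => //; exact: measurableT_comp.
- move=> t Dt; rewrite /h /f (kappaE n)// cE//.
  rewrite setDE -setIA setICl setI0 measure0 mul0r sub0r indicE mem_set// mulr1.
  by rewrite mulrN.
- by move=> t Dt; rewrite indicE memNset// mulr0.
set k2 := (fun t => _) => k2O k2le.
pose k t := w t * \1_(D n) t.
have kE : k = -1 *: k2 + k1.
  by apply/funext => t; rewrite /k /k1 /k2 !fctE /GRing.scale/=; ring.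
have kO : k \in orlicz_class mu phi by rewrite kE orlicz_class_linear.
have kle : lux k < 2^-1.
  rewrite kE; have k2O' : -1 *: k2 \in orlicz_class mu phi.
    by rewrite -[_ *: _]addr0 orlicz_class_linear// orlicz_class0.
  apply: le_lt_trans (luxemburg_normD k2O' k1O) _.
  rewrite luxemburg_normZ// normrN1 mul1r.
  exact: le_lt_trans (lerD k2le k1le) quarter.
have := modular_norm_lt kO kle; rewrite leNgt => /negP; apply.
apply: lt_le_trans (D2u n) _.
apply: (@le_trans _ _ (\int[mu]_(t in D n) phi `|k t / 2^-1|%R)%E).
  rewrite (eq_integral (fun=> (Phi (2 * u n))%:E)); last first.
    move=> t /set_mem Dt; rewrite even_extE// /k (wE n)// indicE mem_set// mulr1.
    by rewrite invrK mulrC.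
  by rewrite integral_cst.
apply: ge0_subset_integral => //.
- by apply: gauge_measurable => //; apply: measurable_funM => //; exact: orlicz_class_measurable kO.
- by move=> t _; have [_ q _ _] := phiG; exact: q.
Qed.

End not_Delta2.

(** * Integration tools: cancellation, Pratt's theorem and an integrable weight *)

Section signed_label.
Context d (S : measurableType d) (R : realType) (nu : {finite_measure set S -> \bar R}).

Lemma integral_label_fin (p : S -> nat) N (A : set S) (f : nat -> R) :
  label p N -> measurable A ->
  (\int[nu]_(w in A) (f (p w))%:E =
    (\sum_(i < N) f i * fine (nu (A `&` p @^-1` [set (i : nat)])))%:E)%E.
Proof.
move=> lp mA.
have mc i : measurable (p @^-1` [set i]) by exact: measurable_label lp.
have fin i : nu (A `&` p @^-1` [set i]) \is a fin_num.
  by apply: fin_num_measure; exact: measurableI.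
transitivity (\int[nu]_(w in A) \sum_(i < N) ((f i)%:E * (\1_(p @^-1` [set (i : nat)]) w)%:E))%E.
  apply: eq_integral => w _; rewrite (bigD1 (Ordinal (lp.2 w)))//= indicE mem_set//.
  rewrite mule1 big1 ?adde0// => i iw; rewrite indicE memNset ?mule0//= => wi.
  by move/eqP : iw; apply; exact/val_inj.
have ii i : nu.-integrable A (fun w => (\1_(p @^-1` [set i]) w)%:E).
  by apply: (integrableS measurableT) => //; exact: integrable_indic.
rewrite integral_sum//; last by move=> i; exact: integrableZl.
rewrite -sumEFin; apply: eq_bigr => i _; rewrite integralZl//.
by rewrite integral_indic// setIC EFinM fineK.
Qed.

End signed_label.

Section generic_measure.
Context d (Z : measurableType d) (R : realType) (P : {measure set Z -> \bar R}).

(** The sum of all k n has integral at most 2c, so it is finite almost everywhere, and it bounds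
    each term. *)
Lemma ae_bounded (k : nat -> Z -> \bar R) (c : R) :
  (forall n, measurable_fun setT (k n)) -> (forall n z, (0 <= k n z)%E) ->
  (forall n, (\int[P]_z k n z <= (c * 2^-1 ^+ n)%:E)%E) ->
  {ae P, forall z, exists C : R, forall n, (k n z <= C%:E)%E}.
Proof.
move=> mk k0 kc.
pose s z := (\sum_(0 <= n <oo) k n z)%E.
have ms : measurable_fun setT s by apply: ge0_emeasurable_sum => // n z _ _; exact: k0.
have c0 : 0 <= c.
  by rewrite -lee_fin; have := kc 0%N; rewrite expr0 mulr1; apply: le_trans; exact: integral_ge0.
have s0 z : (0 <= s z)%E by apply: nneseries_ge0 => n _ _; exact: k0.
have is' : P.-integrable setT s.
  apply/integrableP; split => //; under eq_integral do rewrite gee0_abs//.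
  rewrite integral_nneseries//.
  apply: (@le_lt_trans _ _ (2 * c)%:E); last exact: ltry.
  apply: lime_le; first by apply: is_cvg_nneseries => n _ _; apply: integral_ge0 => z _; exact: k0.
  apply: nearW => N.
  apply: (@le_trans _ _ (2 * c - 2 * c * 2^-1 ^+ N)%:E); last first.
    by rewrite lee_fin gerBl mulr_ge0 ?exprn_ge0 ?invr_ge0// mulr_ge0.
  elim: N => [|N IH]; first by rewrite big_geq// expr0 mulr1 subrr.
  rewrite big_nat_recr//=; apply: le_trans (leeD IH (kc N)) _.
  rewrite -EFinD lee_fin exprS; set y := _ ^+ N; clearbody y.
  have -> : 2 * c * (2^-1 * y) = c * y by field.
  by rewrite -mulrA; nra.
have := integrable_ae measurableT is'; apply: filterS => z /(_ I) sfin.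
exists (fine (s z)) => n; rewrite fineK//.
apply: (@le_trans _ _ (\sum_(0 <= i < n.+1) k i z)%E); last exact: nneseries_lim_ge.
by rewrite big_nat_recr//= leeDr// sume_ge0.
Qed.

(* The positive and negative parts of k have the same integral, so k may be
   cancelled although H1 and H2 need not be integrable. *)
Lemma integral_cancel (E H1 H2 k : Z -> R) :
  measurable_fun setT E -> measurable_fun setT H1 -> measurable_fun setT H2 ->
  (forall z, 0 <= E z) -> (forall z, 0 <= H1 z) -> (forall z, 0 <= H2 z) ->
  P.-integrable setT (fun z => (k z)%:E) -> (\int[P]_z (k z)%:E = 0)%E ->
  {ae P, forall z, E z + H1 z + k z <= H2 z} ->
  (\int[P]_z (E z)%:E + \int[P]_z (H1 z)%:E <= \int[P]_z (H2 z)%:E)%E.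
Proof.
move=> mE mH1 mH2 E0 H10 H20 ik k0 h.
have mk : measurable_fun setT k by apply/measurable_EFinP; case/integrableP: ik.
pose kp z := Num.max (k z) 0; pose km z := Num.max (- k z) 0.
have kp0 z : 0 <= kp z by rewrite le_max lexx orbT.
have km0 z : 0 <= km z by rewrite le_max lexx orbT.
have mkp : measurable_fun setT kp by exact: measurable_maxr.
have mkm : measurable_fun setT km by apply: measurable_maxr => //; exact: measurableT_comp.
have kE z : k z = kp z - km z.
  rewrite /kp /km; have [k1|k1] := leP 0 (k z).
    by rewrite (max_idPr _) ?subr0// oppr_le0.
  by rewrite (max_idPl _) ?sub0r ?opprK// oppr_ge0 ltW.
have le_k (g : Z -> R) : measurable_fun setT g -> (forall z, 0 <= g z) -> (forall z, g z <= `|k z|) ->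
    P.-integrable setT (fun z => (g z)%:E).
  move=> mg g0 gk; apply: le_integrable ik => //; first exact/measurable_EFinP.
  by move=> z _; rewrite lee_fin ger0_norm.
have ikp : P.-integrable setT (fun z => (kp z)%:E).
  by apply: le_k => // z; rewrite /kp ge_max normr_ge0 ler_norm.
have ikm : P.-integrable setT (fun z => (km z)%:E).
  by apply: le_k => // z; rewrite /km ge_max normr_ge0 -normrN ler_norm.
have Ikp : (\int[P]_z (kp z)%:E = \int[P]_z (km z)%:E)%E.
  have : (\int[P]_z (kp z)%:E - \int[P]_z (km z)%:E = 0)%E.
    rewrite -integralB// -[RHS]k0; apply: eq_integral => z _.
    by rewrite [in RHS]kE EFinB.
  have kmfin := integrable_fin_num measurableT ikm.
  by move=> h0; rewrite -[LHS](subeK _ kmfin) h0 add0e.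
have kpfin := integrable_fin_num measurableT ikp.
have : (\int[P]_z (E z)%:E + \int[P]_z (H1 z)%:E + \int[P]_z (kp z)%:E <=
    \int[P]_z (H2 z)%:E + \int[P]_z (km z)%:E)%E.
  have nn (g : Z -> R) : (forall z, 0 <= g z) -> forall z, setT z -> (0 <= (g z)%:E)%E.
    by move=> g0 z _; rewrite lee_fin.
  rewrite -!ge0_integralD//; try exact/measurable_EFinP; try exact: nn.
  - apply: ae_ge0_le_integral => //.
    + by move=> z _; rewrite !adde_ge0// lee_fin.
    + by do ?apply: emeasurable_funD; exact/measurable_EFinP.
    + by move=> z _; rewrite !adde_ge0// lee_fin.
    + by do ?apply: emeasurable_funD; exact/measurable_EFinP.
    by apply: filterS h => z h _; rewrite -!EFinD lee_fin; have := kE z; lra.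
  - by move=> z _; rewrite adde_ge0// lee_fin.
  - by apply: emeasurable_funD; exact/measurable_EFinP.
by rewrite -Ikp leeD2rE.
Qed.

(** Dominated convergence with varying bounds. Both U = min (A, 2 C Y + L) and V = min (X, Y) fall
    under ordinary dominated convergence, and A <= U + C (X - V). As the integrals of the X n do not
    exceed that of Y, those of X - V are at most those of Y - V, which tend to 0. *)
Lemma pratt (A X : nat -> Z -> R) (Y L : Z -> R) (C : R) :
  (forall n, measurable_fun setT (A n)) -> (forall n, measurable_fun setT (X n)) ->
  measurable_fun setT Y -> measurable_fun setT L ->
  (forall n z, 0 <= A n z) -> (forall n z, 0 <= X n z) -> (forall z, 0 <= Y z) ->
  (forall z, 0 <= L z) -> 0 <= C ->
  (forall n z, A n z <= C * (X n z + Y z) + L z) ->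
  {ae P, forall z, A n z @[n --> \oo] --> (0 : R)} ->
  {ae P, forall z, X n z @[n --> \oo] --> Y z} ->
  (forall n, (\int[P]_z (X n z)%:E <= \int[P]_z (Y z)%:E)%E) ->
  (\int[P]_z (Y z)%:E < +oo)%E -> (\int[P]_z (L z)%:E < +oo)%E ->
  (\int[P]_z (A n z)%:E @[n --> \oo] --> 0)%E.
Proof.
move=> mA mX mY mL A0 X0 Y0 L0 C0 hA Acvg Xcvg XY Yoo Loo.
pose M z := C * (2 * Y z) + L z.
pose U n z := Num.min (A n z) (M z).
pose V n z := Num.min (X n z) (Y z).
have M0 z : 0 <= M z by rewrite addr_ge0// mulr_ge0// mulr_ge0.
have mM : measurable_fun setT M.
  by apply: measurable_funD => //; do 2 apply: measurable_funM => //.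
have mU n : measurable_fun setT (U n) by exact: measurable_minr.
have mV n : measurable_fun setT (V n) by exact: measurable_minr.
have U0 n z : 0 <= U n z by rewrite le_min A0 M0.
have V0 n z : 0 <= V n z by rewrite le_min X0 Y0.
have iY : P.-integrable setT (fun z => (Y z)%:E).
  apply/integrableP; split; first exact/measurable_EFinP.
  by under eq_integral do rewrite gee0_abs ?lee_fin//.
have iL : P.-integrable setT (fun z => (L z)%:E).
  apply/integrableP; split; first exact/measurable_EFinP.
  by under eq_integral do rewrite gee0_abs ?lee_fin//.
have iM : P.-integrable setT (fun z => (M z)%:E).
  have -> : (fun z => (M z)%:E) = (fun z => ((C * 2)%:E * (Y z)%:E + (L z)%:E)%E).
    by apply/funext => z; rewrite -EFinM -EFinD /M mulrA.
  by apply: integrableD => //; exact: integrableZl.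
have Ucvg : (\int[P]_z (U n z)%:E @[n --> \oo] --> 0)%E.
  have [] := @dominated_convergence _ _ _ P setT measurableT (fun n z => (U n z)%:E) (fun=> 0%E)
    (fun z => (M z)%:E).
  - by move=> n; exact/measurable_EFinP.
  - exact: measurable_cst.
  - apply: filterS Acvg => z Acvg _.
    apply: (@squeeze_cvge _ _ _ _ (cst 0%E) _ (fun n => (A n z)%:E)).
    + by apply: nearW => n; rewrite !lee_fin U0 ge_min lexx.
    + exact: cvg_cst.
    + by apply: cvg_EFin => //; exact: nearW.
  - exact: iM.
  - by apply: nearW => z n _; rewrite gee0_abs ?lee_fin// ge_min lexx orbT.
  by move=> _ _; rewrite integral0.
have Vcvg : (\int[P]_z (V n z)%:E @[n --> \oo] --> \int[P]_z (Y z)%:E)%E.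
  have [] := @dominated_convergence _ _ _ P setT measurableT (fun n z => (V n z)%:E)
    (fun z => (Y z)%:E) (fun z => (Y z)%:E).
  - by move=> n; exact/measurable_EFinP.
  - exact/measurable_EFinP.
  - apply: filterS Xcvg => z Xcvg _; apply: cvg_EFin; first exact: nearW.
    apply/cvgrPdist_le => e e0; move/cvgrPdist_le : Xcvg => /(_ e e0).
    apply: filterS => n; apply: le_trans; rewrite /V /=.
    by have [|_] := leP (X n z) (Y z); rewrite // subrr normr0.
  - exact: iY.
  - by apply: nearW => z n _; rewrite gee0_abs ?lee_fin// ge_min lexx orbT.
  by [].
have Yfin : (\int[P]_z (Y z)%:E)%E \is a fin_num by exact: integrable_fin_num.
have Vfin n : (\int[P]_z (V n z)%:E)%E \is a fin_num.
  rewrite ge0_fin_numE; last by apply: integral_ge0 => z _; rewrite lee_fin.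
  apply: le_lt_trans Yoo; apply: ge0_le_integral => //.
  - by move=> z _; rewrite lee_fin.
  - exact/measurable_EFinP.
  - exact/measurable_EFinP.
  - by move=> z _; rewrite lee_fin ge_min lexx orbT.
apply: (@squeeze_cvge _ _ _ _ (cst 0%E) _ (fun n => \int[P]_z (U n z)%:E +
    C%:E * (\int[P]_z (Y z)%:E - \int[P]_z (V n z)%:E))%E).
- apply: nearW => n; rewrite integral_ge0//=; last by move=> z _; rewrite lee_fin.
  apply: (@le_trans _ _ (\int[P]_z (U n z)%:E + C%:E * (\int[P]_z (X n z)%:E - \int[P]_z (V n z)%:E))%E); last first.
    apply: leeD => //; apply: lee_wpmul2l; rewrite ?lee_fin//.
    by apply: leeB => //; exact: XY.
  have -> : (\int[P]_z (X n z)%:E - \int[P]_z (V n z)%:E = \int[P]_z (X n z - V n z)%:E)%E.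
    have : (\int[P]_z (X n z)%:E = \int[P]_z (X n z - V n z)%:E + \int[P]_z (V n z)%:E)%E.
      rewrite -ge0_integralD//.
      - by apply: eq_integral => z _; rewrite -EFinD subrK.
      - by move=> z _; rewrite lee_fin subr_ge0 ge_min lexx.
      - by apply/measurable_EFinP; exact: measurable_funB.
      - by move=> z _; rewrite lee_fin.
      - exact/measurable_EFinP.
    by move=> ->; rewrite addeK.
  rewrite -ge0_integralZl//; last 2 first.
  - by apply/measurable_EFinP; exact: measurable_funB.
  - by move=> z _; rewrite lee_fin subr_ge0 ge_min lexx.
  have mC : measurable_fun setT (fun z => (C%:E * (X n z - V n z)%:E)%E).
    by apply: measurable_funeM; apply/measurable_EFinP; exact: measurable_funB.
  have XV0 z : 0 <= X n z - V n z by rewrite subr_ge0 ge_min lexx.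
  rewrite -ge0_integralD//; last 3 first.
  - by move=> z _; rewrite lee_fin.
  - exact/measurable_EFinP.
  - by move=> z _; rewrite mule_ge0 ?lee_fin.
  apply: ge0_le_integral => //.
  - by move=> z _; rewrite lee_fin.
  - exact/measurable_EFinP.
  - by apply: emeasurable_funD => //; exact/measurable_EFinP.
  move=> z _; rewrite -EFinM -EFinD lee_fin /U.
  have [AM|MA] := leP (A n z) (M z); first by rewrite lerDl mulr_ge0.
  apply: le_trans (hA n z) _; rewrite /M addrAC lerD2r -mulrDr ler_wpM2l//.
  have : V n z <= Y z by rewrite ge_min lexx orbT.
  lra.
- exact: cvg_cst.
rewrite -[X in _ --> X]adde0; apply: cvgeD => //.
rewrite -(mule0 C%:E); apply: cvgeZl => //.
rewrite -(subee Yfin); apply: cvgeB => //; first by rewrite fin_num_adde_defr.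
exact: cvg_cst.
Qed.

End generic_measure.

Section weight.
Context d (T : measurableType d) (R : realType).
Variable mu : {sigma_finite_measure set T -> \bar R}.

(** On the n-th set of a partition into sets of finite measure the weight is 2^-(n+1) / (1 +
    measure), so that this set contributes at most 2^-(n+1). *)
Lemma integrable_positive_weight : exists w : T -> R,
  [/\ measurable_fun setT w, forall t, 0 < w t, forall t, w t <= 1 &
      (\int[mu]_t (w t)%:E < +oo)%E].
Proof.
have [F [UF _ mF]] := (sigma_finiteP _ _).1 (sigma_finiteT mu).
pose D := seqDU F.
have mD n : measurable (D n) by apply: seqDU_measurable => i; exact: (mF i).1.
have tD : trivIset setT D by exact: trivIset_seqDU.
have UD : \bigcup_n D n = setT by rewrite /D -seqDU_bigcup_eq -UF.
have Dfin n : mu (D n) \is a fin_num.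
  rewrite ge0_fin_numE//; apply: le_lt_trans (mF n).2; apply: le_measure; rewrite ?inE//.
    exact: (mF n).1.
  exact: subset_seqDU.
pose kappa t : nat := xget 0%N [set n | D n t].
have kappaP t : D (kappa t) t.
  rewrite /kappa; case: xgetP => [k _ //|h]; have : setT t by [].
  by rewrite -UD => -[n _ Dn]; case: (h n).
have kappaE n t : D n t -> kappa t = n.
  by move=> Dt; apply: (tD _ _ I I); exists t; split => //; exact: kappaP.
have mkappa : measurable_fun setT kappa.
  apply: measurable_fun_cells => n; rewrite (_ : kappa @^-1` [set n] = D n)//.
  by apply/seteqP; split=> t /=; [move=> <-; exact: kappaP|exact: kappaE].
pose c n := 2^-1 ^+ n.+1 / (1 + fine (mu (D n))).
have Dp n : 0 < 1 + fine (mu (D n)) by rewrite ltr_pwDl// fine_ge0.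
have p0 n : 0 < (2^-1 ^+ n.+1 : R) by rewrite exprn_gt0// invr_gt0.
have mw : measurable_fun setT (c \o kappa) by exact: measurableT_comp.
exists (c \o kappa); split => //.
- by move=> t /=; rewrite divr_gt0.
- move=> t /=; rewrite /c ler_pdivrMr// mul1r; apply: (@le_trans _ _ 1).
    by rewrite exprn_ile1// ?invr_ge0// invf_le1// ler1n.
  by rewrite lerDl fine_ge0.
rewrite -UD; apply: (@le_lt_trans _ _ 1%E); last exact: ltry.
apply: integral_bigcup_geometric => //.
- exact/measurable_EFinP.
- by move=> t; rewrite lee_fin /= divr_ge0// ltW.
move=> n; rewrite (eq_integral (fun=> (c n)%:E)); last first.
  by move=> t /set_mem Dt; rewrite /= (kappaE n).
have -> : (\int[mu]_(_ in D n) (c n)%:E = (c n * fine (mu (D n)))%:E)%E.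
  by rewrite integral_cst// (EFinM (c n)) fineK.
rewrite lee_fin /c mulrAC ler_pdivrMr//.
by rewrite ler_wpM2l ?ltW// ltrDr.
Qed.

End weight.

(** * A strictly convex function of linear growth *)

Section theta.
Context (R : realType).
Implicit Types x y u : R.

Definition theta x := Num.sqrt (1 + x ^+ 2).
(** The derivative of [theta], a homeomorphism of the line onto ]-1, 1[. *)
Definition squash x := x / theta x.

Let p1 x : 0 < 1 + x ^+ 2. Proof. by rewrite ltr_pwDl// sqr_ge0. Qed.

Lemma theta_sqr x : theta x ^+ 2 = 1 + x ^+ 2.
Proof. by rewrite sqr_sqrtr// ltW. Qed.

Lemma theta_ge1 x : 1 <= theta x.
Proof. by rewrite -[leLHS]sqrtr1; apply: ler_wsqrtr; rewrite lerDl sqr_ge0. Qed.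

Lemma theta_gt0 x : 0 < theta x.
Proof. exact: lt_le_trans (theta_ge1 x). Qed.

Lemma theta_le x : theta x <= 1 + `|x|.
Proof.
rewrite -(@ler_pXn2r _ 2)// ?nnegrE ?addr_ge0 ?(ltW (theta_gt0 x))//.
by rewrite theta_sqr sqrrD expr1n mul1r real_normK ?num_real// lerD2r lerDl mulrn_wge0.
Qed.

Lemma squash_le1 x : `|squash x| <= 1.
Proof.
rewrite /squash normrM normfV (gtr0_norm (theta_gt0 x)) ler_pdivrMr ?theta_gt0// mul1r.
by rewrite -sqrtr_sqr; apply: ler_wsqrtr; rewrite lerDr.
Qed.

Lemma squash_sqr x : 1 - squash x ^+ 2 = (theta x ^+ 2)^-1.
Proof.
rewrite /squash expr_div_n theta_sqr; field.
by rewrite gt_eqF.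
Qed.

(* With (x / theta x, 1 / theta x) on the unit circle, the Bregman divergence
   of theta is half a squared chord, up to the factor theta y >= 1. *)
Lemma theta_bregman x y :
  theta x + squash x * (y - x) + 2^-1 * (squash y - squash x) ^+ 2 <= theta y.
Proof.
rewrite /squash; have hp := theta_sqr x; have hq := theta_sqr y.
have p0 := theta_gt0 x; have q1 := theta_ge1 y; have q0 := theta_gt0 y.
move: (theta x) (theta y) hp hq p0 q1 q0 => p q hp hq p0 q1 q0.
pose D := p * q - 1 - x * y.
have DE : D = p * q * (2^-1 * ((y / q - x / p) ^+ 2 + (q^-1 - p^-1) ^+ 2)).
  have -> : p * q * (2^-1 * ((y / q - x / p) ^+ 2 + (q^-1 - p^-1) ^+ 2)) =
    2^-1 * (p / q * (1 + y ^+ 2) + q / p * (1 + x ^+ 2)) - 1 - x * y.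
    by field; rewrite !gt_eqF.
  by rewrite -hp -hq /D; field; rewrite !gt_eqF.
have D0 : 0 <= D by rewrite DE !mulr_ge0 ?addr_ge0 ?sqr_ge0 ?invr_ge0// ltW.
have h1 : 2^-1 * (y / q - x / p) ^+ 2 <= D / (p * q).
  rewrite DE mulrAC divff ?mul1r ?mulf_neq0 ?gt_eqF// ler_wpM2l ?invr_ge0//.
  by rewrite lerDl sqr_ge0.
have h2 : D / (p * q) <= D / p.
  rewrite invfM mulrA ler_piMr//; first by rewrite divr_ge0// ltW.
  by rewrite invf_le1.
have h3 : q - p - x / p * (y - x) = D / p.
  have -> : q - p - x / p * (y - x) = (q * p - p ^+ 2 - x * y + x ^+ 2) / p.
    by field; rewrite gt_eqF.
  by rewrite hp /D; congr (_ / _); ring.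
move: h3 (le_trans h1 h2); set a := 2^-1 * _; set b := x / p * _; set c := D / p.
by clearbody a b c; lra.
Qed.

Lemma theta_continuous : continuous theta.
Proof.
move=> x; apply: (@continuous_comp _ _ _ (fun x => 1 + x ^+ 2) Num.sqrt).
  by apply: cvgD; [exact: cvg_cst|exact: exprn_continuous].
exact: sqrt_continuous.
Qed.

Lemma squash_continuous : continuous squash.
Proof.
move=> x; apply: cvgM; first exact: cvg_id.
by apply: cvgV; [rewrite gt_eqF// theta_gt0|exact: theta_continuous].
Qed.

(** A limit 1 or -1 would send [theta (F n)] to infinity; a bound along a subsequence excludes
    it. *)
Lemma squash_limit_lt1 (F : nat -> R) u (C : R) :
  squash (F n) @[n --> \oo] --> u ->
  (forall N, exists2 n, (N <= n)%N & theta (F n) <= C) -> u ^+ 2 < 1.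
Proof.
move=> Fu hC; have [n0 _ h0] := hC 0%N.
have C0 : 0 < C by exact: lt_le_trans (theta_gt0 _) h0.
suff : u ^+ 2 <= 1 - (C ^+ 2)^-1.
  by move=> /le_lt_trans; apply; rewrite ltrBlDr ltrDl invr_gt0 exprn_gt0.
rewrite leNgt; apply/negP => h.
have : squash (F n) ^+ 2 @[n --> \oo] --> u ^+ 2.
  exact: (cvgM Fu Fu).
move=> /cvgr_gt/(_ _ h)[N _ hN]; have [n Nn hn] := hC N.
have := hN n Nn; rewrite ltrBlDl -ltrBlDr squash_sqr ltNge => /negP; apply.
rewrite lef_pV2 ?posrE ?exprn_gt0 ?theta_gt0//.
by rewrite ler_pXn2r ?nnegrE ?(ltW C0) ?(ltW (theta_gt0 _)).
Qed.

(** The limit is the image of u under the inverse of [squash], which is continuous on ]-1, 1[. *)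
Lemma squash_cvg (F : nat -> R) u : squash (F n) @[n --> \oo] --> u -> u ^+ 2 < 1 ->
  F n @[n --> \oo] --> u / Num.sqrt (1 - u ^+ 2).
Proof.
move=> Fu u1.
have FE x : x = squash x / Num.sqrt (1 - squash x ^+ 2).
  rewrite squash_sqr sqrtrV ?exprn_ge0 ?(ltW (theta_gt0 x))// sqrtr_sqr gtr0_norm ?theta_gt0//.
  by rewrite invrK /squash divfK// gt_eqF// theta_gt0.
rewrite (_ : F = fun n => squash (F n) / Num.sqrt (1 - squash (F n) ^+ 2)); last first.
  by apply/funext => n; exact: FE.
apply: cvgM => //; apply: cvgV; first by rewrite gt_eqF// sqrtr_gt0 subr_gt0.
have h : 1 - squash (F n) ^+ 2 @[n --> \oo] --> 1 - u ^+ 2.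
  by apply: cvgB; [exact: cvg_cst|exact: (cvgM Fu Fu)].
by apply: (cvg_comp _ _ h); exact: sqrt_continuous.
Qed.

Lemma geometric_increments_cvg (v : nat -> R) (C : R) :
  (forall n, 4 ^+ n * (v n.+1 - v n) ^+ 2 <= C) -> cvgn v.
Proof.
move=> h; have C0 : 0 <= C by apply: le_trans (h 0%N); rewrite mulr_ge0 ?sqr_ge0.
pose dv n := v n.+1 - v n.
have dv_le n : `|dv n| <= Num.sqrt C * 2^-1 ^+ n.
  rewrite -(@ler_pXn2r _ 2)// ?nnegrE ?mulr_ge0 ?sqrtr_ge0 ?exprn_ge0 ?invr_ge0//.
  rewrite real_normK ?num_real// exprMn sqr_sqrtr// -exprM mulnC exprM.
  have -> : (2^-1 ^+ 2 : R) = 4^-1 by field.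
  by rewrite exprVn ler_pdivlMr ?exprn_gt0// mulrC; exact: h.
have cs : cvgn (series dv).
  apply: normed_cvg; apply: (series_le_cvg _ _ dv_le) => //.
  apply: is_cvg_geometric_series.
  by rewrite ger0_norm ?invr_ge0// invf_lt1// ltr1n.
have -> : v = (fun n => v 0%N + series dv n).
  by apply/funext => n; rewrite /series/= telescope_sumr// addrC subrK.
by apply: is_cvgD => //; exact: is_cvg_cst.
Qed.

End theta.

Section frequently_bounded.
Context d (Z : measurableType d) (R : realType) (P : {measure set Z -> \bar R}).

(** By Fatou's lemma the lower limit is integrable, hence finite almost everywhere, and values below
    the lower limit plus 1 occur infinitely often. *)
Lemma ae_frequently_bounded (k : nat -> Z -> \bar R) (B : R) :
  (forall n, measurable_fun setT (k n)) -> (forall n z, (0 <= k n z)%E) ->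
  (forall n, (\int[P]_z k n z <= B%:E)%E) ->
  {ae P, forall z, exists C : R, forall N, exists2 n, (N <= n)%N & (k n z <= C%:E)%E}.
Proof.
move=> mk k0 kB.
have ml : measurable_fun setT (fun z => limn_einf (k^~ z)).
  rewrite (_ : (fun z => _) = (fun z => - limn_esup (fun n => - k n z)))%E.
    by apply: measurableT_comp => //; apply: measurable_fun_limn_esup => n; exact: measurableT_comp.
  by apply/funext => z; rewrite -limn_einfN; congr limn_einf; apply/funext => n /=; rewrite oppeK.
have einfs_ge0 z n : (0 <= einfs (k^~ z) n)%E.
  by apply: le_ereal_inf_tmp => _ [i _ <-].
have l0 z : (0 <= limn_einf (k^~ z))%E.
  rewrite limn_einf_lim; apply: lime_ge; first exact: is_cvg_einfs.
  exact: nearW.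
have il : P.-integrable setT (fun z => limn_einf (k^~ z)).
  apply/integrableP; split => //; under eq_integral do rewrite gee0_abs//.
  apply: le_lt_trans (fatou P measurableT mk (fun n z _ => k0 n z)) _.
  apply: (@le_lt_trans _ _ B%:E); last exact: ltry.
  rewrite limn_einf_lim; apply: lime_le; first exact: is_cvg_einfs.
  apply: nearW => n; apply: le_trans (kB n); apply: ereal_inf_lbound.
  by exists n => /=.
have := integrable_ae measurableT il; apply: filterS => z /(_ I) lfin.
exists (fine (limn_einf (k^~ z)) + 1) => N.
have : (einfs (k^~ z) N < (fine (limn_einf (k^~ z)) + 1)%:E)%E.
  apply: (@le_lt_trans _ _ (limn_einf (k^~ z))); last first.
    by rewrite EFinD fineK// lteDl// lte_fin.
  by rewrite limn_einf_lim (cvg_lim _ (@cvg_einfs_sup _ _))//; apply: ereal_sup_ubound; exists N.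
by move=> /ereal_inf_lt[_ [n /= Nn <-] /ltW nC]; exists n.
Qed.

End frequently_bounded.

(** * Almost everywhere convergence of averages over partitions *)

Section partition_averages.
Context dS (S : measurableType dS) d (T : measurableType d) (R : realType).
Variables (nu : {finite_measure set S -> \bar R}) (mu : {sigma_finite_measure set T -> \bar R}).
Variable phi : orlicz_function R.
Hypothesis phi_finite : finite_orlicz phi.
Variable m : set S -> L_phi mu phi.
Hypothesis mfa : finitely_additive m.
Hypothesis mle : forall A, measurable A -> `|m A| <= fine (nu A).
Variable w : T -> R.
Hypothesis mw : measurable_fun setT w.
Hypothesis w_gt0 : forall t, 0 < w t.
Hypothesis w_le1 : forall t, w t <= 1.
Hypothesis w_fin : (\int[mu]_t (w t)%:E < +oo)%E.
Implicit Types (p q : S -> nat) (z : S * T).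
Local Notation Phi := (even_ext phi).
Local Notation P := (nu \x mu)%E.

Let phiG : gauge phi. Proof. exact: orlicz_gauge. Qed.

Let nu_fin A : measurable A -> nu A \is a fin_num.
Proof. by move=> mA; exact: fin_num_measure. Qed.

(** On a null cell the average is 0, because the inverse of 0 is 0. *)
Definition cell_average p i t : R :=
  (fine (nu (p @^-1` [set i])))^-1 * orlicz_repr (m (p @^-1` [set i])) t.

Definition average_kernel p z : R := cell_average p (p z.1) z.2.

Local Notation x_ := cell_average.
Local Notation F := average_kernel.

Let measurable_repr (x : L_phi mu phi) : measurable_fun setT (orlicz_repr x : T -> R).
Proof. exact: orlicz_repr_measurable. Qed.

Lemma cell_average_measurable p i : measurable_fun setT (x_ p i).
Proof. by apply: measurable_funM. Qed.

Lemma measurable_label_prod d' (Y : measurableType d') p N (k : nat -> T -> Y) : label p N ->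
  (forall i, measurable_fun setT (k i)) -> measurable_fun setT (fun z : S * T => k (p z.1) z.2).
Proof.
move=> lp mk _ B mB; rewrite setTI.
have -> : (fun z : S * T => k (p z.1) z.2) @^-1` B =
    \bigcup_i ((p @^-1` [set i]) `*` (k i @^-1` B)).
  apply/seteqP; split=> [[s t] /= hB|[s t] [i _ [/= <-]]//].
  by exists (p s).
apply: bigcup_measurable => i _; apply: measurableX; first exact: measurable_label lp.
by rewrite -[X in measurable X]setTI; exact: mk.
Qed.

Lemma average_kernel_measurable p N : label p N -> measurable_fun setT (F p).
Proof. by move=> lp; apply: (measurable_label_prod lp) => i; exact: cell_average_measurable. Qed.

Lemma integral_prod_label p N (k : nat -> T -> \bar R) : label p N ->
  (forall i, measurable_fun setT (k i)) -> (forall i t, (0 <= k i t)%E) ->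
  (\int[P]_z k (p z.1) z.2 =
    \sum_(i < N) (\int[mu]_t k i t) * nu (p @^-1` [set (i : nat)]))%E.
Proof.
move=> lp mk k0; have mK := measurable_label_prod lp mk.
rewrite fubini_tonelli1//=.
rewrite /fubini_F/=.
have := integral_label nu lp measurableT (f := fun i => (\int[mu]_t k i t)%E).
move=> ->; last by move=> i; exact: integral_ge0.
by apply: eq_bigr => i _; rewrite setTI.
Qed.

Lemma modular_cell_average p N i : label p N -> (modular mu phi (x_ p i) <= 1)%E.
Proof.
move=> lp; set A := p @^-1` [set i].
have mA : measurable A by exact: measurable_label lp.
have := mle mA; rewrite L_phi_normE => hA.
have [n0|n0] := eqVneq (fine (nu A)) 0.
  rewrite (_ : x_ p i = fun=> 0) ?modular0//.
  by apply/funext => t; rewrite /x_ -/A n0 invr0 mul0r.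
have np : 0 < fine (nu A) by rewrite lt_neqAle eq_sym n0 fine_ge0.
have aO := orlicz_repr_class (m A).
have -> : x_ p i = (fine (nu A))^-1 *: (orlicz_repr (m A) : T -> R) + 0.
  by apply/funext => t; rewrite addr0.
have bO : (fine (nu A))^-1 *: (orlicz_repr (m A) : T -> R) + 0 \in orlicz_class mu phi.
  by rewrite orlicz_class_linear// orlicz_class0.
apply: modular_norm_le1 => //; rewrite addr0.
by rewrite luxemburg_normZ// gtr0_norm ?invr_gt0// mulrC ler_pdivrMr// mul1r.
Qed.

Lemma integral_kernel_le p N : label p N ->
  (\int[P]_z (Phi (F p z))%:E <= nu setT)%E.
Proof.
move=> lp; have := @integral_prod_label p N (fun i t => (Phi (x_ p i t))%:E) lp.
move=> ->; last 2 first.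
- move=> i; apply/measurable_EFinP; apply: measurableT_comp; first exact: even_ext_measurable.
  exact: cell_average_measurable.
- by move=> i t; rewrite lee_fin even_ext_ge0.
rewrite (measure_label nu lp measurableT); apply: lee_sum => i _.
rewrite setTI -[leRHS]mul1e; apply: lee_wpmul2r => //.
have := modular_cell_average i lp; rewrite /modular.
by under eq_integral do rewrite even_extE//.
Qed.

Let integrable_w : P.-integrable setT (fun z : S * T => (w z.2)%:E).
Proof.
have mw2 : measurable_fun setT (fun z : S * T => (w z.2)%:E).
  by apply/measurable_EFinP; exact: measurableT_comp.
apply/integrable12ltyP => //=.
have -> : (\int[mu]_y (`|w y|)%:E = \int[mu]_y (w y)%:E)%E.
  by apply: eq_integral => t _; rewrite gtr0_norm.
rewrite integral_cst//.
rewrite lte_mul_pinfty//; last by rewrite ltey_eq fin_num_measure.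
  by apply: integral_ge0 => t _; rewrite lee_fin ltW.
rewrite ge0_fin_numE//; by apply: integral_ge0 => t _; rewrite lee_fin ltW.
Qed.

(** The weight makes the constant in [|x| <= a + b * Phi x] integrable, and w <= 1 lets the modular
    bound the other term. *)
Lemma integrable_kernel p N : label p N ->
  P.-integrable setT (fun z : S * T => (F p z * w z.2)%:E).
Proof.
move=> lp; have [a a0 [b b0 hab]] := even_ext_growth phi_finite.
have mF := average_kernel_measurable lp.
have mFw : measurable_fun setT (fun z : S * T => (F p z * w z.2)%:E).
  by apply/measurable_EFinP; apply: measurable_funM => //; exact: measurableT_comp.
have mPF : measurable_fun setT (fun z => (Phi (F p z))%:E).
  by apply/measurable_EFinP; apply: measurableT_comp => //; exact: even_ext_measurable.
have iPhi : P.-integrable setT (fun z => (Phi (F p z))%:E).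
  apply/integrableP; split => //.
  under eq_integral do rewrite gee0_abs ?lee_fin ?even_ext_ge0//.
  by apply: le_lt_trans (integral_kernel_le lp) _; rewrite ltey_eq fin_num_measure.
have : P.-integrable setT (fun z : S * T => (a%:E * (w z.2)%:E + b%:E * (Phi (F p z))%:E)%E).
  by apply: integrableD => //; exact: integrableZl.
apply: le_integrable => // z _; rewrite -!EFinM -EFinD lee_fin.
have := hab (F p z) => h1; have wz := w_gt0 z.2; have := w_le1 z.2 => wz1.
have Pz := even_ext_ge0 phi (F p z).
rewrite [leRHS]ger0_norm; last by rewrite addr_ge0// mulr_ge0// ltW.
rewrite normrM (gtr0_norm wz).
apply: (@le_trans _ _ ((a + b * Phi (F p z)) * w z.2)); first by rewrite ler_wpM2r// ltW.
by rewrite mulrDl lerD2l ler_piMr// mulr_ge0//; exact: ltW.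
Qed.

Let repr0 : (orlicz_repr (0 : L_phi mu phi) : T -> R) = (fun=> 0) %[ae mu].
Proof.
have := orlicz_reprZ 0 (0 : L_phi mu phi); rewrite scale0r; apply: filterS => t h _.
by rewrite h// fctE /GRing.scale/= mul0r.
Qed.

Let repr_sum n (Y : 'I_n -> L_phi mu phi) :
  {ae mu, forall t, orlicz_repr (\sum_(i < n) Y i : L_phi mu phi) t = \sum_(i < n) orlicz_repr (Y i) t}.
Proof.
elim: n Y => [|n IH] Y.
  by rewrite big_ord0; apply: filterS repr0 => t h; rewrite h// big_ord0.
rewrite big_ord_recr/=.
apply: filterS2 (orlicz_reprD (\sum_(i < n) Y (widen_ord (leqnSn n) i) : L_phi mu phi) (Y ord_max))
  (IH (fun i => Y (widen_ord (leqnSn n) i))) => t h1 h2.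
by rewrite h1// big_ord_recr/= fctE h2.
Qed.

Let m_null A : measurable A -> fine (nu A) = 0 -> m A = 0.
Proof.
by move=> mA A0; apply/eqP; rewrite -normr_le0; have := mle mA; rewrite A0.
Qed.

Definition cell_mean (q : S -> nat) i : L_phi mu phi :=
  (fine (nu (q @^-1` [set i])))^-1 *: m (q @^-1` [set i]).

Lemma norm_cell_mean_le q N i : label q N -> `|cell_mean q i| <= 1.
Proof.
move=> lq; rewrite /cell_mean normrZ; set A := q @^-1` _.
have mA : measurable A by exact: measurable_label lq.
have A0 : 0 <= fine (nu A) by exact: fine_ge0.
rewrite ger0_norm ?invr_ge0//; have [->|n0] := eqVneq (fine (nu A)) 0; first by rewrite invr0 mul0r.
by rewrite mulrC ler_pdivrMr ?mul1r ?mle// lt_neqAle eq_sym n0.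
Qed.

(** A is a union of cells of q, on each of which V-mass times average gives back m exactly; on a
    null cell both are 0. *)
Lemma sum_cell_mean q N A : label q N -> measurable A ->
  (forall s s', q s = q s' -> A s -> A s') ->
  m A = \sum_(i < N) fine (nu (A `&` q @^-1` [set (i : nat)])) *: cell_mean q i.
Proof.
move=> lq mA sat; pose C j := q @^-1` [set j].
have mC j : measurable (C j) by exact: measurable_label lq.
have mAC j : measurable (A `&` C j) by exact: measurableI.
have m0 : m set0 = 0 by apply: m_null => //; rewrite measure0.
transitivity (\sum_(j < N) m (A `&` C j)).
  rewrite -(finitely_additive_sum mfa m0 (F := fun j : 'I_N => A `&` C j))//.
    congr m; apply/seteqP; split=> s; last by case=> j _ [].
    by move=> As; exists (Ordinal (lq.2 s)).
  by move=> i j _ _ [s [[_ /= si] [_ /= sj]]]; apply/val_inj; rewrite /= -si -sj.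
apply: eq_bigr => j _; have [[s [As Cs]]|AC] := pselect (exists s, A s /\ C j s); last first.
  have AC0 : A `&` C j = set0 by apply/seteqP; split=> // s [As Cs]; apply: AC; exists s.
  by rewrite -/(C j) AC0 m0 measure0 scale0r.
have -> : A `&` q @^-1` [set (j : nat)] = C j.
  apply/seteqP; split=> [s' []//|s' Cs']; split => //.
  by apply: sat As; rewrite Cs Cs'.
rewrite /cell_mean -/(C j); have [n0|n0] := eqVneq (fine (nu (C j))) 0.
  by rewrite n0 scale0r; exact: m_null.
by rewrite scalerA divff// scale1r.
Qed.

(** Pointwise form of the preceding identity. It holds almost everywhere only, as representatives of
    classes are linear only up to null sets. *)
Lemma average_saturated q N A : label q N -> measurable A ->
  (forall s s', q s = q s' -> A s -> A s') ->
  {ae mu, forall t, \sum_(j < N) fine (nu (A `&` q @^-1` [set (j : nat)])) * x_ q j t =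
    orlicz_repr (m A) t}.
Proof.
move=> lq mA sat; rewrite (sum_cell_mean lq mA sat).
pose a j := fine (nu (A `&` q @^-1` [set j])).
have h j : {ae mu, forall t, a j * x_ q j t = orlicz_repr (a j *: cell_mean q j) t}.
  apply: filterS2 (orlicz_reprZ (a j) (cell_mean q j))
    (orlicz_reprZ (fine (nu (q @^-1` [set j])))^-1 (m (q @^-1` [set j]))) => t h1 h2.
  by rewrite h1// fctE /GRing.scale/= h2.
apply: filterS2 (repr_sum (fun j : 'I_N => a j *: cell_mean q j)) (ae_foralln h) => t -> hj.
by apply: eq_bigr => j _; exact: hj.
Qed.

(* Averages over a refinement q of p have the same average as those over p on
   every cell of p. *)
Lemma integral_kernel_orthogonal p q M N (b : nat -> T -> R) (C : R) :
  label p M -> label q N -> refines q p -> (forall i, measurable_fun setT (b i)) ->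
  (forall i t, `|b i t| <= C) ->
  P.-integrable setT (fun z => (b (p z.1) z.2 * (F q z - F p z) * w z.2)%:E) /\
  (\int[P]_z (b (p z.1) z.2 * (F q z - F p z) * w z.2)%:E = 0)%E.
Proof.
move=> lp lq [r pr] mb bC.
have mbp : measurable_fun setT (fun z : S * T => b (p z.1) z.2).
  exact: (measurable_label_prod lp).
have mF p' N' : label p' N' -> measurable_fun setT (F p') by exact: average_kernel_measurable.
have mw2 : measurable_fun setT (fun z : S * T => w z.2) by exact: measurableT_comp.
have ii : P.-integrable setT (fun z => (b (p z.1) z.2 * (F q z - F p z) * w z.2)%:E).
  have iD : P.-integrable setT (fun z => ((F q z * w z.2)%:E - (F p z * w z.2)%:E)%E).
    by apply: integrableB => //; [exact: (integrable_kernel lq)|exact: (integrable_kernel lp)].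
  have := integrableZl measurableT C (integrable_abse iD).
  apply: le_integrable => //.
    apply/measurable_EFinP; apply: measurable_funM => //; apply: measurable_funM => //.
    by apply: measurable_funB; [exact: mF lq|exact: mF lp].
  move=> z _; rewrite [leRHS](_ : _ = `|C * `|F q z * w z.2 - F p z * w z.2| |%:E)//.
  rewrite abse_EFin lee_fin -mulrA -mulrBl (normrM (b _ _)) (normrM C) normr_id ler_wpM2r//.
  exact: le_trans (bC _ _) (ler_norm _).
(* Integrating over S first, it suffices that the inner integral vanishes for almost every t;
   countably many null sets are discarded, for the labels i of cells of p. *)
split => //; rewrite -integral21_prod_meas1//.
have mG := measurable_fubini_G ii.
rewrite -(integral0 mu setT); apply: ae_eq_integral => //.
pose D i := p @^-1` [set i]; pose E j := q @^-1` [set j].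
have mD i : measurable (D i) by exact: measurable_label lp.
have mE j : measurable (E j) by exact: measurable_label lq.
have satq i : {ae mu, forall t, \sum_(j < N) fine (nu (D i `&` E j)) * x_ q j t = orlicz_repr (m (D i)) t}.
  by apply: average_saturated => // s s' qs; rewrite /D pr /= qs.
have satp i : {ae mu, forall t, fine (nu (D i)) * x_ p i t = orlicz_repr (m (D i)) t}.
  have [n0|n0] := eqVneq (fine (nu (D i))) 0.
    by rewrite (m_null (mD i) n0) n0; apply: filterS repr0 => t h; rewrite h// mul0r.
  by apply: nearW => t; rewrite /x_ mulrA divff// mul1r.
apply: filterS2 (ae_foralln satq) (ae_foralln satp) => t hq hp _.
pose k j := b (r j) t * (x_ q j t - x_ p (r j) t) * w t.
rewrite /fubini_G/= (eq_integral (fun s => (k (q s))%:E)); last first.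
  by move=> s _; rewrite /k /F /= pr.
rewrite (integral_label_fin nu k lq measurableT); congr EFin.
have nuE j : fine (nu (setT `&` E j)) = \sum_(i < M) fine (nu (D i `&` E j)).
  rewrite setTI {1}(measure_label nu lp (mE j)) sum_fine.
    by congr fine; apply: eq_bigr => i _; rewrite setIC.
  by move=> i _; apply: nu_fin; exact: measurableI.
under eq_bigr do rewrite nuE mulr_sumr.
rewrite exchange_big/= big1// => i _.
(* A cell E j of q meets D i only if [r j = i]; for all other j both intersections are empty. *)
rewrite (eq_bigr (fun j : 'I_N => b i t * w t * (fine (nu (D i `&` E j)) * x_ q j t) -
    b i t * w t * x_ p i t * fine (nu (E j `&` D i)))); last first.
  move=> j _; have [[s [Ds Es]]|no] := pselect (exists s, D i s /\ E j s).
    have rj : r j = i by rewrite -Es -Ds pr.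
    by rewrite /k rj [E j `&` D i]setIC; ring.
  have -> : D i `&` E j = set0 by apply/seteqP; split=> // s [Ds Es]; apply: no; exists s.
  have -> : E j `&` D i = set0 by apply/seteqP; split=> // s [Es Ds]; apply: no; exists s.
  by rewrite measure0/=; ring.
rewrite big_split/= -mulr_sumr hq sumrN -mulr_sumr.
have -> : \sum_(j < N) fine (nu (E j `&` D i)) = fine (nu (D i)).
  rewrite [in RHS](measure_label nu lq (mD i)) sum_fine.
    by congr fine; apply: eq_bigr => j _; rewrite setIC.
  by move=> j _; apply: nu_fin; exact: measurableI.
by rewrite -hp; ring.
Qed.

(* Refining a partition increases the energy by at least the squared distance
   between the squashed averages. Hence the averages hardly change any more when
   a partition of nearly maximal energy is refined, which gives the almost
   everywhere convergence without a maximal inequality. *)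
Definition energy p : \bar R := (\int[P]_z (theta (F p z) * w z.2)%:E)%E.

Let mF p N : label p N -> measurable_fun setT (F p).
Proof. exact: average_kernel_measurable. Qed.

Let mw2 : measurable_fun setT (fun z : S * T => w z.2).
Proof. exact: measurableT_comp. Qed.

Let mtheta : measurable_fun setT (@theta R).
Proof. by apply: continuous_measurable_fun; exact: theta_continuous. Qed.

Let msquash : measurable_fun setT (@squash R).
Proof. by apply: continuous_measurable_fun; exact: squash_continuous. Qed.

Let thetaw_ge0 p z : 0 <= theta (F p z) * w z.2.
Proof. by rewrite mulr_ge0// ltW// theta_gt0. Qed.

Lemma energy_bounded : exists B : R, forall p N, label p N -> (energy p <= B%:E)%E.
Proof.
have [a a0 [b b0 hab]] := even_ext_growth phi_finite.
pose Iw := (\int[P]_z (w z.2)%:E)%E.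
have Iwfin : Iw \is a fin_num by exact: integrable_fin_num.
pose B := (1 + a) * fine Iw + b * fine (nu setT).
exists B => p N lp; have mFp := mF lp.
have mPF : measurable_fun setT (fun z => (Phi (F p z))%:E).
  by apply/measurable_EFinP; apply: measurableT_comp mFp; exact: even_ext_measurable.
apply: (@le_trans _ _ (\int[P]_z ((1 + a)%:E * (w z.2)%:E + b%:E * (Phi (F p z))%:E))%E).
  apply: ge0_le_integral => //.
  - by move=> z _; rewrite lee_fin.
  - by apply/measurable_EFinP; apply: measurable_funM => //; exact: measurableT_comp.
  - apply: emeasurable_funD; apply: measurable_funeM => //; exact/measurable_EFinP.
  move=> z _; rewrite -!EFinM -EFinD lee_fin.
  apply: (@le_trans _ _ ((1 + (a + b * Phi (F p z))) * w z.2)).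
    apply: ler_wpM2r; first exact: ltW.
    apply: le_trans (theta_le _) _.
    by rewrite lerD2l; exact: hab.
  rewrite addrA mulrDl lerD2l ler_piMr//.
  by rewrite mulr_ge0 ?even_ext_ge0// ltW.
have a1 : 0 <= 1 + a by rewrite addr_ge0// ltW.
rewrite ge0_integralD//; last 4 first.
- by move=> z _; rewrite -EFinM lee_fin mulr_ge0// ltW.
- by apply: measurable_funeM; exact/measurable_EFinP.
- by move=> z _; rewrite -EFinM lee_fin mulr_ge0 ?even_ext_ge0// ltW.
- exact: measurable_funeM.
rewrite ge0_integralZl//; last 2 first.
- exact/measurable_EFinP.
- by move=> z _; rewrite lee_fin ltW.
rewrite ge0_integralZl//; last 2 first.
- by move=> z _; rewrite lee_fin even_ext_ge0.
- by rewrite lee_fin ltW.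
have -> : (B%:E = (1 + a)%:E * Iw + b%:E * nu setT)%E.
  by rewrite /B [LHS]EFinD 2!EFinM !fineK// nu_fin.
apply: leeD => //; apply: lee_wpmul2l; first by rewrite lee_fin ltW.
exact: integral_kernel_le lp.
Qed.

(** [theta_bregman] is integrated against w. Its linear term has the bounded factor
    [squash (F p z)], determined by t and the cell of p, and vanishes by orthogonality. *)
Lemma energy_refines p q M N : label p M -> label q N -> refines q p ->
  ((2^-1)%:E * \int[P]_z ((squash (F q z) - squash (F p z)) ^+ 2 * w z.2)%:E +
    energy p <= energy q)%E.
Proof.
move=> lp lq qp.
have [ik k0] := @integral_kernel_orthogonal p q M N (fun i t => squash (x_ p i t)) 1 lp lq qp
  (fun i => measurableT_comp msquash (cell_average_measurable p i)) (fun i t => squash_le1 _).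
have mFp := mF lp; have mFq := mF lq.
have mE : measurable_fun setT (fun z => (squash (F q z) - squash (F p z)) ^+ 2 * w z.2).
  apply: measurable_funM => //; apply: measurable_funX.
  by apply: measurable_funB; exact: measurableT_comp.
rewrite -ge0_integralZl//; last 2 first.
- exact/measurable_EFinP.
- by move=> z _; rewrite lee_fin mulr_ge0 ?sqr_ge0// ltW.
apply: (integral_cancel (E := fun z => 2^-1 * ((squash (F q z) - squash (F p z)) ^+ 2 * w z.2))
  _ _ _ _ _ _ ik k0) => //.
- exact: measurable_funM.
- by apply: measurable_funM => //; exact: measurableT_comp.
- by apply: measurable_funM => //; exact: measurableT_comp.
- by move=> z; rewrite mulr_ge0 ?invr_ge0// mulr_ge0 ?sqr_ge0//; exact: ltW.
apply: nearW => z; have := theta_bregman (F p z) (F q z).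
have -> : squash (x_ p (p z.1) z.2) = squash (F p z) by [].
move/(ler_wpM2r (ltW (w_gt0 z.2))); rewrite !mulrDl.
by move=> h; apply: le_trans h; rewrite mulrA -addrA [leLHS]addrC.
Qed.

Lemma near_maximal_energy (e : R) : 0 < e -> exists p N, label p N /\
  forall q M, label q M -> (energy q <= energy p + e%:E)%E.
Proof.
move=> e0; have [B hB] := energy_bounded.
pose E := [set energy p | p in [set p | exists N, label p N]].
have l0 : label (fun=> 0%N : nat) 1 :> Prop by split => //; exact: measurable_cst.
have E0 p : (0 <= energy p)%E by apply: integral_ge0 => z _; rewrite lee_fin.
have supfin : ereal_sup E \is a fin_num.
  rewrite ge0_fin_numE.
    apply: (@le_lt_trans _ _ B%:E); last exact: ltry.
    by apply: ge_ereal_sup => _ [p [N lp] <-]; exact: hB lp.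
  apply: le_trans (E0 (fun=> 0%N)) _; apply: ereal_sup_ubound.
  by exists (fun=> 0%N) => //; exists 1%N.
have [_ [p [N lp] <-] hp] := ub_ereal_sup_adherent e0 supfin.
exists p, N; split => // q M lq.
apply: (@le_trans _ _ (ereal_sup E)); first by apply: ereal_sup_ubound; exists q => //; exists M.
by rewrite -leeBlDr// ltW.
Qed.

(** Refinements of r have at least its energy, so that they are as nearly maximal as r itself. *)
Lemma near_maximal_squash (e : R) r p q K M N : label r K -> label p M -> label q N ->
  (forall q M, label q M -> (energy q <= energy r + e%:E)%E) ->
  refines p r -> refines q p ->
  (\int[P]_z ((squash (F q z) - squash (F p z)) ^+ 2 * w z.2)%:E <= (2 * e)%:E)%E.
Proof.
move=> lr lp lq hr pr qp.
have sq_ge0 p' q' : (0 <= (2^-1)%:E *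
    \int[P]_z ((squash (F q' z) - squash (F p' z)) ^+ 2 * w z.2)%:E)%E.
  rewrite mule_ge0 ?lee_fin ?invr_ge0//; apply: integral_ge0 => z _.
  by rewrite lee_fin mulr_ge0 ?sqr_ge0//; exact: ltW.
have [B hB] := energy_bounded.
have rfin : energy r \is a fin_num.
  rewrite ge0_fin_numE; last by apply: integral_ge0 => z _; rewrite lee_fin.
  by apply: le_lt_trans (hB _ _ lr) _; exact: ltry.
have rp : (energy r <= energy p)%E.
  by apply: le_trans (energy_refines lr lp pr); rewrite leeDr.
have := le_trans (energy_refines lp lq qp) (hr _ _ lq).
move=> /(le_trans (leeD (lexx _) rp)); rewrite addeC leeD2lE// => h.
rewrite [leLHS](_ : _ = 2%:E * (2^-1%:E *
    \int[P]_z ((squash (F q z) - squash (F p z)) ^+ 2 * w z.2)%:E))%E.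
  by rewrite EFinM; apply: lee_wpmul2l; rewrite ?lee_fin.
by rewrite muleA -EFinM divff ?mul1e.
Qed.

Fixpoint merge_labels (r H : nat -> S -> nat) n := match n with
  | 0 => join (r 0) (H 0)
  | n.+1 => join (merge_labels r H n) (join (r n.+1) (H n.+1)) end.

(** Any q n refining p n has squashed averages within a multiple of 2^-n of those of p n, at almost
    every point. For q n = p (n + 1) this makes the latter converge; bounded energies exclude the
    limits 1 and -1; for general q it shows that the limit is the same. *)
Lemma average_limit (H : nat -> S -> nat) : (forall n, exists N, label (H n) N) ->
  exists (p : nat -> S -> nat) (g : S * T -> R),
  [/\ forall n, exists N, label (p n) N,
      forall n, refines (p n.+1) (p n),
      forall n, refines (p n) (H n),
      measurable_fun setT g &
      forall q : nat -> S -> nat, (forall n, exists N, label (q n) N) -> (forall n, refines (q n) (p n)) ->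
        {ae P, forall z, F (q n) z @[n --> \oo] --> g z}].
Proof.
move=> lH.
(* Of the rate 8^-n, a factor 4^-n makes the increments of order 2^-n pointwise, and a factor 2^-n
   makes the rescaled integrals summable. *)
have e0 n : (0 : R) < 8^-1 ^+ n by rewrite exprn_gt0// invr_gt0.
have /choice[r hr] n := near_maximal_energy (e0 n).
pose p := merge_labels r H.
have lp n : exists N, label (p n) N.
  have lrH i : exists N, label (join (r i) (H i)) N.
    by have [N [lr _]] := hr i; have [M lHi] := lH i; exact: label_join lr lHi.
  elim: n => [|n [N IH]]; first exact: lrH.
  by have [M lM] := lrH n.+1; exact: label_join IH lM.
have pp n : refines (p n.+1) (p n) by exact: refines_joinl.
have prH n : refines (p n) (join (r n) (H n)).
  by case: n => [|n]; [exact: refines_refl|exact: refines_joinr].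
have pr n : refines (p n) (r n) := refines_trans (prH n) (refines_joinl _ _).
have pH n : refines (p n) (H n) := refines_trans (prH n) (refines_joinr _ _).
have mFn (q : nat -> S -> nat) n : (forall n, exists N, label (q n) N) -> measurable_fun setT (F (q n)).
  by move=> lq; have [N lqn] := lq n; exact: mF lqn.
pose sq p q z : R := (squash (F q z) - squash (F p z)) ^+ 2 * w z.2.
have sq0 p' q' z : 0 <= sq p' q' z by rewrite mulr_ge0 ?sqr_ge0//; exact: ltW.
have msq p' q' M N : label p' M -> label q' N -> measurable_fun setT (sq p' q').
  move=> lp' lq'; apply: measurable_funM => //; apply: measurable_funX.
  have mFp := mF lp'; have mFq := mF lq'.
  by apply: measurable_funB; exact: measurableT_comp.
have close (q : nat -> S -> nat) : (forall n, exists N, label (q n) N) -> (forall n, refines (q n) (p n)) ->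
    {ae P, forall z, exists C : R, forall n, 4 ^+ n * (squash (F (q n) z) - squash (F (p n) z)) ^+ 2 <= C}.
  move=> lq qp.
  have : {ae P, forall z, exists C : R, forall n, ((4 ^+ n * sq (p n) (q n) z)%:E <= C%:E)%E}.
    apply: (@ae_bounded _ _ _ P (fun n z => (4 ^+ n * sq (p n) (q n) z)%:E) 2).
    - move=> n; have [N lpn] := lp n; have [M lqn] := lq n.
      by apply/measurable_EFinP; apply: measurable_funM => //; exact: msq lpn lqn.
    - by move=> n z; rewrite lee_fin mulr_ge0.
    move=> n; have [N lpn] := lp n; have [M lqn] := lq n; have [K [lr rmax]] := hr n.
    under eq_integral do rewrite EFinM.
    rewrite ge0_integralZl//; last 2 first.
    - by apply/measurable_EFinP; exact: msq lpn lqn.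
    - by move=> z _; rewrite lee_fin.
    have h := near_maximal_squash lr lpn lqn rmax (pr n) (qp n).
    have -> : (2 * 2^-1 ^+ n)%:E = ((4 ^+ n)%:E * (2 * 8^-1 ^+ n)%:E : \bar R)%E.
      rewrite -EFinM; congr EFin; rewrite mulrCA -exprMn; congr (_ * _ ^+ _).
      by field.
    by apply: lee_wpmul2l; rewrite ?lee_fin.
  apply: filterS => z [C hC]; exists (C / w z.2) => n.
  by rewrite ler_pdivlMr// -mulrA; have := hC n; rewrite lee_fin.
have lpS n : exists N, label (p n.+1) N by exact: lp.
have [B hB] := energy_bounded.
have bnd : {ae P, forall z, exists C : R, forall N, exists2 n, (N <= n)%N &
    ((theta (F (p n) z) * w z.2)%:E <= C%:E)%E}.
  apply: (@ae_frequently_bounded _ _ _ P _ B).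
  - move=> n; apply/measurable_EFinP; apply: measurable_funM => //.
    by apply: measurableT_comp => //; exact: mFn.
  - by move=> n z; rewrite lee_fin.
  - by move=> n; have [N lpn] := lp n; exact: hB lpn.
(* The upper limit is measurable everywhere and agrees with the limit wherever that exists. *)
pose g z := fine (limn_esup (fun n => (F (p n) z)%:E)).
exists p, g; split => //.
  apply: measurableT_comp => //; apply: measurable_fun_limn_esup => n.
  by apply/measurable_EFinP; exact: mFn.
move=> q lq qp.
apply: filterS3 (close (fun n => p n.+1) lpS pp) (close q lq qp) bnd.
move=> z [C1 h1] [C2 h2] [C3 h3].
have [u pu] : exists u : R, squash (F (p n) z) @[n --> \oo] --> u.
  have /cvg_ex[u hu] := geometric_increments_cvg (v := fun n => squash (F (p n) z)) h1.
  by exists u.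
have u1 : u ^+ 2 < 1.
  apply: (squash_limit_lt1 pu (C := C3 / w z.2)) => N; have [n Nn hn] := h3 N.
  by exists n => //; rewrite ler_pdivlMr// -lee_fin.
have -> : g z = u / Num.sqrt (1 - u ^+ 2).
  have h : (F (p n) z)%:E @[n --> \oo] --> (u / Num.sqrt (1 - u ^+ 2))%:E.
    by apply: cvg_EFin; [exact: nearW|exact: (squash_cvg pu u1)].
  by have [_ hg] := cvg_limn_einf_sup h; rewrite /g hg.
apply: squash_cvg => //.
have d0 : squash (F (q n) z) - squash (F (p n) z) @[n --> \oo] --> (0 : R).
  have C20 : 0 <= C2 by apply: le_trans (h2 0%N); rewrite mulr_ge0 ?sqr_ge0.
  apply: (@squeeze_cvgr _ _ _ _ (fun n => - (Num.sqrt C2 * 2^-1 ^+ n)) (fun n => Num.sqrt C2 * 2^-1 ^+ n)).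
  - apply: nearW => n; rewrite -ler_norml.
    rewrite -(@ler_pXn2r _ 2)// ?nnegrE ?mulr_ge0 ?sqrtr_ge0 ?exprn_ge0 ?invr_ge0//.
    rewrite real_normK ?num_real// exprMn sqr_sqrtr// -exprM mulnC exprM.
    have -> : (2^-1 ^+ 2 : R) = 4^-1 by field.
    by rewrite exprVn ler_pdivlMr ?exprn_gt0// mulrC; exact: h2.
  - rewrite -oppr0; apply: cvgN; rewrite -(mulr0 (Num.sqrt C2)); apply: cvgM; first exact: cvg_cst.
    by apply: cvg_expr; rewrite ger0_norm ?invr_ge0// invf_lt1// ltr1n.
  - rewrite -(mulr0 (Num.sqrt C2)); apply: cvgM; first exact: cvg_cst.
    by apply: cvg_expr; rewrite ger0_norm ?invr_ge0// invf_lt1// ltr1n.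
rewrite -[u]add0r (_ : (fun n => _) = (fun n => squash (F (q n) z) - squash (F (p n) z) + squash (F (p n) z))).
  exact: cvgD.
by apply/funext => n; rewrite subrK.
Qed.

End partition_averages.

(** * Uniform integrability, Jensen's inequality and convergence in modular *)

Section ereal_limits.
Context (R : realType).

Lemma cvge0_near (u : nat -> \bar R) (e : R) : u n @[n --> \oo] --> 0%E -> 0 < e ->
  \forall n \near \oo, (u n < e%:E)%E.
Proof.
move=> /fine_cvgP[ufin u0] e0.
have h : \forall n \near \oo, fine (u n) < e by exact: (cvgr_lt _ u0).
near=> n; have un : u n \is a fin_num by near: n.
by rewrite -(fineK un) lte_fin; near: n.
Unshelve. all: by end_near.
Qed.

Lemma cvge0_le (u : nat -> \bar R) : (forall n, (0 <= u n)%E) ->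
  (forall e, 0 < e -> exists2 v : nat -> \bar R, v n @[n --> \oo] --> 0%E &
    forall n, (u n <= v n + e%:E)%E) ->
  u n @[n --> \oo] --> 0%E.
Proof.
move=> u0 h.
have main e : 0 < e -> \forall n \near \oo, (u n < e%:E)%E.
  move=> e0; have e20 : 0 < e / 2 by rewrite divr_gt0.
  have [v v0 uv] := h _ e20; have := cvge0_near v0 e20; apply: filterS => n vn.
  apply: le_lt_trans (uv n) _; rewrite [e in ltRHS](_ : _ = e / 2 + e / 2); last by field.
  by rewrite EFinD lteD2rE.
have ufin : \forall n \near \oo, u n \is a fin_num.
  by have := main 1 ltr01; apply: filterS => n un; rewrite ge0_fin_numE// (lt_trans un)// ltry.
apply/fine_cvgP; split => //; apply/cvgr0Pnorm_lt => e e0.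
near=> n; have un : u n \is a fin_num by near: n.
rewrite /= ger0_norm ?fine_ge0// -lte_fin fineK//; near: n; exact: main.
Unshelve. all: by end_near.
Qed.

End ereal_limits.

Section truncated_slope.
Context (R : realType) (phi : orlicz_function R).
Hypothesis phi_finite : finite_orlicz phi.
Local Notation Phi := (even_ext phi).
Local Notation slope := (subgradient (even_ext_convex phi_finite)).

(** Here x is an average and y the weight at the same point. Dividing by y cancels the weight of the
    integrals in which the slope is used; the two cut-offs make the quotient bounded. *)
Definition truncated_slope N (x y : R) : R :=
  if (`|x| <= N%:R) && (N.+1%:R^-1 <= y) then slope x / y else 0.

Lemma truncated_slope_bounded N : exists C : R, forall x y, `|truncated_slope N x y| <= C.
Proof.
pose M := Num.max `|slope N%:R| `|slope (- N%:R)|.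
have M0 : 0 <= M by rewrite le_max normr_ge0.
exists (M * N.+1%:R) => x y; rewrite /truncated_slope.
case: ifPn => [/andP[xN Ny]|_]; last by rewrite normr0 mulr_ge0.
have y0 : 0 < y by apply: lt_le_trans Ny; rewrite invr_gt0.
rewrite normrM normfV (gtr0_norm y0); apply: ler_pM => //; first by rewrite invr_ge0 ltW.
  exact: subgradient_bounded.
by rewrite invf_ple ?posrE.
Qed.

Lemma truncated_slope_measurable d (Z : measurableType d) N (f h : Z -> R) :
  measurable_fun setT f -> measurable_fun setT h ->
  measurable_fun setT (fun z => truncated_slope N (f z) (h z)).
Proof.
move=> mf mh; pose c : R := N.+1%:R^-1.
have c0 : 0 < c by rewrite invr_gt0.
(* Where the weight is at least c it may be replaced by its maximum with c, and the inverse of that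
   maximum is monotone in the weight, hence measurable. *)
rewrite (_ : (fun z => _) = fun z => if (`|f z| <= N%:R) && (c <= h z)
    then slope (f z) / Num.max (h z) c else 0); last first.
  apply/funext => z; rewrite /truncated_slope -/c.
  by case: ifPn => // /andP[_ /max_idPl ->].
apply: measurable_fun_ifT => //.
- apply: measurable_and; apply: measurable_fun_ler => //.
  exact: measurableT_comp.
- apply: measurable_funM.
    by apply: measurableT_comp mf; exact: subgradient_measurable.
  apply: (measurableT_comp (f := fun y : R => (Num.max y c)^-1)) mh.
  apply: nonincreasing_measurable => // x y xy.
  have cm y' : 0 < Num.max y' c by rewrite lt_max c0 orbT.
  by rewrite lef_pV2 ?posrE// ge_max !le_max xy lexx orbT.
Qed.

End truncated_slope.

Section growth.
Context (R : realType) (phi : orlicz_function R).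
Hypothesis phi_finite : finite_orlicz phi.
Local Notation Phi := (even_ext phi).

(** The arbitrarily small coefficient e, in place of the fixed one of [even_ext_growth], is what
    yields uniform integrability, as in the criterion of de la Vallee Poussin. *)
Lemma N_function_growth : N_function_at_infinity phi ->
  forall e, 0 < e -> exists2 K : R, 0 < K & forall x, `|x| <= K + e * Phi x.
Proof.
move=> phiN e e0; move/cvgeyPge: phiN => /(_ e^-1)[M [_ hM]].
exists (Num.max M 1); first by rewrite lt_max ltr01 orbT.
move=> x; have [xM|Mx] := leP `|x| (Num.max M 1).
  by apply: le_trans xM _; rewrite lerDl mulr_ge0 ?even_ext_ge0// ltW.
move: (Mx); rewrite gt_max => /andP[Mx' x1].
have x0 : 0 < `|x| by exact: lt_trans x1.
have := hM _ Mx'; rewrite even_extE// -EFinM lee_fin ler_pdivlMr// mulrC.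
rewrite ler_pdivrMr// mulrC => h; apply: le_trans h _; rewrite lerDr.
by rewrite le_max ler01 orbT.
Qed.

Lemma Delta2_growth d (T : measurableType d) (mu : {measure set T -> \bar R}) :
  appropriate_Delta2 mu phi -> exists2 k : R, 0 <= k /\ (k%:E * mu setT < +oo)%E &
  forall l : R, exists2 C : R, 0 <= C & forall x, Phi (l * x) <= C * (Phi x + k).
Proof.
move=> [Doo Dfin].
suff [k [k0 kmu] [K K0 hK]] : exists2 k : R, 0 <= k /\ (k%:E * mu setT < +oo)%E &
    exists2 K : R, 0 <= K & forall x, Phi (2 * x) <= K * (Phi x + k).
  exists k => // l.
  have hn n x : Phi (2 ^+ n * x) + k <= (K + 1) ^+ n * (Phi x + k).
    elim: n => [|n IH]; first by rewrite !expr0 !mul1r.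
    rewrite !exprS -!mulrA; apply: (@le_trans _ _ ((K + 1) * (Phi (2 ^+ n * x) + k))).
      rewrite [leRHS]mulrDl mul1r; apply: lerD; first exact: hK.
      by rewrite lerDr even_ext_ge0.
    by rewrite ler_wpM2l// addr_ge0.
  have [n ln] : exists n : nat, `|l| <= 2 ^+ n.
    exists (Num.bound `|l|); rewrite ltW//; apply: lt_le_trans (archi_boundP (normr_ge0 l)) _.
    by rewrite -natrX ler_nat ltnW// ltn_expl.
  exists ((K + 1) ^+ n); first by rewrite exprn_ge0// addr_ge0.
  move=> x; apply: le_trans (hn n x); rewrite -[leLHS]addr0; apply: lerD => //.
  apply: le_even_ext => //; rewrite !normrM ler_wpM2r//.
  by rewrite [leRHS]ger0_norm// exprn_ge0.
have [muoo|mufin] := eqVneq (mu setT) +oo%E.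
  have [K K2 hK] := Doo muoo; exists 0; first by rewrite mul0e lexx ltry.
  have K0 : 0 <= K by lra.
  exists K => // x; rewrite addr0 -lee_fin EFinM -!even_extE//.
  by rewrite normrM ger0_norm//; exact: hK.
have mufin' : (mu setT < +oo)%E by rewrite ltey.
have [K [u0 [K2 u00 _ hK]]] := Dfin mufin'.
have K0 : 0 <= K by lra.
have hK' x : u0 <= `|x| -> Phi (2 * x) <= K * Phi x.
  move=> ux; rewrite -lee_fin EFinM -!even_extE// normrM ger0_norm//; exact: hK.
exists (Phi u0).
  rewrite even_ext_ge0; split => //; apply: lte_mul_pinfty => //.
  by rewrite lee_fin even_ext_ge0.
exists K => // x; have [ux|xu] := leP u0 `|x|.
  by apply: le_trans (hK' _ ux) _; rewrite ler_wpM2l// lerDl even_ext_ge0.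
apply: (@le_trans _ _ (Phi (2 * u0))).
  by apply: le_even_ext => //; rewrite !normrM ler_wpM2l// (ger0_norm u00) ltW.
apply: le_trans (hK' _ _) _; first by rewrite ger0_norm.
by rewrite ler_wpM2l// lerDr even_ext_ge0.
Qed.

End growth.

(* Here F is a martingale for the finite measure W P, except that the
   martingale property is needed only against bounded functions b (F n) w. *)
Section modular_convergence.
Context d (Z : measurableType d) (R : realType) (P : {measure set Z -> \bar R}).
Variable phi : orlicz_function R.
Hypothesis phi_finite : finite_orlicz phi.
Local Notation Phi := (even_ext phi).
Variables (W : Z -> R) (F : nat -> Z -> R) (g : Z -> R) (c : R).
Hypothesis mW : measurable_fun setT W.
Hypothesis W_gt0 : forall z, 0 < W z.
Hypothesis W_le1 : forall z, W z <= 1.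
Hypothesis W_fin : (\int[P]_z (W z)%:E < +oo)%E.
Hypothesis mF : forall n, measurable_fun setT (F n).
Hypothesis mg : measurable_fun setT g.
Hypothesis Fg : {ae P, forall z, F n z @[n --> \oo] --> g z}.
Hypothesis Fle : forall n, (\int[P]_z (Phi (F n z))%:E <= c%:E)%E.

Let mPhi (f : Z -> R) : measurable_fun setT f -> measurable_fun setT (fun z => (Phi (f z))%:E).
Proof.
by move=> mf; apply/measurable_EFinP; apply: measurableT_comp mf; exact: even_ext_measurable.
Qed.

Lemma integral_limit_le : (\int[P]_z (Phi (g z))%:E <= c%:E)%E.
Proof.
apply: (@fatou_cvg _ _ _ P (fun n z => (Phi (F n z))%:E) _ (fun=> c%:E)) => //.
- by move=> n; exact: mPhi.
- by move=> n z; rewrite lee_fin even_ext_ge0.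
- exact: mPhi.
- by move=> z; rewrite lee_fin even_ext_ge0.
- apply: filterS Fg => z Fz; apply: cvg_EFin; first exact: nearW.
  by apply: (cvg_comp _ _ Fz); exact: even_ext_continuous.
- exact: cvg_cst.
Qed.

Hypothesis phi_growth : forall e, 0 < e -> exists2 K : R, 0 < K & forall x, `|x| <= K + e * Phi x.

Let dist n z := `|F n z - g z| * W z.
Let dist_ge0 n z : 0 <= dist n z. Proof. by rewrite mulr_ge0// ltW. Qed.
Let mdist n : measurable_fun setT (dist n).
Proof.
by apply: measurable_funM => //; apply: measurableT_comp => //; exact: measurable_funB.
Qed.

Let c_ge0 : 0 <= c.
Proof.
rewrite -lee_fin; apply: le_trans (Fle 0); apply: integral_ge0 => z _.
by rewrite lee_fin even_ext_ge0.
Qed.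

(** Uniform integrability: the part of [|F n - g|] above 2K is at most e (Phi (F n) + Phi g), whose
    integral is at most 2 c e. The truncated part is dominated by a multiple of W. *)
Lemma dist_split e : 0 < e -> exists2 K : R, 0 < K & forall n,
  (\int[P]_z (dist n z)%:E <= \int[P]_z (Num.min `|F n z - g z| K * W z)%:E + (e * (2 * c))%:E)%E.
Proof.
move=> e0; have [K K0 hK] := phi_growth e0; exists (2 * K); first exact: mulr_gt0.
move=> n; have mmin : measurable_fun setT (fun z => Num.min `|F n z - g z| (2 * K) * W z).
  apply: measurable_funM => //; apply: measurable_minr => //.
  by apply: measurableT_comp => //; exact: measurable_funB.
have min0 z : 0 <= Num.min `|F n z - g z| (2 * K) * W z.
  by rewrite mulr_ge0 ?le_min ?normr_ge0 ?mulr_ge0//; exact: ltW.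
have P0 (f : Z -> R) z : (0 <= (Phi (f z))%:E)%E by rewrite lee_fin even_ext_ge0.
have mF' := mPhi (mF n); have mg' := mPhi mg.
have e0' : (0 <= e%:E)%E by rewrite lee_fin ltW.
apply: (@le_trans _ _ (\int[P]_z ((Num.min `|F n z - g z| (2 * K) * W z)%:E +
    e%:E * ((Phi (F n z))%:E + (Phi (g z))%:E)))%E).
  apply: ge0_le_integral => //.
  - by move=> z _; rewrite lee_fin.
  - exact/measurable_EFinP.
  - apply: emeasurable_funD; first exact/measurable_EFinP.
    by apply: measurable_funeM; exact: emeasurable_funD.
  move=> z _; rewrite -[X in (_ + _ * X)%E]EFinD -EFinM -EFinD lee_fin.
  have [dK|Kd] := leP `|F n z - g z| (2 * K).
    by rewrite lerDl mulr_ge0 ?addr_ge0 ?even_ext_ge0//; exact: ltW.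
  have h : `|F n z - g z| <= 2 * K + e * (Phi (F n z) + Phi (g z)).
    apply: le_trans (ler_normB _ _) _; apply: le_trans (lerD (hK _) (hK _)) _.
    by rewrite mulrDr addrACA -mulr2n mulr_natl.
  apply: (@le_trans _ _ ((2 * K + e * (Phi (F n z) + Phi (g z))) * W z)).
    by apply: ler_wpM2r => //; exact: ltW.
  rewrite mulrDl lerD2l ler_piMr//.
  by rewrite mulr_ge0 ?addr_ge0 ?even_ext_ge0//; exact: ltW.
rewrite ge0_integralD//; last 4 first.
- by move=> z _; rewrite lee_fin.
- exact/measurable_EFinP.
- by move=> z _; rewrite mule_ge0 ?adde_ge0.
- by apply: measurable_funeM; exact: emeasurable_funD.
apply: leeD => //; rewrite ge0_integralZl//; last 2 first.
- exact: emeasurable_funD.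
- by move=> z _; rewrite adde_ge0.
rewrite EFinM; apply: lee_wpmul2l => //; rewrite ge0_integralD//.
by rewrite mulr_natl mulr2n EFinD; apply: leeD => //; exact: integral_limit_le.
Qed.

Let integral_min_cvg K : 0 < K ->
  (\int[P]_z (Num.min `|F n z - g z| K * W z)%:E @[n --> \oo] --> 0)%E.
Proof.
move=> K0; have mmin n : measurable_fun setT (fun z => Num.min `|F n z - g z| K * W z).
  apply: measurable_funM => //; apply: measurable_minr => //.
  by apply: measurableT_comp => //; exact: measurable_funB.
have min0 n z : 0 <= Num.min `|F n z - g z| K * W z.
  by rewrite mulr_ge0 ?le_min ?normr_ge0//; exact: ltW.
have iW : P.-integrable setT (fun z => (W z)%:E).
  apply/integrableP; split; first exact/measurable_EFinP.
  by under eq_integral do rewrite gee0_abs ?lee_fin ?(ltW (W_gt0 _))//.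
have [] := @dominated_convergence _ _ _ P setT measurableT
  (fun n z => (Num.min `|F n z - g z| K * W z)%:E) (fun=> 0%E) (fun z => (K%:E * (W z)%:E)%E).
- by move=> n; exact/measurable_EFinP.
- exact: measurable_cst.
- apply: filterS Fg => z Fz _; apply: cvg_EFin; first exact: nearW.
  rewrite -(mul0r (W z)); apply: cvgM; last exact: cvg_cst.
  apply: (@squeeze_cvgr _ _ _ _ (cst 0) (fun n => `|F n z - g z|)).
  + by apply: nearW => n; rewrite le_min normr_ge0 (ltW K0) ge_min lexx.
  + exact: cvg_cst.
  + by apply/norm_cvg0P; rewrite -(subrr (g z)); apply: cvgB => //; exact: cvg_cst.
- exact: integrableZl.
- apply: nearW => z n _; rewrite gee0_abs ?lee_fin//.
  by apply: ler_wpM2r; [exact: ltW|rewrite ge_min lexx orbT].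
by move=> _ _; rewrite integral0.
Qed.

Lemma dist_cvg0 : (\int[P]_z (dist n z)%:E @[n --> \oo] --> 0)%E.
Proof.
apply: cvge0_le => [n|e e0]; first by apply: integral_ge0 => z _; rewrite lee_fin.
have c1 : 0 < 2 * c + 1 by rewrite ltr_wpDl// mulr_ge0.
have e10 : 0 < e / (2 * c + 1) by rewrite divr_gt0.
have [K K0 hK] := dist_split e10.
exists (fun n => \int[P]_z (Num.min `|F n z - g z| K * W z)%:E)%E.
  exact: integral_min_cvg.
move=> n; apply: le_trans (hK n) _; apply: leeD => //.
rewrite lee_fin mulrAC ler_pdivrMr//; apply: ler_wpM2l; first exact: ltW.
by rewrite lerDl.
Qed.

Lemma integrable_dist n : P.-integrable setT (fun z => ((g z - F n z) * W z)%:E).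
Proof.
have mgF : measurable_fun setT (fun z => (g z - F n z) * W z).
  by apply: measurable_funM => //; exact: measurable_funB.
apply/integrableP; split; first exact/measurable_EFinP.
rewrite (eq_integral (fun z => (dist n z)%:E)); last first.
  by move=> z _; rewrite /dist /= distrC normrM (gtr0_norm (W_gt0 z)).
have [K K0 hK] := dist_split ltr01; apply: le_lt_trans (hK n) _.
rewrite lte_add_pinfty ?ltry//.
apply: (@le_lt_trans _ _ (\int[P]_z (K%:E * (W z)%:E))%E).
  apply: ge0_le_integral => //.
  - by move=> z _; rewrite lee_fin mulr_ge0 ?le_min ?normr_ge0//; exact: ltW.
  - apply/measurable_EFinP; apply: measurable_funM => //; apply: measurable_minr => //.
    by apply: measurableT_comp => //; exact: measurable_funB.
  - by apply: measurable_funeM; exact/measurable_EFinP.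
  - by move=> z _; apply: ler_wpM2r; [exact: ltW|rewrite ge_min lexx orbT].
rewrite ge0_integralZl//; last 3 first.
- exact/measurable_EFinP.
- by move=> z _; rewrite lee_fin; exact: ltW.
- by rewrite lee_fin ltW.
by rewrite lte_mul_pinfty// ?lee_fin ?ltW// integral_ge0// => z _; rewrite lee_fin ltW.
Qed.

Hypothesis Fmart : forall n m N, (n <= m)%N ->
  P.-integrable setT (fun z => (truncated_slope phi_finite N (F n z) (W z) * (F m z - F n z) * W z)%:E) /\
  (\int[P]_z (truncated_slope phi_finite N (F n z) (W z) * (F m z - F n z) * W z)%:E = 0)%E.

Local Notation b := (truncated_slope phi_finite).

(** The factor b is bounded, so F m may be replaced by its limit g in the weighted mean. *)
Lemma limit_orthogonal n N :
  P.-integrable setT (fun z => (b N (F n z) (W z) * (g z - F n z) * W z)%:E) /\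
  (\int[P]_z (b N (F n z) (W z) * (g z - F n z) * W z)%:E = 0)%E.
Proof.
have [C bC] := truncated_slope_bounded phi_finite N.
have C0 : 0 <= C by apply: le_trans (bC 0 0).
have mb := truncated_slope_measurable phi_finite N (mF n) mW.
have ib m : P.-integrable setT (fun z => (b N (F n z) (W z) * (g z - F m z) * W z)%:E).
  have := integrableZl measurableT C (integrable_dist m); apply: le_integrable => //.
    apply/measurable_EFinP; do 2 apply: measurable_funM => //; exact: measurable_funB.
  move=> z _; rewrite -EFinM lee_fin -!mulrA [leRHS]normrM (ger0_norm C0) [leLHS]normrM.
  by rewrite ler_wpM2r.
split; first exact: ib.
have h m : (n <= m)%N -> (`|\int[P]_z (b N (F n z) (W z) * (g z - F n z) * W z)%:E| <=
    C%:E * \int[P]_z (dist m z)%:E)%E.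
  move=> nm; have [i0 int0] := Fmart N nm.
  rewrite (_ : \int[P]_z _ = \int[P]_z (b N (F n z) (W z) * (g z - F m z) * W z)%:E)%E; last first.
    rewrite -[RHS]adde0 -int0 -integralD//; apply: eq_integral => z _.
    by rewrite -EFinD; congr EFin; ring.
  apply: le_trans (le_abse_integral P measurableT _) _.
    by case/integrableP: (ib m).
  rewrite -ge0_integralZl//; last 2 first.
  - by apply/measurable_EFinP; exact: mdist.
  - by move=> z _; rewrite lee_fin.
  apply: ge0_le_integral => //.
  - by apply: measurableT_comp => //; case/integrableP: (ib m).
  - by apply: measurable_funeM; apply/measurable_EFinP; exact: mdist.
  move=> z _; rewrite abse_EFin -EFinM lee_fin -!mulrA normrM.
  rewrite normrM (gtr0_norm (W_gt0 z)) distrC; apply: ler_wpM2r; first exact: dist_ge0.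
  exact: bC.
apply/eqP; rewrite -abse_eq0 eq_le abse_ge0 andbT.
have : (C%:E * \int[P]_z (dist m z)%:E @[m --> \oo] --> 0)%E.
  by rewrite -(mule0 C%:E); apply: cvgeZl => //; exact: dist_cvg0.
move/cvge_to_ge; apply; near=> m; apply: h; near: m; exact: nbhs_infty_ge.
Unshelve. all: by end_near.
Qed.

(** Jensen's inequality without conditional expectations: the subgradient inequality at F n is
    integrated over the set E N, where the truncated slope is the slope divided by W and the linear
    term integrates to 0. Then N tends to infinity. *)
Lemma integral_le_limit n : (\int[P]_z (Phi (F n z))%:E <= \int[P]_z (Phi (g z))%:E)%E.
Proof.
pose E N z := (`|F n z| <= N%:R) && (N.+1%:R^-1 <= W z).
pose H N z := if E N z then Phi (F n z) else 0.
have mPF : measurable_fun setT (fun z => Phi (F n z)).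
  by apply: measurableT_comp => //; exact: even_ext_measurable.
have mH N : measurable_fun setT (H N).
  apply: measurable_fun_ifT => //; apply: measurable_and; apply: measurable_fun_ler => //.
  exact: measurableT_comp.
have H0 N z : 0 <= H N z by rewrite /H; case: ifP => // _; exact: even_ext_ge0.
apply: (@fatou_cvg _ _ _ P (fun N z => (H N z)%:E) _ (fun=> \int[P]_z (Phi (g z))%:E)%E) => //.
- by move=> N; exact/measurable_EFinP.
- exact/measurable_EFinP.
- by move=> z; rewrite lee_fin even_ext_ge0.
- apply: nearW => z; apply: cvg_near_cst.
  have [N1 hN1] : exists N1, forall N, (N1 <= N)%N -> `|F n z| <= N%:R.
    exists (Num.bound `|F n z|) => N hN; rewrite ltW//.
    by apply: lt_le_trans (archi_boundP (normr_ge0 _)) _; rewrite ler_nat.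
  have [N2 hN2] : exists N2, forall N, (N2 <= N)%N -> N.+1%:R^-1 <= W z.
    exists (Num.bound (W z)^-1) => N hN; rewrite invf_ple ?posrE// ltW//.
    have W0 : 0 <= (W z)^-1 by rewrite invr_ge0 ltW.
    by apply: lt_le_trans (archi_boundP W0) _; rewrite ler_nat leqW.
  exists (maxn N1 N2) => // N /=; rewrite geq_max => /andP[h1 h2].
  by rewrite /H /E hN1// hN2.
- move=> N; have [ik k0] := limit_orthogonal n N.
  have := integral_cancel (E := fun=> 0) (H1 := H N) (H2 := fun z => Phi (g z)) _ _ _ _ _ _ ik k0 _.
  rewrite integral0 add0e; apply => //.
  + by apply: measurableT_comp => //; exact: even_ext_measurable.
  + by move=> z; exact: even_ext_ge0.
  apply: nearW => z; rewrite add0r /H /truncated_slope -/(E N z); case: ifPn => Ez.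
    rewrite [X in _ + X](_ : _ = subgradient (even_ext_convex phi_finite) (F n z) * (g z - F n z)).
      exact: subgradientP.
    by field; rewrite gt_eqF.
  by rewrite mul0r mul0r addr0 even_ext_ge0.
- exact: cvg_cst.
Qed.

(** Convexity and the growth condition dominate the integrand by C (Phi (F n) + Phi g) + 2 C k, as
    Pratt's theorem requires. *)
Lemma modular_cvg0 (k : R) : 0 <= k -> (k%:E * P setT < +oo)%E ->
  (forall l : R, exists2 C : R, 0 <= C & forall x, Phi (l * x) <= C * (Phi x + k)) ->
  forall l, (\int[P]_z (Phi (l * (F n z - g z)))%:E @[n --> \oo] --> 0)%E.
Proof.
move=> k0 kP hk l; have [C C0 hC] := hk (2 * l).
have cPhi : continuous Phi by exact: even_ext_continuous.
have mPhi' : measurable_fun setT Phi by exact: even_ext_measurable.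
apply: (@pratt _ _ _ P (fun n z => Phi (l * (F n z - g z))) (fun n z => Phi (F n z))
    (fun z => Phi (g z)) (fun=> 2 * C * k) C) => //.
- by move=> n; apply: measurableT_comp => //; apply: measurable_funM => //; exact: measurable_funB.
- by move=> n; exact: measurableT_comp.
- exact: measurableT_comp.
- by move=> n z; exact: even_ext_ge0.
- by move=> n z; exact: even_ext_ge0.
- by move=> z; exact: even_ext_ge0.
- by move=> z; rewrite !mulr_ge0.
- move=> n z; rewrite mulrBr; apply: le_trans (even_ext_half phi_finite _ _) _.
  have -> : 2 * - (l * g z) = - (2 * l * g z) by rewrite mulrN mulrA.
  rewrite -(even_ext_norm _ (- _)) normrN even_ext_norm mulrA.
  by apply: le_trans (lerD (hC _) (hC _)) _; rewrite le_eqVlt; apply/orP; left; apply/eqP; ring.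
- apply: filterS Fg => z Fz; rewrite -(even_ext0 phi) -(mulr0 l) -(subrr (g z)).
  have h : l * (F n z - g z) @[n --> \oo] --> l * (g z - g z).
    by apply: cvgM; [exact: cvg_cst|apply: cvgB => //; exact: cvg_cst].
  by apply: (cvg_comp _ _ h); exact: cPhi.
- by apply: filterS Fg => z Fz; apply: (cvg_comp _ _ Fz); exact: cPhi.
- exact: integral_le_limit.
- by apply: le_lt_trans integral_limit_le _; exact: ltry.
rewrite integral_cst// EFinM -muleA lte_mul_pinfty//.
- by rewrite lee_fin mulr_ge0.
Qed.

End modular_convergence.

(** * Convergence of the averages in L_phi and approximation of the scalar density *)

Section averages.
Context dS (S : measurableType dS) d (T : measurableType d) (R : realType).
Variables (nu : {finite_measure set S -> \bar R}) (mu : {sigma_finite_measure set T -> \bar R}).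
Variable phi : orlicz_function R.
Hypothesis phi_finite : finite_orlicz phi.
Variable m : set S -> L_phi mu phi.
Hypothesis mfa : finitely_additive m.
Hypothesis mle : forall A, measurable A -> `|m A| <= fine (nu A).
Local Notation Phi := (even_ext phi).
Local Notation P := (nu \x mu)%E.
Local Notation F := (average_kernel nu m).
Local Notation x_ := (cell_average nu m).
Local Notation cell_mean := (cell_mean nu m).

(** The Amemiya bound with factor k: when the modular is small the norm is at most about 1/k, which
    is why modular convergence is needed for every k. *)
Lemma norm_cell_mean_sub q i (f : T -> R) (fO : f \in orlicz_class mu phi) (k : R) : 0 < k ->
  ((`|cell_mean q i - L_phi_of fO|)%:E <=
    (1 + \int[mu]_t (Phi (k * (x_ q i t - f t)))%:E) * (k^-1)%:E)%E.
Proof.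
move=> k0; have mf : measurable_fun setT f by exact: orlicz_class_measurable fO.
have mx : measurable_fun setT (x_ q i) by exact: cell_average_measurable.
have mxf : measurable_fun setT (fun t => x_ q i t - f t) by exact: measurable_funB.
have -> : `|cell_mean q i - L_phi_of fO| = luxemburg_norm mu phi (fun t => x_ q i t - f t).
  apply: L_phi_norm_ae => //.
  have := orlicz_repr_lin (cell_mean q i) (L_phi_of fO) 1; rewrite scale1r.
  have := orlicz_reprZ (fine (nu (q @^-1` [set i])))^-1 (m (q @^-1` [set i])).
  apply: filterS3 (repr_L_phi_of fO) => t h1 h2 h3 tT.
  by rewrite h3// mul1r h1// h2.
have I0 : (0 <= \int[mu]_t (Phi (k * (x_ q i t - f t)))%:E)%E.
  by apply: integral_ge0 => t _; rewrite lee_fin even_ext_ge0.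
have [Ioo|Ioo] := eqVneq (\int[mu]_t (Phi (k * (x_ q i t - f t)))%:E)%E +oo%E.
  by rewrite Ioo addey// gt0_mulye ?lte_fin ?invr_gt0// leey.
have If : (\int[mu]_t (Phi (k * (x_ q i t - f t)))%:E)%E \is a fin_num.
  by rewrite ge0_fin_numE// ltey.
rewrite -(fineK If) -EFinD -EFinM lee_fin; apply: luxemburg_norm_modular => //.
  exact: fine_ge0.
by rewrite fineK// /modular; under eq_integral do rewrite even_extE//.
Qed.

(** Compared with [average_limit], q is also required to be successively refined: orthogonality is
    applied between q n and all later partitions of the same sequence. *)
Lemma average_cvg (H : nat -> S -> nat) :
  N_function_at_infinity phi -> appropriate_Delta2 mu phi ->
  (forall n, exists N, label (H n) N) ->
  exists (p : nat -> S -> nat) (g : S * T -> R),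
  [/\ forall n, exists N, label (p n) N,
      forall n, refines (p n.+1) (p n),
      forall n, refines (p n) (H n),
      measurable_fun setT g /\ (\int[P]_z (Phi (g z))%:E < +oo)%E &
      forall q : nat -> S -> nat, (forall n, exists N, label (q n) N) ->
        (forall n, refines (q n) (p n)) -> (forall n, refines (q n.+1) (q n)) ->
        forall k : R, (\int[P]_z (Phi (k * (F (q n) z - g z)))%:E @[n --> \oo] --> 0)%E].
Proof.
move=> phiN phiD lH.
have [w [mw w0 w1 wfin]] := integrable_positive_weight mu.
have [p [g [lp pp pH mg pg]]] := average_limit phi_finite mfa mle mw w0 w1 wfin lH.
have nufin : nu setT \is a fin_num by exact: fin_num_measure.
have mF q N : label q N -> measurable_fun setT (F q) by exact: average_kernel_measurable.
have Fle q N : label q N -> (\int[P]_z (Phi (F q z))%:E <= (fine (nu setT))%:E)%E.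
  by move=> lq; rewrite fineK//; exact: integral_kernel_le lq.
have mFp n : measurable_fun setT (F (p n)) by have [N lpn] := lp n; exact: mF lpn.
exists p, g; split => //.
  split => //; apply: (@le_lt_trans _ _ (fine (nu setT))%:E); last exact: ltry.
  apply: (@integral_limit_le _ _ _ P _ phi_finite (fun n => F (p n))) => //.
    by apply: pg => // n; exact: refines_refl.
  by move=> n; have [N lpn] := lp n; exact: Fle lpn.
move=> q lq qp qq.
have [k [k0 kmu] hk] := Delta2_growth phi_finite phiD.
have mFq n : measurable_fun setT (F (q n)) by have [N lqn] := lq n; exact: mF lqn.
have mw2 : measurable_fun setT (fun z : S * T => w z.2) by exact: measurableT_comp.
have qqm n i : refines (q (n + i)%N) (q n).
  elim: i => [|i IH]; first by rewrite addn0; exact: refines_refl.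
  by rewrite addnS; exact: refines_trans (qq _) IH.
apply: (@modular_cvg0 _ _ _ P _ phi_finite (fun z => w z.2) _ g (fine (nu setT))
  mw2 _ _ _ mFq mg _ _ _ _ k) => //.
- rewrite fubini_tonelli1//=; last first.
  + by move=> z; rewrite lee_fin ltW.
  + exact/measurable_EFinP.
  rewrite /fubini_F/= integral_cst// lte_mul_pinfty//; last by rewrite ltey_eq nufin.
    by apply: integral_ge0 => t _; rewrite lee_fin ltW.
  rewrite ge0_fin_numE//; by apply: integral_ge0 => t _; rewrite lee_fin ltW.
- exact: pg.
- by move=> n; have [N lqn] := lq n; exact: Fle lqn.
- exact: N_function_growth.
(* The truncated slope may depend on t through w t, since orthogonality admits functions of t chosen
   cell by cell. *)
- move=> n i N; move/subnKC <-; have [K lqn] := lq n; have [M lqi] := lq (n + (i - n))%N.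
  have [C bC] := truncated_slope_bounded phi_finite N.
  apply: (integral_kernel_orthogonal phi_finite mfa mle mw w0 w1 wfin lqn lqi (qqm n _)
    (b := fun j t => truncated_slope phi_finite N (x_ (q n) j t) (w t)) (C := C)).
  + by move=> j; apply: truncated_slope_measurable => //; exact: cell_average_measurable.
  + by move=> j t; exact: bC.
have PE : ((nu \x mu) setT = nu setT * mu setT)%E by rewrite -setXTT product_measure1E.
rewrite [ltLHS](_ : _ = nu setT * (k%:E * mu setT))%E; last by rewrite [RHS]muleCA -PE.
by rewrite lte_mul_pinfty// ltey_eq nufin.
Qed.

End averages.

Section label_integrals.
Import HBNNSimple.
Context d (S : measurableType d) (R : realType).

Lemma integral_cells (nu : {measure set S -> \bar R}) (q : S -> nat) N (A : set S) (f : S -> \bar R) :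
  label q N -> measurable A -> measurable_fun A f -> (forall s, (0 <= f s)%E) ->
  (\int[nu]_(s in A) f s = \sum_(i < N) \int[nu]_(s in A `&` q @^-1` [set (i : nat)]) f s)%E.
Proof.
move=> lq mA mf f0.
have AE : A = \big[setU/set0]_(i < N) (A `&` q @^-1` [set (i : nat)]).
  rewrite -bigcup_seq; apply/seteqP; split=> [s As|s [i _ []]//].
  by exists (Ordinal (lq.2 s)) => //=; exact: mem_index_enum.
rewrite {1}AE ge0_integral_bigsetU//.
- by move=> i; apply: measurableI => //; exact: measurable_label lq.
- exact: index_enum_uniq.
- move=> i j _ _ [s [[_ /= si] [_ /= sj]]]; apply/val_inj.
  by rewrite /= -si -sj.
- by rewrite -AE.
Qed.

(** The H n are labellings by the values of the standard increasing simple approximations, which h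
    dominates. They are imposed on the partitions so that the scalar density is nearly constant, in
    the mean, on their cells. *)
Lemma label_approximation (nu : {finite_measure set S -> \bar R}) (h : S -> R) :
  measurable_fun setT h -> (forall s, 0 <= h s) -> (\int[nu]_s (h s)%:E < +oo)%E ->
  exists (H : nat -> S -> nat) (c : nat -> nat -> R),
    (forall n, exists N, label (H n) N) /\
    (\int[nu]_s (`|c n (H n s) - h s|)%:E @[n --> \oo] --> 0)%E.
Proof.
move=> mh h0 hfin.
have mhE : measurable_fun setT (EFin \o h) by exact/measurable_EFinP.
pose a n : S -> R := nnsfun_approx measurableT mhE n.
have ah x : a n x @[n --> \oo] --> h x.
  have : (a n x)%:E @[n --> \oo] --> (h x)%:E.
    by apply: (cvg_nnsfun_approx measurableT mhE) => // s _; rewrite lee_fin.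
  by move/fine_cvgP => [].
have nda := @nd_nnsfun_approx _ _ _ _ measurableT _ mhE.
have sa n : simple_function (a n : S -> R^o).
  split; first exact: fimfunP.
  by move=> x; exact: measurable_sfunP.
have /choice[H /choice[c hHc]] : forall n, exists H c, (exists N, label H N) /\ (a n : S -> R^o) = c \o H.
  by move=> n; have [N [p [c [lp ->]]]] := simple_functionP (sa n); exists p, c; split => //; exists N.
exists H, c; split => [n|]; first exact: (hHc n).1.
have aE n s : c n (H n s) = a n s by have := congr1 (fun f => f s) (hHc n).2.
have ale n s : a n s <= h s.
  apply: (cvgr_to_ge (ah s)); near=> k.
  have nk : (n <= k)%N by near: k; exact: nbhs_infty_ge.
  by have /lefP := nda _ _ nk; exact.
have [] := @dominated_convergence _ _ _ nu setT measurableT (fun n s => (`|a n s - h s|)%:E)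
  (fun=> 0%E) (fun s => (h s)%:E).
- move=> n; apply/measurable_EFinP; apply: measurableT_comp => //; exact: measurable_funB.
- exact: measurable_cst.
- apply: nearW => s _; apply: cvg_EFin; first exact: nearW.
  by apply/norm_cvg0P; rewrite -(subrr (h s)); apply: cvgB => //; exact: cvg_cst.
- apply/integrableP; split => //.
  by under eq_integral do rewrite gee0_abs ?lee_fin//.
- apply: nearW => s n _; rewrite gee0_abs ?lee_fin// distrC ger0_norm ?subr_ge0//.
  by rewrite gerBl.
by move=> _ _; rewrite integral0; under eq_fun do under eq_integral do rewrite -aE.
Unshelve. all: by end_near.
Qed.

End label_integrals.

(** * The density relative to nu and its simple approximations *)

Section density.
Context dS (S : measurableType dS) d (T : measurableType d) (R : realType).
Variables (nu V : {finite_measure set S -> \bar R}) (mu : {sigma_finite_measure set T -> \bar R}).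
Variable phi : orlicz_function R.
Hypothesis phi_finite : finite_orlicz phi.
Variable m : set S -> L_phi mu phi.
Hypothesis mfa : finitely_additive m.
Hypothesis mle : forall A, measurable A -> `|m A| <= fine (V A).
Variable h : S -> R.
Hypothesis mh : measurable_fun setT h.
Hypothesis h_ge0 : forall s, 0 <= h s.
Hypothesis VE : forall A, measurable A -> V A = (\int[nu]_(s in A) (h s)%:E)%E.
Hypothesis integral_density : forall k : S -> \bar R, measurable_fun setT k ->
  (forall s, (0 <= k s)%E) -> (\int[nu]_s (k s * (h s)%:E) = \int[V]_s k s)%E.
Variable g : S * T -> R.
Hypothesis mg : measurable_fun setT g.
Local Notation Phi := (even_ext phi).
Local Notation P := (V \x mu)%E.
Hypothesis g_fin : (\int[P]_z (Phi (g z))%:E < +oo)%E.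
Local Notation F := (average_kernel V m).
Local Notation x_ := (cell_average V m).

Let J s : \bar R := (\int[mu]_t (Phi (g (s, t)))%:E)%E.

Let mPhi (f : S * T -> R) : measurable_fun setT f -> measurable_fun setT (fun z => (Phi (f z))%:E).
Proof.
by move=> mf; apply/measurable_EFinP; apply: measurableT_comp mf; exact: even_ext_measurable.
Qed.

Let section_class s : (J s < +oo)%E -> (fun t => g (s, t)) \in orlicz_class mu phi.
Proof.
move=> Js; rewrite inE; split; first exact: measurableT_comp.
by exists 1 => //; rewrite /modular; under eq_integral do rewrite mul1r even_extE//.
Qed.

(* The value 0 is used only where the section is not in the Orlicz class, which
   happens almost nowhere on {h != 0}. *)
Definition density s : L_phi mu phi :=
  h s *: (if pselect (J s < +oo)%E is left Js then L_phi_of (section_class Js) else 0).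

Let J_ge0 s : (0 <= J s)%E.
Proof. by apply: integral_ge0 => t _; rewrite lee_fin even_ext_ge0. Qed.

Let mJ : measurable_fun setT J.
Proof.
apply: (@measurable_fun_fubini_tonelli_F _ _ _ _ _ mu (fun z => (Phi (g z))%:E)).
- exact: mPhi.
- by move=> z; rewrite lee_fin even_ext_ge0.
Qed.

(** By the change of variables from nu to V and Tonelli's theorem, J h has as nu-integral the
    integral of Phi g, which is finite. *)
Let ae_section : {ae nu, forall s, h s = 0 \/ (J s < +oo)%E}.
Proof.
have ik : nu.-integrable setT (fun s => J s * (h s)%:E)%E.
  apply/integrableP; split.
    by apply: emeasurable_funM => //; exact/measurable_EFinP.
  rewrite (eq_integral (fun s => J s * (h s)%:E))%E; last first.
    by move=> s _; rewrite gee0_abs// mule_ge0// lee_fin.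
  rewrite integral_density//; move: g_fin; rewrite fubini_tonelli1//.
  - exact: mPhi.
  - by move=> z; rewrite lee_fin even_ext_ge0.
have := integrable_ae measurableT ik; apply: filterS => s /(_ I) Jh.
have [->|hs] := eqVneq (h s) 0; first by left.
right; rewrite ltey; apply/eqP => Joo; move: Jh.
by rewrite Joo gt0_mulye// lte_fin lt_neqAle eq_sym hs h_ge0.
Qed.

Variables (q : nat -> S -> nat) (c : nat -> nat -> R).
Hypothesis lq : forall n, exists N, label (q n) N.
Hypothesis ch : (\int[nu]_s (`|c n (q n s) - h s|)%:E @[n --> \oo] --> 0)%E.
Hypothesis Fg : forall k : R, (\int[P]_z (Phi (k * (F (q n) z - g z)))%:E @[n --> \oo] --> 0)%E.

(** On each cell, the average of m relative to V times an approximate value of the density of V. *)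
Definition density_step n : S -> L_phi mu phi :=
  (fun i => c n i *: cell_mean V m (q n) i) \o q n.

Let ch_abs n s : \bar R := (`|c n (q n s) - h s|)%:E.

Let mch n : measurable_fun setT (ch_abs n).
Proof.
apply/measurable_EFinP; apply: measurableT_comp => //; apply: measurable_funB => //.
by have [N [mqn _]] := lq n; exact: (measurableT_comp (f := c n)).
Qed.

Let gap k n s : \bar R := (\int[mu]_t (Phi (k * (F (q n) (s, t) - g (s, t))))%:E)%E.

Let gap_ge0 k n s : (0 <= gap k n s)%E.
Proof. by apply: integral_ge0 => t _; rewrite lee_fin even_ext_ge0. Qed.

Let mgapz k n : measurable_fun setT (fun z => (Phi (k * (F (q n) z - g z)))%:E).
Proof.
apply: mPhi; apply: measurable_funM => //; apply: measurable_funB => //.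
by have [N lqn] := lq n; exact: average_kernel_measurable lqn.
Qed.

Let mgap k n : measurable_fun setT (gap k n).
Proof.
apply: (@measurable_fun_fubini_tonelli_F _ _ _ _ _ mu (fun z => (Phi (k * (F (q n) z - g z)))%:E)) => //.
by move=> z; rewrite lee_fin even_ext_ge0.
Qed.

Let err k n s : \bar R := (ch_abs n s + (k^-1)%:E * (gap k n s * (h s)%:E))%E.

Let err_ge0 (k : R) n s : 0 < k -> (0 <= err k n s)%E.
Proof.
by move=> k0; rewrite adde_ge0 ?lee_fin// mule_ge0 ?lee_fin ?invr_ge0 ?(ltW k0)// mule_ge0// lee_fin.
Qed.

Let merr k n : measurable_fun setT (err k n).
Proof.
apply: emeasurable_funD => //; apply: measurable_funeM; apply: emeasurable_funM => //.
exact/measurable_EFinP.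
Qed.

(** With a the cell mean and G the section of g, c a - h G = (c - h) a + h (a - G). The first term
    is controlled by |a| <= 1, the second by the Amemiya bound, whose constant 1 leaves the
    remainder h / k. *)
Let density_step_le (k : R) n : 0 < k ->
  {ae nu, forall s, ((`|density_step n s - density s|)%:E <= err k n s + (k^-1 * h s)%:E)%E}.
Proof.
move=> k0; apply: filterS ae_section => s hJ.
rewrite /density_step/= /density; have [N lqn] := lq n.
set a := cell_mean V m (q n) (q n s); set G := (X in _ - _ *: X).
have -> : c n (q n s) *: a - h s *: G = (c n (q n s) - h s) *: a + h s *: (a - G).
  by rewrite scalerBl scalerBr addrA subrK.
apply: (@le_trans _ _ (ch_abs n s + (h s)%:E * (`|a - G|)%:E)%E).
  have : `|a| <= 1 by exact: (norm_cell_mean_le mle _ lqn).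
  rewrite -EFinM -EFinD lee_fin; move: (a) => b b1.
  apply: le_trans (ler_normD _ _) _; rewrite !normrZ.
  by rewrite (ger0_norm (h_ge0 s)) lerD2r ler_piMr.
rewrite /err -addeA leeD2lE//.
have [h0|Js] := hJ.
  by rewrite h0 mul0e mule0 mulr0 mule0 add0e.
have aG : ((`|a - G|)%:E <= (1 + gap k n s) * (k^-1)%:E)%E.
  by rewrite /G; case: pselect => // Js'; exact: norm_cell_mean_sub.
apply: le_trans (lee_wpmul2l (_ : (0 <= (h s)%:E)%E) aG) _; first by rewrite lee_fin.
rewrite ge0_muleDl// mul1e ge0_muleDr ?mule_ge0// ?lee_fin ?invr_ge0 ?(ltW k0)//.
rewrite [leLHS]addeC EFinM (muleC (k^-1)%:E (h s)%:E) leeD2rE//.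
by rewrite [leRHS]muleC -!muleA [leRHS]muleCA.
Qed.

Let err_cvg0 (k : R) : 0 < k -> (\int[nu]_s err k n s @[n --> \oo] --> 0)%E.
Proof.
move=> k0; have k1 : 0 <= k^-1 by rewrite invr_ge0 ltW.
have gh0 n s : (0 <= gap k n s * (h s)%:E)%E by rewrite mule_ge0// lee_fin.
have mgh n : measurable_fun setT (fun s => gap k n s * (h s)%:E)%E.
  by apply: emeasurable_funM => //; exact/measurable_EFinP.
rewrite (_ : (fun n => _) = (fun n => \int[nu]_s ch_abs n s +
    (k^-1)%:E * \int[P]_z (Phi (k * (F (q n) z - g z)))%:E)%E).
  rewrite -[X in _ --> X]adde0 -[X in _ --> (_ + X)%E](mule0 (k^-1)%:E).
  apply: cvgeD => //; apply: cvgeZl => //; exact: Fg.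
apply/funext => n; rewrite ge0_integralD//; last 3 first.
- by move=> s _; rewrite lee_fin.
- by move=> s _; rewrite mule_ge0 ?lee_fin.
- exact: measurable_funeM.
rewrite ge0_integralZl//; congr (_ + _ * _)%E; rewrite integral_density//.
rewrite fubini_tonelli1// => z; by rewrite lee_fin even_ext_ge0.
Qed.

Let simple_density_step n : simple_function (density_step n).
Proof. by have [N lqn] := lq n; exact: simple_label lqn. Qed.

Let V_fin : V setT \is a fin_num. Proof. exact: fin_num_measure. Qed.

Lemma density_approximates : approximates_in_mean nu density_step density.
Proof.
split => //; apply: cvge0_le => [n|e e0]; first by apply: integral_ge0 => s _; rewrite lee_fin.
(* The remainder h / k has integral V(S) / k, which is at most e for this k. *)
pose k := (fine (V setT) + 1) / e.
have V1 : 0 < fine (V setT) + 1 by rewrite ltr_wpDl// fine_ge0.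
have k0 : 0 < k by rewrite divr_gt0.
exists (fun n => \int[nu]_s err k n s)%E; first exact: err_cvg0.
move=> n; apply: (@le_trans _ _ (\int[nu]_s (err k n s + (k^-1 * h s)%:E))%E).
  apply: ae_le_lower_integral; last exact: density_step_le.
  - by move=> s; rewrite lee_fin.
  - by move=> s; rewrite adde_ge0 ?err_ge0// lee_fin mulr_ge0// invr_ge0 ltW.
have kh0 s : (0 <= (k^-1 * h s)%:E)%E by rewrite lee_fin mulr_ge0// invr_ge0 ltW.
rewrite ge0_integralD//; last 2 first.
- by move=> s _; exact: err_ge0.
- by apply/measurable_EFinP; exact: measurable_funM.
apply: leeD => //; under eq_integral do rewrite EFinM.
rewrite ge0_integralZl//; last 3 first.
- exact/measurable_EFinP.
- by move=> s _; rewrite lee_fin.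
- by rewrite lee_fin invr_ge0 ltW.
rewrite -VE// -(fineK V_fin) -EFinM lee_fin /k invf_div mulrAC ler_pdivrMr//.
by rewrite ler_wpM2l// ?(ltW e0)// lerDl.
Qed.

(** Pointwise convergence needs the factor and the index to grow together. For the factor k + 1 an
    index n k with error integral at most 4^-k is chosen; almost everywhere the error is then at
    most a multiple of 2^-k, and the remainder h / (k + 1) tends to 0. *)
Lemma density_strongly_measurable : strongly_measurable nu density.
Proof.
have pos k : 0 < (k.+1%:R : R) by [].
have /choice[n hn] : forall k : nat, exists n, (\int[nu]_s err k.+1%:R n s <= (4^-1 ^+ k)%:E)%E.
  move=> k; have e0 : 0 < (4^-1 ^+ k : R) by rewrite exprn_gt0// invr_gt0.
  have [N _ hN] := cvge0_near (err_cvg0 (pos k)) e0.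
  by exists N; apply/ltW/hN => /=.
exists (fun k => density_step (n k)); split => //.
have bnd : {ae nu, forall s, exists C : R, forall k, ((2 ^+ k)%:E * err k.+1%:R (n k) s <= C%:E)%E}.
  apply: (@ae_bounded _ _ _ nu (fun k s => (2 ^+ k)%:E * err k.+1%:R (n k) s)%E 1).
  - by move=> k; exact: measurable_funeM.
  - by move=> k s; rewrite mule_ge0 ?err_ge0// lee_fin exprn_ge0.
  move=> k; rewrite ge0_integralZl//; last by move=> s _; exact: err_ge0.
  have -> : (1 * 2^-1 ^+ k)%:E = ((2 ^+ k)%:E * (4^-1 ^+ k)%:E : \bar R)%E.
    by rewrite -EFinM mul1r -exprMn; congr ((_ ^+ _)%:E); field.
  by apply: lee_wpmul2l => //; rewrite lee_fin exprn_ge0.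
have := ae_foralln (fun k => density_step_le (n k) (pos k)).
apply: filterS2 bnd => s [C hC] hs.
apply/cvgrPdist_le => e e0.
have lim0 : C * 2^-1 ^+ k + k.+1%:R^-1 * h s @[k --> \oo] --> (0 : R).
  rewrite -[X in _ --> X]addr0 -[X in _ --> X + _](mulr0 C) -[X in _ --> _ + X](mul0r (h s)).
  apply: cvgD; apply: cvgM; do ?exact: cvg_cst.
  - by apply: cvg_expr; rewrite ger0_norm ?invr_ge0// invf_lt1// ltr1n.
  - exact: cvg_harmonic.
move/cvgrPdist_le : lim0 => /(_ _ e0); apply: filterS => k; apply: le_trans.
rewrite sub0r normrN.
apply: le_trans (ler_norm _); rewrite distrC -lee_fin; apply: le_trans (hs k) _.
rewrite EFinD leeD2rE//.
rewrite -(@lee_pmul2l _ (2 ^+ k)%:E)// ?lte_fin ?exprn_gt0//.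
apply: le_trans (hC k) _; rewrite -EFinM mulrCA -exprMn divff// expr1n mulr1.
by [].
Qed.

(** As A is saturated, m A is the sum of the cell means with coefficients V (A [&] C i), the
    integrals of h, in place of c times nu (A [&] C i). The means have norm at most 1, so the error
    is at most the mean of |c - h|. *)
Lemma simple_integral_density_step A : measurable A ->
  (forall n s s', q n s = q n s' -> A s -> A s') ->
  simple_integral nu A (density_step n) @[n --> \oo] --> m A.
Proof.
move=> mA sat.
have key n : ((`|m A - simple_integral nu A (density_step n)|)%:E <= \int[nu]_s ch_abs n s)%E.
  have [N lqn] := lq n; pose C i := q n @^-1` [set i].
  have mC i : measurable (A `&` C i) by apply: measurableI => //; exact: measurable_label lqn.
  rewrite (sum_cell_mean mfa mle lqn mA (sat n)) (simple_integral_label nu _ lqn mA) -sumrB.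
  apply: (@le_trans _ _ (\sum_(i < N) \int[nu]_(s in A `&` C i) ch_abs n s)%E); last first.
    rewrite -integral_cells//.
    - by apply: ge0_subset_integral => // s _; rewrite lee_fin.
    - exact: measurable_funTS.
    - by move=> s; rewrite lee_fin.
  apply: (@le_trans _ _ (\sum_(i < N) (`|fine (V (A `&` C i)) *: cell_mean V m (q n) i -
      fine (nu (A `&` C i)) *: (c n i *: cell_mean V m (q n) i)|)%:E)%E).
    by rewrite sumEFin lee_fin; exact: ler_norm_sum.
  apply: lee_sum => i _; have := norm_cell_mean_le mle i lqn.
  move: (cell_mean _ _ _ _) => b b1; rewrite scalerA -scalerBl normrZ.
  have ih : nu.-integrable (A `&` C i) (fun s => (h s)%:E).
    apply: (integrableS measurableT) => //; apply/integrableP; split; first exact/measurable_EFinP.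
    under eq_integral do rewrite gee0_abs ?lee_fin//.
    by rewrite -VE// ltey_eq V_fin.
  have ic : nu.-integrable (A `&` C i) (fun=> (c n i)%:E).
    exact: finite_measure_integrable_cst.
  apply: (@le_trans _ _ (`|\int[nu]_(s in A `&` C i) (h s - c n i)%:E|)%E).
    under eq_integral do rewrite EFinB.
    have VAC : V (A `&` C i) \is a fin_num by exact: fin_num_measure.
    have nuAC : nu (A `&` C i) \is a fin_num by exact: fin_num_measure.
    rewrite integralB// -VE// integral_cst//.
    have -> : (V (A `&` C i) - (c n i)%:E * nu (A `&` C i) =
        (fine (V (A `&` C i)) - fine (nu (A `&` C i)) * c n i)%:E)%E.
      by rewrite EFinB EFinM !fineK// muleC.
    by rewrite abse_EFin lee_fin ler_piMr.
  apply: le_trans (le_abse_integral nu (mC i) _) _.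
    by apply/measurable_EFinP/measurable_funTS; exact: measurable_funB.
  rewrite (eq_integral (ch_abs n))// => s; rewrite inE => -[_ /= qs].
  by rewrite /ch_abs qs distrC.
apply/cvgrPdist_le => e e0; have := cvge0_near ch e0; apply: filterS => n ne.
by rewrite -lee_fin; apply: le_trans (key n) (ltW ne).
Qed.

End density.

Lemma refines_join d (S : measurableType d) (p p' q : S -> nat) : refines p' p -> refines (join p' q) (join p q).
Proof.
move=> [r pr]; exists (fun i => if @unpickle (nat * nat)%type i is Some ij
  then pickle (r ij.1, ij.2) else 0%N).
by apply/funext => s; rewrite /join /= pickleK /= pr.
Qed.

(** * Sufficiency and the theorem *)

Section sufficiency.
Context d (T : measurableType d) (R : realType).
Variables (mu : {sigma_finite_measure set T -> \bar R}) (phi : orlicz_function R).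
Hypothesis phi_finite : finite_orlicz phi.

Lemma variation_null dS (S : measurableType dS) (nu : {finite_measure set S -> \bar R})
    (X : normedModType R) (m : set S -> X) A :
  Defs.absolutely_continuous nu m -> measurable A -> nu A = 0%E -> Defs.variation m A = 0%E.
Proof.
move=> mac mA A0; apply/eqP; rewrite eq_le; apply/andP; split; last first.
  exact: variation_ge0.
apply: ge_ereal_sup => _ [n [F [mF tF UF ->]]]; rewrite lee_fin big1// => i _.
rewrite mac ?normr0//; apply/eqP; rewrite -measure_le0 -A0; apply: le_measure; rewrite ?inE//.
by rewrite -UF => s Fs; exists i.
Qed.

Lemma rnp_of_N_function_Delta2 : N_function_at_infinity phi -> appropriate_Delta2 mu phi ->
  radon_nikodym_property (L_phi mu phi).
Proof.
move=> phiN phiD dS S nu m mca mfin mac.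
pose V : {finite_measure set S -> \bar R} := finite_variation_measure mca mfin.
have mfa := countably_additive_finitely mca.
have VE A : measurable A -> V A = Defs.variation m A by move=> mA; exact: finite_variation_measureE.
have mle A : measurable A -> `|m A| <= fine (V A).
  move=> mA; rewrite -lee_fin fineK; last exact: fin_num_measure.
  by rewrite VE//; exact: le_norm_variation.
have Vnu : V `<< nu.
  by move=> A nA B mB BA; rewrite VE//; apply: (variation_null mac mB); exact: nA.
pose h s := fine (Radon_Nikodym_SigmaFinite.f V nu s).
have hE s : (h s)%:E = Radon_Nikodym_SigmaFinite.f V nu s.
  by rewrite fineK//; exact: Radon_Nikodym_SigmaFinite.f_fin_num.
have h_ge0 s : 0 <= h s by rewrite fine_ge0//; exact: Radon_Nikodym_SigmaFinite.f_ge0.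
have mh : measurable_fun setT h.
  apply: measurableT_comp => //.
  by have /integrableP[] := Radon_Nikodym_SigmaFinite.f_integrable Vnu.
have Vh A : measurable A -> V A = (\int[nu]_(s in A) (h s)%:E)%E.
  by move=> mA; under eq_integral do rewrite hE; exact: Radon_Nikodym_SigmaFinite.f_integral.
have cov (k : S -> \bar R) : measurable_fun setT k -> (forall s, (0 <= k s)%E) ->
    (\int[nu]_s (k s * (h s)%:E) = \int[V]_s k s)%E.
  move=> mk k0; under eq_integral do rewrite hE.
  exact: Radon_Nikodym_SigmaFinite.change_of_variables.
have hfin : (\int[nu]_s (h s)%:E < +oo)%E by rewrite -Vh// ltey_eq fin_num_measure.
have [H [c [lH ch]]] := label_approximation mh h_ge0 hfin.
have [p [g [lp pp pH [mg gfin] pg]]] := average_cvg phi_finite mfa mle phiN phiD lH.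
pose D := density mu phi_finite h mg.
(* Any q refining p also refines H, so the values c approximating h can be reindexed by the labels
   of q. *)
have step (q : nat -> S -> nat) : (forall n, exists N, label (q n) N) ->
    (forall n, refines (q n) (p n)) -> (forall n, refines (q n.+1) (q n)) ->
    exists2 c' : nat -> nat -> R, (\int[nu]_s (`|c' n (q n s) - h s|)%:E @[n --> \oo] --> 0)%E &
      forall k : R, (\int[V \x mu]_z (even_ext phi (k * (average_kernel V m (q n) z - g z)))%:E
        @[n --> \oo] --> 0)%E.
  move=> lq qp qq.
  have /choice[r hr] n : exists r, H n = r \o q n by exact: refines_trans (qp n) (pH n).
  exists (fun n i => c n (r n i)); last exact: pg.
  by under eq_fun => n do under eq_integral => s _ do
    rewrite -[r n (q n s)]/((r n \o q n) s) -hr.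
have [c0 hc0 hF0] := step p lp (fun n => refines_refl (p n)) pp.
exists D; split.

  split; first exact: (density_strongly_measurable phi_finite mle mh h_ge0 cov mg gfin lp hc0 hF0).
  eexists; exact: (density_approximates phi_finite mle mh h_ge0 Vh cov mg gfin lp hc0 hF0).
(* The indicator of A is adjoined to each partition, which makes A saturated. The density D depends
   on g and h only, so it is the same for all A. *)
move=> A mA; pose a s : nat := s \in A.
have la : label a 2.
  split; last by move=> s; rewrite /a; case: (s \in A).
  apply: measurable_fun_cells => -[|[|i]].
  - rewrite (_ : _ @^-1` _ = ~` A); first exact: measurableC.
    apply/seteqP; split=> s /=; rewrite /a; first by case: (boolP (s \in A)) => // /negP sA _ /mem_set.
    by move=> sA; rewrite memNset.
  - rewrite (_ : _ @^-1` _ = A)//; apply/seteqP; split=> s /=; rewrite /a.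
      by case: (boolP (s \in A)) => // /set_mem.
    by move=> sA; rewrite mem_set.
  - rewrite (_ : _ @^-1` _ = set0)//; apply/seteqP; split=> s //=; rewrite /a.
    by case: (s \in A).
pose q n := join (p n) a.
have lq n : exists N, label (q n) N by have [N lpn] := lp n; exact: label_join lpn la.
have qp n : refines (q n) (p n) by exact: refines_joinl.
have qq n : refines (q n.+1) (q n) by exact/refines_join/pp.
have [c1 hc1 hF1] := step q lq qp qq.
eexists; first exact: (density_approximates phi_finite mle mh h_ge0 Vh cov mg gfin lq hc1 hF1).
apply: (simple_integral_density_step mfa mle mh h_ge0 Vh lq hc1) => //.
move=> n s s' qs As; have [r ar] := refines_joinr (p n) a.
have : a s = a s' by rewrite ar /= -/(q n) qs.
by rewrite /a mem_set//; case: (boolP (s' \in A)) => // /set_mem.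
Qed.

End sufficiency.

Theorem theorem3p5 (d : measure_display) (T : measurableType d) (R : realType)
    (mu : {sigma_finite_measure set T -> \bar R}) (phi : orlicz_function R)
    (mu_complete : measure_is_complete mu)
    (mu_non_atomic : non_atomic mu)
    (mu_pos : (0 < mu setT)%E)
    (phi_finite : finite_orlicz phi) :
  (radon_nikodym_property (L_phi mu phi) <->
     N_function_at_infinity phi /\ appropriate_Delta2 mu phi) /\
  (radon_nikodym_property (L_phi0 mu phi) <->
     N_function_at_infinity phi /\ appropriate_Delta2 mu phi).
Proof.
have main : radon_nikodym_property (L_phi mu phi) <->
    N_function_at_infinity phi /\ appropriate_Delta2 mu phi.
  split=> [rnp|[phiN phiD]]; last exact: rnp_of_N_function_Delta2.
  by split; [exact: rnp_N_function rnp|exact: rnp_Delta2 rnp].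
split; first exact: main.
by apply: iff_trans main; exact: rnp_L_phi0.
Qed.
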